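(* Let $f:\mathbb{R}^d\to\mathbb{R}$ be SPB with parameters $\mathrm{R}_1,\mathrm{R}_2,m$, with $\inf_{\mathbb{R}^d}f>-\infty$, and let $\delta\in(0,1)$. Let $\mathcal{P}=4\mathrm{R}_2+2^{m+1}\mathrm{R}_1(m+d)^{m/2}$, \[\kappa_1=\min\Big\{[2^{m+1}\mathrm{R}_1(m+d)^{m/2}]^{-1/m},\ \frac{\delta\mathcal{P}^{-1/d}}{\sqrt{d\pi e}}\Big\},\qquad\kappa_2=\frac{\delta\mathcal{P}^{-1/d}}{\sqrt{d\pi e}},\] \[\breve{\mathcal{N}}(m)=\begin{cases}\max\{\min\{5\mathrm{R}_2,1\}^{-1/\min\{m,d\}},\kappa_1\}^{4\min\{m,d\}+2}+1 & \text{if } m\ge1,\\ \max\{\min\{5\mathrm{R}_2,1\}^{-1/d},\kappa_2\}^{4d+2}+1 & \text{if } m=0.\end{cases}\] Let $T\ge\breve{\mathcal{N}}(m)$ be a positive integer, $\gamma=\sigma=\breve\sigma(m)$ where $\breve\sigma(m)=\kappa_1T^{-1/(4\min\{m,d\}+2)}$ if $m\ge1$ and $\breve\sigma(m)=\kappa_2T^{-1/(4d+2)}$ if $m=0$, and $\tau_k=\gamma/\sqrt{T+1}$ for $k=0,\dots,T$. Let $x^0\in\mathbb{R}^d$ and generate $\{x^k\}$ by: draw $u^k\sim\mathcal{N}(0,I)$ independently of the past, set $v^k=\sigma^{-1}[f(x^k+\sigma u^k)-f(x^k)]u^k$ and $x^{k+1}=x^k-\tau_kv^k/(\|x^k\|^{2m}+1)$;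 $\mathbb{E}$ denotes expectation over all the $u^k$. Let \[K=f(x^0)-\inf f+\breve{\mathcal{M}}(x^0)+0.5\breve{\mathcal{H}}_{(2)}\big(2^{2m-2}\mathrm{R}_1(m+1+d)^{\frac{m+1}{2}}+\mathrm{R}_2\sqrt d\big)+2^{2m-3}\breve{\mathcal{H}}_{(2)}\mathrm{R}_1\sqrt d+2^{m-1}\mathrm{R}_1\breve{\mathcal{H}}_{(m+2)}(m+2)^{-1}\sqrt d,\] with $\breve{\mathcal{M}}(x)=(2^{m-1}\mathrm{R}_1\|x\|^m+\mathrm{R}_2)\sqrt d+2^{m-1}\mathrm{R}_1(m+1+d)^{(m+1)/2}$ and, for integers $p\ge1$, $\breve{\mathcal{H}}_{(p)}=3^{p-1}\big(\mathrm{R}_2^p(2p+d)^p+2^{(m-1)p}\mathrm{R}_1^p[(m+2)p+d]^{(m+2)p/2}\big)$. Then: (i) If $m\ge1$, and in addition $\mathcal{S}:=\mathop{\rm arg\,min}_{\mathbb{R}^d}f$ is nonempty and bounded and there is $\mu>0$ with $f(x)-\inf f\ge\frac\mu2\mathrm{dist}(x,\mathcal{S})^2$ for all $x\in\mathbb{R}^d$, then \[\min_{0\le k\le T}\mathbb{E}\Big[\mathrm{dist}\big(0,\partial_G^\delta f(x^k)\big)^{\frac{1}{2\lceil m/2\rceil}}\Big]\le\frac{\big(1+\sqrt{\widetilde K_\Omega}\big)\big(2K^{1/2}\kappa_1^{-1/2}+2\big)^{\frac{1}{2\lceil m/2\rceil}}}{T^{\left(\frac14-\frac{1}{8\min\{m,d\}+4}\right)\frac{1}{2\lceil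 m/2\rceil}}},\] where $\widetilde K_\Omega=8\mu^{-1}K+4d+2\sup_{w\in\mathcal{S}}\|w\|^2$. (ii) If $m=0$, then \[\min_{0\le k\le T}\mathbb{E}\big[\mathrm{dist}\big(0,\partial_G^\delta f(x^k)\big)\big]\le\big(2K^{1/2}\kappa_2^{-1/2}+2\big)T^{-\left(\frac14-\frac{1}{8d+4}\right)}.\]
   Context: $\mathcal{N}(0,I)$ is the $d$-dimensional standard Gaussian distribution; $\|\cdot\|$ the Euclidean norm; $\mathrm{dist}(x,S)=\inf_{y\in S}\|x-y\|$; $\lceil\cdot\rceil$ the ceiling. For a locally Lipschitz $f$, $\partial_C f$ is the Clarke subdifferential and the Goldstein $\delta$-subdifferential is $\partial_G^\delta f(x)=\mathrm{conv}\big(\bigcup_{y\in\mathbb{B}(x,\delta)}\partial_Cf(y)\big)$, with $\mathbb{B}(x,\delta)$ the closed ball of radius $\delta$ around $x$. $f$ is SPB with parameters $\mathrm{R}_1\ge0$, $\mathrm{R}_2>0$, integer $m\ge0$ (with $\mathrm{R}_1=0$ iff $m=0$) if $f$ is locally Lipschitz and $\sup_{\zeta\in\partial_Cf(x)}\|\zeta\|\le\mathrm{R}_1\|x\|^m+\mathrm{R}_2$ for all $x$ (convention $0^0=1$). *)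

(* Defs.v *)
From HB Require Import structures.
From mathcomp Require Import all_boot all_order all_algebra.
From mathcomp Require Import all_classical all_reals all_analysis.
From mathcomp Require Import normal_distribution.

Set Implicit Arguments.
Unset Strict Implicit.
Unset Printing Implicit Defensive.

Import Order.TTheory GRing.Theory Num.Theory.
Local Open Scope classical_set_scope.
Local Open Scope ring_scope.

Section Defs.
Variables (R : realType) (d : nat).
Implicit Types (x y z zeta v : 'rV[R]_d) (f : 'rV[R]_d -> R).

Definition dotv x y : R := \sum_(i < d) x 0 i * y 0 i.
Definition enorm x : R := Num.sqrt (dotv x x).

Definition setdist x (S : set 'rV[R]_d) : R := inf [set enorm (x - y) | y in S].

Definition locally_lipschitz f : Prop :=
  forall x, exists r : R, 0 < r /\ exists L : R,
    forall y z, enorm (y - x) < r -> enorm (z - x) < r ->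
      `|f y - f z| <= L * enorm (y - z).

(* Clarke subdifferential: zeta such that <zeta, v> <= f°(x; v) for all v,
   where f°(x;v) = limsup_{y -> x, t -> 0+} (f (y + t v) - f y) / t;
   the inequality <zeta,v> <= limsup is written out with epsilons. *)
Definition clarke_subdiff f x : set 'rV[R]_d :=
  [set zeta | forall v, forall eta : R, 0 < eta -> forall eps : R, 0 < eps ->
     exists y, exists t : R, enorm (y - x) < eps /\ 0 < t /\ t < eps /\
       dotv zeta v - eta <= (f (y + t *: v) - f y) / t].

Definition conv_hull (S : set 'rV[R]_d) : set 'rV[R]_d :=
  [set z | exists n : nat, exists lam : 'I_n -> R, exists p : 'I_n -> 'rV[R]_d,
     (forall i, 0 <= lam i) /\ \sum_(i < n) lam i = 1 /\ (forall i, S (p i)) /\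
     z = \sum_(i < n) lam i *: p i].

Definition goldstein_subdiff f (delta : R) x : set 'rV[R]_d :=
  conv_hull [set zeta | exists y, enorm (y - x) <= delta /\ clarke_subdiff f y zeta].

Definition SPB f (R1 R2 : R) (m : nat) : Prop :=
  [/\ 0 <= R1, 0 < R2, (R1 = 0 <-> m = 0%N), locally_lipschitz f &
      forall x zeta, clarke_subdiff f x zeta -> enorm zeta <= R1 * enorm x ^+ m + R2].

Definition inf_f f : R := inf (range f).
Definition argmin_set f : set 'rV[R]_d := [set x | forall y, f x <= f y].

End Defs.

Section Params.
Variables (R : realType) (d m : nat) (R1 R2 delta : R).
Local Notation "a `^ b" := (powR a b).

Definition Pcal : R :=
  4 * R2 + 2 ^+ m.+1 * R1 * (m%:R + d%:R) `^ (m%:R / 2).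
Definition kappa2 : R :=
  delta * Pcal `^ (- (d%:R)^-1) / Num.sqrt (d%:R * pi * expR 1).
Definition kappa1 : R :=
  Num.min ((2 ^+ m.+1 * R1 * (m%:R + d%:R) `^ (m%:R / 2)) `^ (- (m%:R)^-1)) kappa2.
Definition qmd : nat := minn m d.
Definition Nbreve : R :=
  if (1 <= m)%N then
    (Num.max ((Num.min (5 * R2) 1) `^ (- (qmd%:R)^-1)) kappa1) ^+ (4 * qmd + 2) + 1
  else
    (Num.max ((Num.min (5 * R2) 1) `^ (- (d%:R)^-1)) kappa2) ^+ (4 * d + 2) + 1.
Definition sigma_breve (T : nat) : R :=
  if (1 <= m)%N then kappa1 * T%:R `^ (- ((4 * qmd + 2)%:R)^-1)
  else kappa2 * T%:R `^ (- ((4 * d + 2)%:R)^-1).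
Definition Mbreve (normx : R) : R :=
  (2 `^ (m%:R - 1) * R1 * normx ^+ m + R2) * Num.sqrt d%:R
  + 2 `^ (m%:R - 1) * R1 * (m%:R + 1 + d%:R) `^ ((m%:R + 1) / 2).
Definition Hbreve (p : nat) : R :=
  3 ^+ p.-1 * (R2 ^+ p * (2 * p%:R + d%:R) ^+ p
    + 2 `^ ((m%:R - 1) * p%:R) * R1 ^+ p
      * ((m%:R + 2) * p%:R + d%:R) `^ ((m%:R + 2) * p%:R / 2)).
Definition Kconst (fx0 inff normx0 : R) : R :=
  fx0 - inff + Mbreve normx0
  + 2^-1 * Hbreve 2 * (2 `^ (2 * m%:R - 2) * R1 * (m%:R + 1 + d%:R) `^ ((m%:R + 1) / 2)
                       + R2 * Num.sqrt d%:R)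
  + 2 `^ (2 * m%:R - 3) * Hbreve 2 * R1 * Num.sqrt d%:R
  + 2 `^ (m%:R - 1) * R1 * Hbreve (m + 2) * (m%:R + 2)^-1 * Num.sqrt d%:R.
End Params.

Definition mutually_independent_rv {dO : measure_display} {Omega : measurableType dO}
  {R : realType} (P : probability Omega R) {I : eqType} (X : I -> Omega -> R) : Prop :=
  (forall i, measurable_fun setT (X i)) /\
  forall (s : seq I) (B : I -> set R), uniq s -> (forall i, measurable (B i)) ->
    P (\big[setI/setT]_(i <- s) (X i @^-1` B i)) = (\prod_(i <- s) P (X i @^-1` B i))%E.

(* u : nat -> Omega -> R^d is a sequence of independent N(0, I_d) vectors:
   all coordinates are mutually independent standard normal variables. *)
Definition iid_std_gaussian {dO : measure_display} {Omega : measurableType dO}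
  {R : realType} (P : probability Omega R) (d : nat) (u : nat -> Omega -> 'rV[R]_d) : Prop :=
  mutually_independent_rv P (fun ki : nat * 'I_d => fun w => u ki.1 w 0 ki.2) /\
  forall k (i : 'I_d) (B : set R), measurable B ->
    P ((fun w => u k w 0 i) @^-1` B) = normal_prob 0 1 B.

(* Main.v *)
Require Import Defs.
From HB Require Import structures.
From mathcomp Require Import all_boot all_order all_algebra.
From mathcomp Require Import all_classical all_reals all_analysis.
From mathcomp Require Import normal_distribution.
From mathcomp Require Import measurable_realfun ring lra.
Import Order.TTheory GRing.Theory Num.Theory.
Import numFieldNormedType.Exports.
Local Open Scope classical_set_scope.
Local Open Scope ring_scope.

(** Smooth [f] by a Gaussian: [F x = E f(x + s u)], so that the random direction [v^k] has
    conditional mean [grad F (x^k)].  Lebourg's mean value inequality and the growth of the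
    Clarke subgradients make [f] Lipschitz on balls with an explicit constant; the
    Cameron-Martin shift then gives differentiability of [F], a local Lipschitz bound for
    [grad F], and hence a descent inequality whose telescoped expectation bounds both
    [E F(x^k)] and the smallest [E (|grad F|^2 / (|x^k|^(2m) + 1))].

    To pass from [grad F] to the Goldstein subdifferential, separate [0] from the latter by a
    unit vector [v].  Along [v] the function decreases at rate [dist(0, G)] near [x], while the
    contribution of [|s u| > 3 delta / 4] is controlled by a moment of order [d]; comparing
    with the directional derivative of [F] yields [dist(0, G) <= |grad F| + error].  This
    works with support functions only, so Rademacher's theorem is not needed.

    Gaussian moments come from [E exp(a |u|^2) = (1 - 2a)^(-d/2)].  The final averaging uses
    Hoelder and Jensen for part (i), where quadratic growth bounds [E |x^k|^2]. *)

(** * Euclidean norm and sublinear functions *)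

(** Two errors must be of the same order. With [sigma = kappa eps], the descent bound for the mean
    of |grad F|^2 / (|x|^(2m) + 1) is K / (sigma sqrt(T+1)), while the smoothing error is eps^q
    (|x|^m + 1), where q = min(m, d), or q = d if m = 0. The exponent in eps = T^(-1/(4q+2)) gives
    eps^(2q+1) = T^(-1/2), so the root of the first quantity is of order eps^q too. Measurability
    shapes the averaging: that of x |-> dist(0, G(x)) is not established. Hoelder and Jensen are
    therefore replaced by tangent-line inequalities, which bound the power of the distance pointwise
    by an affine combination of measurable quantities with known mean bounds; the distance itself
    meets only monotonicity of the integral. Row vectors receive the sigma-algebra generated by
    their coordinates. As x^k depends on finitely many noise coordinates, independence is needed
    only between the sigma-algebras of two disjoint finite families of coordinates, and conditioning
    on the past becomes an iterated integral. *)

Section EuclideanNorm.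
Context {R : realType} {d : nat}.
Implicit Types (x y z v w : 'rV[R]_d) (a : R).

Lemma dotvC x y : dotv x y = dotv y x.
Proof. by apply: eq_bigr => i _; rewrite mulrC. Qed.

Lemma dotvDl x y z : dotv (x + y) z = dotv x z + dotv y z.
Proof. by rewrite -big_split; apply: eq_bigr => i _; rewrite mxE mulrDl. Qed.

Lemma dotvZl a x y : dotv (a *: x) y = a * dotv x y.
Proof. by rewrite mulr_sumr; apply: eq_bigr => i _; rewrite mxE mulrA. Qed.

Lemma dotvDr x y z : dotv z (x + y) = dotv z x + dotv z y.
Proof. by rewrite dotvC dotvDl !(dotvC z). Qed.

Lemma dotvZr a x y : dotv x (a *: y) = a * dotv x y.
Proof. by rewrite dotvC dotvZl dotvC. Qed.

Lemma dotvNl x y : dotv (- x) y = - dotv x y.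
Proof. by rewrite -scaleN1r dotvZl mulN1r. Qed.

Lemma dotvNr x y : dotv x (- y) = - dotv x y.
Proof. by rewrite dotvC dotvNl dotvC. Qed.

Lemma dotvBl x y z : dotv (x - y) z = dotv x z - dotv y z.
Proof. by rewrite dotvDl dotvNl. Qed.

Lemma dotv_ge0 x : 0 <= dotv x x.
Proof. by apply: sumr_ge0 => i _; rewrite -expr2 sqr_ge0. Qed.

Lemma enorm_ge0 x : 0 <= enorm x.
Proof. exact: sqrtr_ge0. Qed.
Hint Resolve enorm_ge0 : core.

Lemma enorm_sqr x : enorm x ^+ 2 = dotv x x.
Proof. by rewrite sqr_sqrtr// dotv_ge0. Qed.

Lemma enorm0 : enorm (0 : 'rV[R]_d) = 0.
Proof.
by rewrite /enorm /dotv big1 ?sqrtr0// => i _; rewrite mxE mul0r.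
Qed.

Lemma enormZ a x : enorm (a *: x) = `|a| * enorm x.
Proof.
rewrite /enorm dotvZl dotvZr mulrA -expr2 sqrtrM ?sqr_ge0//.
by rewrite sqrtr_sqr.
Qed.

Lemma enormN x : enorm (- x) = enorm x.
Proof. by rewrite -scaleN1r enormZ normrN normr1 mul1r. Qed.

Lemma enormBC x y : enorm (x - y) = enorm (y - x).
Proof. by rewrite -opprB enormN. Qed.

Lemma dotv_cauchy_sqr x y : dotv x y ^+ 2 <= dotv x x * dotv y y.
Proof.
have [y0|y0] := eqVneq (dotv y y) 0.
  have yi i : y 0 i = 0.
    move/eqP: y0; rewrite psumr_eq0 => [|j _]; last by rewrite -expr2 sqr_ge0.
    by move=> /allP /(_ i); rewrite mem_index_enum => /(_ isT) /=; rewrite mulf_eq0 orbb => /eqP.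
  by rewrite y0 mulr0 /dotv big1 ?expr0n// => i _; rewrite yi mulr0.
have yp : 0 < dotv y y by rewrite lt_neqAle eq_sym y0 dotv_ge0.
have := dotv_ge0 (dotv y y *: x - dotv x y *: y).
rewrite dotvBl !(dotvDr, dotvNr, dotvZl, dotvZr) (dotvC y x) => h.
have : 0 <= dotv y y * (dotv x x * dotv y y - dotv x y ^+ 2) by lra.
by rewrite pmulr_rge0// subr_ge0.
Qed.

Lemma dotv_cauchy x y : dotv x y <= enorm x * enorm y.
Proof.
rewrite (le_trans (ler_norm _))// -sqrtr_sqr -sqrtrM ?dotv_ge0//.
by rewrite ler_wsqrtr// dotv_cauchy_sqr.
Qed.

Lemma dotv_cauchy_abs x y : `|dotv x y| <= enorm x * enorm y.
Proof.
rewrite ler_norml dotv_cauchy andbT lerNl -dotvNl.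
by rewrite (le_trans (dotv_cauchy _ _))// enormN.
Qed.

Lemma enormD x y : enorm (x + y) <= enorm x + enorm y.
Proof.
rewrite -(@ler_sqr _ (enorm _))// ?nnegrE ?addr_ge0//.
rewrite enorm_sqr dotvDl !dotvDr sqrrD !enorm_sqr (dotvC y x).
have := dotv_cauchy x y; lra.
Qed.

Lemma enormB x y : enorm (x - y) <= enorm x + enorm y.
Proof. by rewrite (le_trans (enormD _ _))// enormN. Qed.

Lemma enorm_coord x i : `|x 0 i| <= enorm x.
Proof.
rewrite -sqrtr_sqr ler_wsqrtr// /dotv (bigD1 i)//= -expr2 lerDl.
by apply: sumr_ge0 => j _; rewrite -expr2 sqr_ge0.
Qed.

Lemma enorm_delta i : enorm (delta_mx 0 i : 'rV[R]_d) = 1.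
Proof.
rewrite /enorm /dotv (bigD1 i)//= big1 ?addr0 ?mxE ?eqxx ?mulr1 ?sqrtr1//.
by move=> j ji; rewrite mxE (negbTE ji) andbF mul0r.
Qed.

Lemma dotv_delta x i : dotv x (delta_mx 0 i) = x 0 i.
Proof.
rewrite /dotv (bigD1 i)//= big1 ?addr0 ?mxE ?eqxx ?mulr1//.
by move=> j ji; rewrite mxE (negbTE ji) andbF mulr0.
Qed.

Lemma enorm_sum (I : Type) (s : seq I) (Q : pred I) (F : I -> 'rV[R]_d) :
  enorm (\sum_(i <- s | Q i) F i) <= \sum_(i <- s | Q i) enorm (F i).
Proof.
elim/big_ind2: _ => [||//]; first by rewrite enorm0.
by move=> a b x y ab xy; rewrite (le_trans (enormD _ _))// lerD.
Qed.

Lemma enorm_le_sum x : enorm x <= \sum_(i < d) `|x 0 i|.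
Proof.
rewrite {1}(row_sum_delta x) (le_trans (enorm_sum _ _ _ _))//.
by apply: ler_sum => i _; rewrite enormZ enorm_delta mulr1.
Qed.

End EuclideanNorm.
#[global] Hint Extern 0 (is_true (0 <= enorm _)) => solve [apply: enorm_ge0] : core.

(** * Sublinear functions and Hahn-Banach in finite dimension *)

Section Sublinear.
Context {R : realType} {d : nat}.
Implicit Types (p q : 'rV[R]_d -> R) (e v w : 'rV[R]_d).

(** Homogeneity is asked as an inequality only, which is what an infimum delivers; using it for [a]
    and for [a^-1] gives equality. *)
Definition sublinear p : Prop :=
  (forall v w, p (v + w) <= p v + p w) /\
  (forall (a : R) v, 0 < a -> p (a *: v) <= a * p v).

Lemma sublinear0 p : sublinear p -> p 0 = 0.
Proof.
move=> [pD pZ]; apply/eqP; rewrite eq_le; apply/andP; split.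
  have h0 : 0 < 2^-1 :> R by [].
  have := pZ 2^-1 0 h0; rewrite scaler0; lra.
have := pD 0 0; rewrite addr0; lra.
Qed.

Lemma sublinearN p v : sublinear p -> 0 <= p v + p (- v).
Proof. by move=> sp; rewrite -(sublinear0 p sp) -(subrr v); apply: sp.1. Qed.

Lemma sublinearZ p (a : R) v : sublinear p -> 0 <= a -> p (a *: v) = a * p v.
Proof.
move=> sp; rewrite le_eqVlt => /orP[/eqP <-|a0].
  by rewrite scale0r mul0r sublinear0.
apply/eqP; rewrite eq_le sp.2//=.
have a'0 : 0 < a^-1 by rewrite invr_gt0.
have := sp.2 a^-1 (a *: v) a'0.
by rewrite scalerK ?gt_eqF// ler_pdivlMl.
Qed.

(** The witness is the infimum over t >= 0 of p(v + t e) - t p(e). It is bounded below by -p(-v),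
    and t = 1 at v = -e gives the value -p(e), so the minorant is linear along e. *)
Lemma sublinear_flatten p e : sublinear p -> exists q, [/\ sublinear q,
  (forall v, q v <= p v), q e = p e & q (- e) = - q e].
Proof.
move=> sp.
pose S v := [set p (v + t *: e) - t * p e | t in [set t : R | 0 <= t]].
have S0 v : S v !=set0 by exists (p (v + 0 *: e) - 0 * p e), 0 => /=.
have lbS v : lbound (S v) (- p (- v)).
  move=> _ [t /= t0 <-].
  have := sp.1 (v + t *: e) (- v).
  rewrite addrAC subrr add0r sublinearZ//; lra.
have infS v : has_inf (S v) by split; last by exists (- p (- v)).
pose q v := inf (S v).
have qle v (t : R) : 0 <= t -> q v <= p (v + t *: e) - t * p e.
  by move=> t0; apply: ge_inf; [exists (- p (- v))|exists t].
have qp v : q v <= p v.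
  by have := qle v 0 (lexx _); rewrite scale0r addr0 mul0r subr0.
have qD v w : q (v + w) <= q v + q w.
  rewrite -lerBlDr; apply: lb_le_inf => // _ [t /= t0 <-].
  rewrite lerBlDl -lerBlDr; apply: lb_le_inf => // _ [s /= s0 <-].
  have := qle (v + w) (t + s) (addr_ge0 t0 s0).
  have := sp.1 (v + t *: e) (w + s *: e).
  rewrite addrACA -scalerDl; lra.
have qZ (a : R) v : 0 < a -> q (a *: v) <= a * q v.
  move=> a0; rewrite -ler_pdivrMl//; apply: lb_le_inf => // _ [t /= t0 <-].
  rewrite ler_pdivrMl//.
  have := qle (a *: v) (a * t) (mulr_ge0 (ltW a0) t0).
  rewrite -scalerA -scalerDr (sublinearZ _ _ (v + t *: e) sp (ltW a0)); lra.
have sq : sublinear q by [].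
have qe : q e = p e.
  apply/eqP; rewrite eq_le qp; apply: lb_le_inf => // _ [t /= t0 <-].
  rewrite -[X in X + t *: e](scale1r e) -scalerDl sublinearZ ?addr_ge0//; lra.
exists q; split => //; apply/eqP; rewrite eq_le; apply/andP; split.
  have := qle (- e) 1 ler01.
  by rewrite scale1r addNr sublinear0// mul1r sub0r qe.
have := sublinearN _ e sq; lra.
Qed.

Lemma sublinear_flatten_seq p (s : seq 'rV[R]_d) : sublinear p ->
  exists q, [/\ sublinear q, (forall v, q v <= p v) &
    (forall e, e \in s -> q (- e) = - q e)].
Proof.
elim: s p => [|e s IHs] p sp; first by exists p.
have [q [sq qp qs]] := IHs _ sp.
have [r [sr rq re rNe]] := sublinear_flatten _ e sq.
exists r; split=> // [v|w]; first exact: le_trans (rq v) (qp v).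
rewrite inE => /orP[/eqP -> //|ws].
(* Oddness survives further flattening: [r w <= q w], [r (- w) <= - q w] and [0 <= r w + r (- w)]
   force equalities. *)
have := sublinearN _ w sr; have := rq w; have := rq (- w); rewrite qs//; lra.
Qed.

(** Flattening along [v0] first pins the value [p v0]; flattening along the basis vectors afterwards
    leaves a sublinear function that is odd on a basis, hence linear, and [zeta] lists its values
    there. *)
Lemma hahn_banach_support p v0 : sublinear p ->
  exists zeta, (forall v, dotv zeta v <= p v) /\ dotv zeta v0 = p v0.
Proof.
move=> sp; have [p1 [sp1 p1p p1v p1Nv]] := sublinear_flatten _ v0 sp.
have [q [sq qp1 qs]] :=
  sublinear_flatten_seq _ [seq delta_mx 0 i | i <- enum 'I_d] sp1.
have qd i : q (- delta_mx 0 i) = - q (delta_mx 0 i).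
  by apply/qs/map_f; rewrite mem_enum.
pose zeta : 'rV[R]_d := \row_i q (delta_mx 0 i).
have qsum (I : Type) (s : seq I) (F : I -> 'rV[R]_d) :
    q (\sum_(i <- s) F i) <= \sum_(i <- s) q (F i).
  elim: s => [|a s IHs]; first by rewrite !big_nil sublinear0.
  by rewrite !big_cons (le_trans (sq.1 _ _))// lerD2l.
have qle v : q v <= dotv zeta v.
  rewrite {1}(row_sum_delta v) (le_trans (qsum _ _ _))//.
  apply: ler_sum => i _; rewrite mxE; have [v0i|v0i] := leP 0 (v 0 i).
    by rewrite sublinearZ// mulrC.
  rewrite -(opprK (v 0 i)) scaleNr -scalerN.
  have v0i' : 0 <= - v 0 i by lra.
  rewrite (sublinearZ _ _ _ sq v0i') qd.
  by rewrite mulrN mulNr !opprK mulrC.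
have qge v : dotv zeta v <= q v.
  have := sublinearN _ v sq; have := qle (- v); rewrite dotvNr; lra.
exists zeta; split=> [v|]; first by rewrite (le_trans (qge v))// (le_trans (qp1 v)).
apply/eqP; rewrite eq_le; apply/andP; split.
  by rewrite (le_trans (qge _))// (le_trans (qp1 _)).
have := qge (- v0); have := qle v0; have := qp1 (- v0).
have := sublinearN _ v0 sq; rewrite dotvNr; lra.
Qed.

End Sublinear.

(** * Clarke and Goldstein subdifferentials *)

Section Clarke.
Context {R : realType} {d : nat}.
Implicit Types (f : 'rV[R]_d -> R) (x y z v w zeta : 'rV[R]_d).

(** Uniform bounds of the difference quotients near [x]. Their infimum is the limsup defining
    Clarke's directional derivative f°(x; v). *)
Definition clarke_ub f x v : set R :=
  [set M | exists2 e : R, 0 < e & forall y (t : R), enorm (y - x) < e ->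
    0 < t -> t < e -> f (y + t *: v) - f y <= M * t].

Definition clarke_dd f x v : R := inf (clarke_ub f x v).

Lemma clarke_ub_lip f x v : locally_lipschitz f -> exists2 L : R, 0 <= L &
  clarke_ub f x v (L * enorm v) /\ lbound (clarke_ub f x v) (- (L * enorm v)).
Proof.
move=> /(_ x)[r [r0 [L Lf]]].
(* [locally_lipschitz] prescribes no sign for its constant. *)
pose L' := Num.max L 0.
have L'f y z : enorm (y - x) < r -> enorm (z - x) < r ->
    `|f y - f z| <= L' * enorm (y - z).
  move=> yr zr; apply: (le_trans (Lf _ _ yr zr)).
  by apply: ler_wpM2r => //; rewrite /L' le_max lexx.
have n0 : 0 < enorm v + 1 by rewrite ltr_wpDl.
have close (y : 'rV[R]_d) (t : R) : enorm (y - x) < r / 2 -> 0 < t ->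
    t < r / 2 / (enorm v + 1) -> enorm (y + t *: v - x) < r.
  move=> yr t0; rewrite ltr_pdivlMr// mulrDr mulr1 => tr.
  rewrite addrAC (le_lt_trans (enormD _ _))// enormZ gtr0_norm//; lra.
pose e := Num.min (r / 2) (r / 2 / (enorm v + 1)).
have e0 : 0 < e by rewrite lt_min !divr_gt0.
exists L'; first by rewrite /L' le_max lexx orbT.
split.
  exists e => // y t; rewrite !lt_min => /andP[yr _] t0 /andP[_ tr].
  rewrite (le_trans (ler_norm _))// (le_trans (L'f _ _ (close _ _ yr t0 tr) _))//.
    by rewrite (lt_trans yr)// ltr_pdivrMr// mulr_natr mulr2n ltrDl.
  by rewrite addrAC subrr add0r enormZ gtr0_norm// mulrCA mulrC.
move=> M [e' e'0 H].
pose t := Num.min e e' / 2.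
have t0 : 0 < t by rewrite divr_gt0// lt_min e0 e'0.
have te : t < Num.min e e' by rewrite /t ltr_pdivrMr// mulr_natr mulr2n ltrDl lt_min e0.
have [te1 te2] : t < e /\ t < e' by move: te; rewrite lt_min => /andP[].
have [tr1 tr2] : t < r / 2 /\ t < r / 2 / (enorm v + 1).
  by move: te1; rewrite lt_min => /andP[].
have x0 : enorm (x - x) < r / 2 by rewrite subrr enorm0 divr_gt0.
have xe' : enorm (x - x) < e' by rewrite subrr enorm0.
have := H x t xe' t0 te2.
have x0r : enorm (x - x) < r by lra.
have := L'f _ _ (close _ _ x0 t0 tr2) x0r.
rewrite addrAC subrr add0r enormZ (gtr0_norm t0) ler_norml => /andP[h _] h'.
by rewrite -(ler_pM2r t0) mulNr -mulrA (mulrC _ t); lra.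
Qed.

Lemma clarke_ub_has_inf f x v : locally_lipschitz f -> has_inf (clarke_ub f x v).
Proof.
move=> /clarke_ub_lip => /(_ x v) [L _ [U lb]].
by split; [exists (L * enorm v)|exists (- (L * enorm v))].
Qed.

(** The increment along v + w is cut at y + t v. This point is again close to x for small t, and the
    bound for w holds at all base points near x. *)
Lemma clarke_ubD f x v w (M N : R) : clarke_ub f x v M -> clarke_ub f x w N ->
  clarke_ub f x (v + w) (M + N).
Proof.
move=> [e e0 He] [e' e'0 He'].
have n0 : 0 < enorm v + 1 by rewrite ltr_wpDl.
exists (Num.min (Num.min e e') (Num.min (e' / 2) (e' / 2 / (enorm v + 1)))).
  by rewrite !lt_min e0 e'0 !divr_gt0.
move=> y t; rewrite !lt_min => /andP[/andP[y1 y2] /andP[y3 y4]] t0.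
move=> /andP[/andP[t1 t2] /andP[t3 t4]].
have := He y t y1 t0 t1.
have : enorm (y + t *: v - x) < e'.
  rewrite addrAC (le_lt_trans (enormD _ _))// enormZ gtr0_norm//.
  move: t4; rewrite ltr_pdivlMr// mulrDr mulr1; lra.
move=> /He' /(_ t0 t2); rewrite scalerDr addrA; lra.
Qed.

Lemma clarke_ubZ f x v (a M : R) : 0 < a -> clarke_ub f x v M ->
  clarke_ub f x (a *: v) (a * M).
Proof.
move=> a0 [e e0 He]; exists (Num.min e (e / a)).
  by rewrite lt_min e0 divr_gt0.
move=> y t; rewrite !lt_min => /andP[y1 y2] t0 /andP[t1 t2].
have := He y (t * a) y1 (mulr_gt0 t0 a0).
by rewrite -ltr_pdivlMr// -scalerA => /(_ t2); rewrite mulrA (mulrAC a) (mulrC a) => h; lra.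
Qed.

Lemma clarke_dd_sublinear f x : locally_lipschitz f -> sublinear (clarke_dd f x).
Proof.
move=> lf; have Hi v := clarke_ub_has_inf f x v lf.
have dd_le v M : clarke_ub f x v M -> clarke_dd f x v <= M.
  by move=> U; apply: ge_inf => //; exact: (Hi v).2.
split=> [v w|a v a0].
  rewrite -lerBlDr; apply: lb_le_inf; first exact: (Hi v).1.
  move=> M UM; rewrite lerBlDl -lerBlDr; apply: lb_le_inf; first exact: (Hi w).1.
  by move=> N UN; rewrite lerBlDl; apply/dd_le/clarke_ubD.
rewrite -ler_pdivrMl//; apply: lb_le_inf; first exact: (Hi v).1.
by move=> M UM; rewrite ler_pdivrMl//; apply/dd_le/clarke_ubZ.
Qed.

Lemma clarke_dd_attained f x v : locally_lipschitz f ->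
  exists2 zeta, clarke_subdiff f x zeta & dotv zeta v = clarke_dd f x v.
Proof.
move=> lf.
have [zeta [zle zv]] := hahn_banach_support _ v (clarke_dd_sublinear f x lf).
exists zeta => // w eta eta0 eps eps0; apply: contrapT => H.
(* If no quotient near [x] came within [eta] of [dotv zeta w], then f°(x; w) would be at most
   [dotv zeta w - eta], although [zeta] lies below f°(x; .). *)
have : clarke_ub f x w (dotv zeta w - eta).
  exists eps => // y t ye t0 te; apply: contrapT => /negP; rewrite -ltNge => h.
  apply: H; exists y, t; do 3 split => //.
  by rewrite ler_pdivlMr// ltW.
move=> /(ge_inf (clarke_ub_has_inf f x w lf).2); have := zle w.
rewrite /clarke_dd; lra.
Qed.

Lemma clarke_subdiff_nonempty f x : locally_lipschitz f ->
  exists zeta, clarke_subdiff f x zeta.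
Proof. by move=> /clarke_dd_attained => /(_ x 0) [zeta ? _]; exists zeta. Qed.

(** Continuity-induction: the supremum c of the points up to which the slope bound holds can be
    crossed, because the local bound at c applies to base points slightly to its left. Hence the
    bound reaches 1. *)
Lemma local_slope_global (g : R -> R) (M : R) :
  (forall s, 0 <= s <= 1 -> exists2 e : R, 0 < e & forall a t : R,
     `|a - s| < e -> 0 < t -> t < e -> g (a + t) - g a <= M * t) ->
  g 1 - g 0 <= M.
Proof.
move=> H; pose S := [set s : R | 0 <= s <= 1 /\ g s - g 0 <= M * s].
have S0 : S 0 by split; rewrite ?lexx ?ler01 ?subrr ?mulr0.
have Sub : ubound S 1 by move=> s [/andP[]].
have hS : has_sup S by split; [exists 0|exists 1].
set c := sup S.
have c0 : 0 <= c by apply: ub_le_sup => //; exists 1.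
have c1 : c <= 1 by apply: sup_le_ub => //; exists 0.
have c01 : 0 <= c <= 1 by rewrite c0.
have [e e0 He] := H c c01.
have [a [/andP[a0 a1] ga] ac] := sup_adherent (divr_gt0 e0 (ltr0Sn _ 1)) hS.
have ac' : a <= c by apply: ub_le_sup => //; [exists 1|split; rewrite ?a0].
rewrite -/c in ac.
(* A point to the right of [c], still within the reach [e] of a point [a] of [S] lying just before
   [c]. *)
pose b := Num.min 1 (c + e / 2).
have b1 : b <= 1 by rewrite ge_min lexx.
have cb : c <= b by rewrite le_min c1 lerDl divr_ge0// ltW.
have be : b <= c + e / 2 by rewrite ge_min lexx orbT.
have Sb : S b.
  split; first by rewrite b1 (le_trans c0).
  have [ab|ab] := ltP a b; last first.
    by have -> : b = a by apply/eqP; rewrite eq_le ab (le_trans ac').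
  have ba0 : 0 < b - a by rewrite subr_gt0.
  have bae : b - a < e by lra.
  have ace : `|a - c| < e by rewrite ler0_norm; lra.
  have := He a (b - a) ace ba0 bae; rewrite addrCA subrr addr0; lra.
have bc : b <= c by apply: ub_le_sup => //; exists 1.
have b1E : b = 1.
  by move: bc; rewrite /b minEle; case: ifP => // _; lra.
by move: Sb; rewrite b1E => -[_]; rewrite mulr1.
Qed.

(** One-sided form of Lebourg's theorem. Since f° is attained by a subgradient, a bound on
    subgradients along the segment bounds the local slopes by M + eta, and local slopes add up. *)
Lemma clarke_mean_value f y z (M : R) : locally_lipschitz f ->
  (forall s : R, 0 <= s <= 1 -> forall zeta,
     clarke_subdiff f (y + s *: (z - y)) zeta -> dotv zeta (z - y) <= M) ->
  f z - f y <= M.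
Proof.
move=> lf H; set v := z - y in H *.
apply/ler_addgt0Pr => eta eta0.
have n0 : 0 < enorm v + 1 by rewrite ltr_wpDl.
have := @local_slope_global (fun s => f (y + s *: v)) (M + eta).
have yvz : y + v = z by rewrite /v addrC subrK.
rewrite scale1r scale0r addr0 yvz; apply => s s01.
have [zeta zc zv] := clarke_dd_attained f (y + s *: v) v lf.
have ddM : clarke_dd f (y + s *: v) v <= M by rewrite -zv; exact: H s01 _ zc.
have [N [e e0 He] NM] := inf_adherent eta0 (clarke_ub_has_inf f (y + s *: v) v lf).
rewrite -/(clarke_dd _ _ _) in NM.
exists (Num.min e (e / (enorm v + 1))); first by rewrite lt_min e0 divr_gt0.
move=> a t; rewrite !lt_min => /andP[a1 a2] t0 /andP[t1 t2].
have := He (y + a *: v) t _ t0 t1.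
rewrite opprD addrACA subrr add0r -scalerBl enormZ.
have -> : `|a - s| * enorm v < e.
  move: a2; rewrite ltr_pdivlMr// mulrDr mulr1 => a2.
  by rewrite (le_lt_trans _ a2)// lerDl.
move=> /(_ isT); rewrite -addrA -scalerDl => h.
by rewrite (le_trans h)// ler_pM2r// ltW// (lt_le_trans NM)// lerD2r.
Qed.

Lemma enorm_segment y z (s r : R) : 0 <= s <= 1 -> enorm y <= r -> enorm z <= r ->
  enorm (y + s *: (z - y)) <= r.
Proof.
move=> /andP[s0 s1] yr zr.
have -> : y + s *: (z - y) = (1 - s) *: y + s *: z.
  by rewrite scalerBr scalerBl scale1r addrA addrAC.
rewrite (le_trans (enormD _ _))// !enormZ ger0_norm ?subr_ge0// ger0_norm//.
have : (1 - s) * enorm y <= (1 - s) * r by apply: ler_wpM2l => //; rewrite subr_ge0.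
have : s * enorm z <= s * r by exact: ler_wpM2l.
lra.
Qed.

Lemma spb_lipschitz_ball f (R1 R2 : R) m y z (r : R) : SPB f R1 R2 m ->
  enorm y <= r -> enorm z <= r ->
  `|f y - f z| <= (R1 * r ^+ m + R2) * enorm (y - z).
Proof.
move=> [R10 R20 _ lf Hf] yr zr.
have key a b : enorm a <= r -> enorm b <= r ->
    f b - f a <= (R1 * r ^+ m + R2) * enorm (b - a).
  move=> ar br; apply: clarke_mean_value => // s s01 zeta /Hf zb.
  rewrite (le_trans (dotv_cauchy _ _))// ler_wpM2r// (le_trans zb)// lerD2r.
  by rewrite ler_wpM2l// lerXn2r ?nnegrE ?enorm_segment// (le_trans _ ar).
by rewrite ler_norml key// andbT lerNl opprB enormBC key.
Qed.

Lemma conv_hull_convex (S : set 'rV[R]_d) y z (s : R) : 0 <= s <= 1 ->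
  conv_hull S y -> conv_hull S z -> conv_hull S ((1 - s) *: y + s *: z).
Proof.
move=> /andP[s0 s1] [n [lam [p [lam0 [lam1 [pS ->]]]]]].
move=> [n' [mu [q [mu0 [mu1 [qS ->]]]]]].
exists (n + n')%N.
exists (fun i => match fintype.split i with inl j => (1 - s) * lam j | inr j => s * mu j end).
exists (fun i => match fintype.split i with inl j => p j | inr j => q j end).
have sl (j : 'I_n) : fintype.split (lshift n' j) = inl j by exact: (unsplitK (inl j)).
have sr (j : 'I_n') : fintype.split (rshift n j) = inr j by exact: (unsplitK (inr j)).
split; first by move=> i; case: fintype.split => j; rewrite mulr_ge0// subr_ge0.
split.
  rewrite big_split_ord/=.
  under eq_bigr do rewrite sl; under [X in _ + X]eq_bigr do rewrite sr.
  by rewrite -!mulr_sumr lam1 mu1 !mulr1 subrK.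
split; first by move=> i; case: fintype.split.
rewrite big_split_ord/= !scaler_sumr.
by congr (_ + _); apply: eq_bigr => i _; rewrite ?sl ?sr scalerA.
Qed.

Lemma conv_hull_sub (S : set 'rV[R]_d) : S `<=` conv_hull S.
Proof.
move=> z Sz; exists 1%N, (fun=> 1), (fun=> z); split => //.
by rewrite !big_ord1 scale1r.
Qed.

Lemma conv_hull_bounded (S : set 'rV[R]_d) (L : R) :
  (forall z, S z -> enorm z <= L) -> forall z, conv_hull S z -> enorm z <= L.
Proof.
move=> SL z [n [lam [p [lam0 [lam1 [pS ->]]]]]].
rewrite (le_trans (enorm_sum _ _ _ _))// -[leRHS]mul1r -lam1 mulr_suml.
by apply: ler_sum => i _; rewrite enormZ ger0_norm// ler_wpM2l// SL.
Qed.

Lemma setdist0_le (G : set 'rV[R]_d) z : G z -> setdist 0 G <= enorm z.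
Proof.
move=> Gz; apply: ge_inf; first by exists 0 => _ [y _ <-].
by exists z => //; rewrite sub0r enormN.
Qed.

Lemma setdist_ge0 (G : set 'rV[R]_d) x : 0 <= setdist x G.
Proof.
(* For empty [G] the distance takes the default value 0 of the infimum. *)
have [[z Gz]|/set0P/negP/negPn/eqP->] := pselect (G !=set0); last first.
  by rewrite /setdist image_set0 inf0.
by apply: lb_le_inf => [|_ [y _ <-]//]; exists (enorm (x - z)), z.
Qed.

(* An almost-shortest point of [G] almost realizes the separating hyperplane of [0] and [G]. *)
Lemma convex_separation0 (G : set 'rV[R]_d) (L : R) : G !=set0 ->
  (forall y z (s : R), 0 <= s <= 1 -> G y -> G z -> G ((1 - s) *: y + s *: z)) ->
  (forall z, G z -> enorm z <= L) -> 0 < setdist 0 G ->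
  forall eta : R, 0 < eta -> exists2 v, enorm v = 1 &
    forall z, G z -> dotv z v <= - setdist 0 G + eta.
Proof.
move=> [z0 Gz0] Gconv GL; set D := setdist 0 G => D0 eta eta0.
have L0 : 0 <= L by rewrite (le_trans (enorm_ge0 z0))// GL.
have hi : has_inf [set enorm (0 - y) | y in G].
  split; first by exists (enorm (0 - z0)), z0.
  by exists 0 => _ [y _ <-].
(* Expanding |(1-s) w + s z|^2 >= D^2 leaves two errors, |w|^2 - D^2 and s^2 |w - z|^2. This [s],
   and the slack allowed to [w] in the infimum below, make each of them at most s eta D. *)
pose s : R := Num.min 1 (eta * D / (4 * L ^+ 2 + 1)).
have q0 : 0 < 4 * L ^+ 2 + 1 by rewrite ltr_wpDl// mulr_ge0// sqr_ge0.
have s0 : 0 < s by rewrite lt_min ltr01 divr_gt0// mulr_gt0.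
have s1 : s <= 1 by rewrite ge_min lexx.
have sL : s * (4 * L ^+ 2 + 1) <= eta * D.
  by rewrite -ler_pdivlMr// ge_min lexx orbT.
have e0 : 0 < s * eta * D / (4 * L + 1) / 2.
  by rewrite !divr_gt0// ?mulr_gt0// ltr_wpDl// mulr_ge0.
have [_ [w Gw <-] wD] := inf_adherent e0 hi.
rewrite sub0r enormN -/(setdist _ _) -/D in wD.
have Dw : D <= enorm w by exact: setdist0_le.
have w0 : 0 < enorm w by exact: lt_le_trans Dw.
have wL : enorm w <= L by exact: GL.
exists (- (enorm w)^-1 *: w).
  by rewrite enormZ normrN gtr0_norm ?invr_gt0// mulVf ?gt_eqF.
move=> z Gz; rewrite dotvZr mulNr lerNl opprD opprK ler_pdivlMl//.
have zL : enorm z <= L by exact: GL.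
have Ds : D ^+ 2 <= dotv ((1 - s) *: w + s *: z) ((1 - s) *: w + s *: z).
  rewrite -enorm_sqr ler_sqr ?nnegrE ?(ltW D0)//.
  by apply: (setdist0_le G); apply: Gconv => //; rewrite (ltW s0) s1.
move: Ds; rewrite dotvDl !dotvDr !dotvZl !dotvZr (dotvC w z) -!enorm_sqr => Ds.
have z2 : enorm z ^+ 2 <= L ^+ 2 by rewrite ler_sqr ?nnegrE.
have w2 : enorm w ^+ 2 <= L ^+ 2 by rewrite ler_sqr ?nnegrE.
have zw : - dotv z w <= L ^+ 2.
  rewrite -dotvNl (le_trans (dotv_cauchy _ _))// enormN expr2.
  by apply: ler_pM.
have wD2 : enorm w ^+ 2 - D ^+ 2 <= s * eta * D.
  rewrite subr_sqr.
  have h1 : enorm w - D <= s * eta * D / (4 * L + 1) / 2 by lra.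
  have h2 : enorm w + D <= (4 * L + 1) * 2 by lra.
  have -> : s * eta * D = (s * eta * D / (4 * L + 1) / 2) * ((4 * L + 1) * 2).
    field; apply: lt0r_neq0; lra.
  by apply: ler_pM => //; lra.
have key : 2 * s * (enorm w ^+ 2 - dotv z w) <= s * (eta * D + s * (4 * L ^+ 2)).
  have : s ^+ 2 * (enorm w ^+ 2 + enorm z ^+ 2 - 2 * dotv z w) <= s ^+ 2 * (4 * L ^+ 2).
    by apply: ler_wpM2l; [exact: sqr_ge0|lra].
  have -> : s * (eta * D + s * (4 * L ^+ 2)) = s * eta * D + s ^+ 2 * (4 * L ^+ 2) by ring.
  lra.
have key2 : enorm w ^+ 2 - dotv z w <= eta * D.
  have : 2 * (enorm w ^+ 2 - dotv z w) <= eta * D + s * (4 * L ^+ 2).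
    by rewrite -(ler_pM2l s0); apply: le_trans key; rewrite le_eqVlt; apply/orP; left; apply/eqP; ring.
  lra.
have DwD : D * enorm w <= enorm w ^+ 2 by rewrite expr2 ler_pM2r.
have : eta * D <= eta * enorm w by rewrite ler_pM2l.
lra.
Qed.

Lemma spb_goldstein_bounded f (R1 R2 : R) m (delta : R) x zeta : SPB f R1 R2 m ->
  goldstein_subdiff f delta x zeta ->
  enorm zeta <= R1 * (enorm x + delta) ^+ m + R2.
Proof.
move=> [R10 R20 _ lf Hf]; apply: conv_hull_bounded => {}zeta [y [yx]] /Hf h.
rewrite (le_trans h)// lerD2r ler_wpM2l// lerXn2r ?nnegrE//.
  by rewrite addr_ge0// (le_trans _ yx).
by rewrite -[y](subrK x) (le_trans (enormD _ _))// addrC lerD2l.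
Qed.

Lemma goldstein_nonempty f (delta : R) x : locally_lipschitz f -> 0 <= delta ->
  exists2 zeta, goldstein_subdiff f delta x zeta & clarke_subdiff f x zeta.
Proof.
move=> lf d0; have [zeta zc] := clarke_subdiff_nonempty f x lf.
exists zeta => //; apply: conv_hull_sub; exists x; split => //.
by rewrite subrr enorm0.
Qed.

Lemma spb_goldstein_dist f (R1 R2 : R) m (delta : R) x : SPB f R1 R2 m ->
  0 <= delta -> setdist 0 (goldstein_subdiff f delta x) <= R1 * enorm x ^+ m + R2.
Proof.
move=> [R10 R20 _ lf Hf] d0; have [zeta zG zc] := goldstein_nonempty f delta x lf d0.
by rewrite (le_trans (setdist0_le _ _ zG))// Hf.
Qed.

(** By convexity of the ball the whole segment stays within [delta] of [x], so its Clarke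
    subgradients lie in the Goldstein set, where the separating direction [v] controls them; the
    mean value inequality concludes. *)
Lemma goldstein_descent f (R1 R2 : R) m (delta : R) x : SPB f R1 R2 m ->
  0 <= delta -> 0 < setdist 0 (goldstein_subdiff f delta x) ->
  forall eta : R, 0 < eta -> exists2 v, enorm v = 1 &
   forall y (t : R), 0 <= t -> enorm (y - x) <= delta ->
     enorm (y + t *: v - x) <= delta ->
     f (y + t *: v) - f y <= t * (- setdist 0 (goldstein_subdiff f delta x) + eta).
Proof.
move=> spb d0 D0 eta eta0; have [R10 R20 _ lf Hf] := spb.
have [zeta zG _] := goldstein_nonempty f delta x lf d0.
have [v v1 Hv] := convex_separation0 _ _ (ex_intro _ _ zG)
  (fun y z s => conv_hull_convex _ y z s)
  (fun z => spb_goldstein_bounded _ _ _ _ _ _ z spb) D0 _ eta0.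
exists v => // y t t0 yd ytd; apply: clarke_mean_value => // s s01 {zG}zeta zc.
rewrite addrAC subrr add0r dotvZr; apply: ler_wpM2l => //; apply: Hv.
apply: conv_hull_sub; exists (y + s *: (y + t *: v - y)); split => //.
have := enorm_segment (y - x) (y + t *: v - x) s delta s01 yd ytd.
by rewrite opprB !addrA subrK (addrAC _ (- x)).
Qed.

End Clarke.

(** * Measurability and independence *)

Section EContinuity.
Context {R : realType} {d : nat}.

(* Continuity for the Euclidean norm, so that no topology on ['rV[R]_d] is involved. *)
Definition econtinuous (f : 'rV[R]_d -> R) : Prop :=
  forall x (e : R), 0 < e -> exists2 r : R, 0 < r &
    forall y, enorm (y - x) < r -> `|f y - f x| < e.

(** [X] is rounded to the grid of step 1/(n+1). A rounded map takes countably many values, each on a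
    measurable set, so composing it with [f] is measurable; continuity then makes the compositions
    converge pointwise. *)
Lemma measurable_econtinuous_comp (dT : measure_display) (T : measurableType dT)
  (X : T -> 'rV[R]_d) (f : 'rV[R]_d -> R) :
  (forall i, measurable_fun setT (fun t => X t 0 i)) -> econtinuous f ->
  measurable_fun setT (fun t => f (X t)).
Proof.
move=> mX cf.
pose rnd (n : nat) (k : 'rV[int]_d) : 'rV[R]_d := \row_i ((k 0 i)%:~R / n.+1%:R).
pose K (n : nat) t : 'rV[int]_d := \row_i Num.floor (X t 0 i * n.+1%:R).
have K_near n t : enorm (rnd n (K n t) - X t) <= d%:R / n.+1%:R.
  rewrite (le_trans (enorm_le_sum _))//.
  have -> : d%:R / n.+1%:R = \sum_(i < d) n.+1%:R^-1 :> R.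
    by rewrite sumr_const card_ord mulr_natl.
  apply: ler_sum => i _; rewrite !mxE.
  have n0 : 0 < n.+1%:R :> R by [].
  have := floor_le_tmp (X t 0 i * n.+1%:R); have := floorD1_gt (X t 0 i * n.+1%:R).
  rewrite intrD => h1 h2.
  rewrite distrC ger0_norm ?subr_ge0 ?ler_pdivrMr//.
  rewrite -(ler_pM2r n0) mulrBl divfK ?gt_eqF// mulVf ?gt_eqF//; lra.
apply: (@measurable_fun_cvg _ _ _ _ (fun n t => f (rnd n (K n t)))).
  move=> n _ B mB; rewrite setTI.
  have -> : (fun t => f (rnd n (K n t))) @^-1` B =
      \bigcup_(k : 'rV[int]_d) ([set t | K n t = k] `&` [set t | B (f (rnd n k))]).
    apply/seteqP; split=> [t Bt|t [k _ [<-]]//]; by exists (K n t).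
  apply: countable_bigcupT_measurable; first exact: countableP.
  move=> k; apply: measurableI; last first.
    have [h|h] := pselect (B (f (rnd n k))).
      by rewrite [X in measurable X](_ : _ = setT)//; apply/seteqP; split.
    by rewrite [X in measurable X](_ : _ = set0)//; apply/seteqP; split.
  have -> : [set t | K n t = k] = \bigcap_(i in [set: 'I_d])
      ((fun t => X t 0 i * n.+1%:R) @^-1` `[(k 0 i)%:~R, (k 0 i + 1)%:~R[%classic).
    apply/seteqP; split => t /=.
      move=> <- i _ /=; rewrite mxE in_itv/= floor_le_tmp.
      exact: floorD1_gt.
    move=> H; apply/rowP => i; rewrite mxE.
    by have := H i I; rewrite /= in_itv/= => h; exact: floor_def.
  apply: fin_bigcap_measurable; first exact: finite_finset.
  move=> i _; rewrite -[X in measurable X]setTI.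
  by apply: (measurable_funM (mX i) (measurable_cst _)).
move=> t _; apply/cvgrPdist_lt => e e0; have [r r0 Hr] := cf (X t) e e0.
near=> n; rewrite distrC; apply: Hr; rewrite (le_lt_trans (K_near _ _))//.
rewrite ltr_pdivrMr// mulrC -ltr_pdivrMr//.
near: n; apply: filterS (nbhs_infty_gtr (d%:R / r)) => n h.
by rewrite (lt_le_trans h)// ler_nat.
Unshelve. all: by end_near.
Qed.

End EContinuity.

Section CoordinateSigmaAlgebra.
Context {R : realType} {Om : pointedType} {I : choiceType}.
Variable X : I -> Om -> R.
Implicit Types (s t : seq I) (B : I -> set R).

Definition coord_box s B : set Om := \big[setI/setT]_(i <- s) (X i @^-1` B i).

(** Pi-system generating the sigma-algebra of the coordinates in [s]. It serves both for [Om], with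
    the noise coordinates, and for row vectors. *)
Definition coord_boxes s : set (set Om) :=
  [set A | exists B, (forall i, measurable (B i)) /\ A = coord_box s B].

Lemma coord_boxP s B w : coord_box s B w <-> forall i, i \in s -> B i (X i w).
Proof. by rewrite /coord_box -bigcap_seq; split=> h i /h. Qed.

Lemma coord_boxes_setI s : setI_closed (coord_boxes s).
Proof.
move=> _ _ [B [mB ->]] [B' [mB' ->]]; exists (fun i => B i `&` B' i).
split=> [i|]; first exact: measurableI.
apply/seteqP; split=> w.
  by case=> /coord_boxP h /coord_boxP h'; apply/coord_boxP => i si; split; [exact: h|exact: h'].
by move=> /coord_boxP h; split; apply/coord_boxP => i /h [].
Qed.

Lemma coord_boxes_setT s : coord_boxes s setT.
Proof.
exists (fun=> setT); split => //; apply/seteqP; split=> w // _.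
by apply/coord_boxP.
Qed.

Lemma coord_measurable s i : i \in s ->
  measurable_fun setT (X i : g_sigma_algebraType (coord_boxes s) -> R).
Proof.
move=> si _ B mB; rewrite setTI; apply: sub_sigma_algebra.
exists (fun j => if j == i then B else setT); split=> [j|]; first by case: ifP.
apply/seteqP; split=> w.
  by move=> Bw; apply/coord_boxP => j _; case: eqP => [->|].
by move=> /coord_boxP /(_ i si); rewrite eqxx.
Qed.

Lemma measurable_to_coord (dT : measure_display) (T : measurableType dT) s
  (Y : T -> g_sigma_algebraType (coord_boxes s)) :
  (forall i, i \in s -> measurable_fun setT (fun w => X i (Y w))) ->
  measurable_fun setT Y.
Proof.
move=> mY; apply: (@measurability _ _ _ (g_sigma_algebraType (coord_boxes s)) setT Y
  (coord_boxes s) erefl) => _ [_ [B [mB ->]] <-].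
rewrite setTI.
have -> : Y @^-1` coord_box s B = \bigcap_(i in [set` s]) ((fun w => X i (Y w)) @^-1` B i).
  by apply/seteqP; split=> w; [move=> /coord_boxP|move=> h; apply/coord_boxP].
apply: fin_bigcap_measurable; first exact: finite_seq.
by move=> i /= si; rewrite -[X in measurable X]setTI; apply: mY.
Qed.

End CoordinateSigmaAlgebra.

Section Independence.
Context {R : realType} {dO : measure_display} {Om : measurableType dO}.
Variable P : probability Om R.

(** The joint law of an independent pair is the product of the laws, by uniqueness of the product
    measure; Tonelli then separates the integrals. *)
Lemma indep_integral (d1 d2 : measure_display) (T1 : measurableType d1)
  (T2 : measurableType d2) (X : Om -> T1) (Y : Om -> T2) :
  measurable_fun setT X -> measurable_fun setT Y ->
  (forall A B, measurable A -> measurable B ->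
     P (X @^-1` A `&` Y @^-1` B) = (P (X @^-1` A) * P (Y @^-1` B))%E) ->
  forall Phi : T1 * T2 -> \bar R, measurable_fun setT Phi ->
  (forall z, 0 <= Phi z)%E ->
  (\int[P]_w Phi (X w, Y w) = \int[P]_w \int[P]_w' Phi (X w, Y w'))%E.
Proof.
move=> mX mY indep Phi mPhi Phi0.
pose X' : {mfun Om >-> T1} := HB.pack X (isMeasurableFun.Build _ _ _ _ _ mX).
pose Y' : {mfun Om >-> T2} := HB.pack Y (isMeasurableFun.Build _ _ _ _ _ mY).
have mXY : measurable_fun setT (fun w => (X w, Y w)) by exact: measurable_fun_pair.
pose XY : {mfun Om >-> (T1 * T2)%type} :=
  HB.pack (fun w => (X w, Y w)) (isMeasurableFun.Build _ _ _ _ _ mXY).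
rewrite -[LHS](ge0_integral_distribution XY mPhi Phi0).
rewrite (@eq_measure_integral _ _ _ _ (distribution P X' \x distribution P Y')%E); last first.
  move=> A mA _; apply/esym; apply: product_measure_unique => //.
rewrite fubini_tonelli1//.
rewrite ge0_integral_distribution//=; last 2 first.
- exact: measurable_fun_fubini_tonelli_F.
- by move=> y; apply: integral_ge0 => z _.
apply: eq_integral => w _; rewrite /= /fubini_F.
by rewrite ge0_integral_distribution// ; exact: measurableT_comp.
Qed.

Context {I : choiceType}.
Variable X : I -> Om -> R.
Hypothesis indepX : mutually_independent_rv P X.

Lemma coord_boxes_measurable s : coord_boxes X s `<=` measurable.
Proof.
move=> _ [B [mB ->]]; rewrite /coord_box -bigcap_seq.
apply: fin_bigcap_measurable; first exact: finite_seq.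
by move=> i _; rewrite -[X in measurable X]setTI; apply: indepX.1.
Qed.

Lemma coord_sigma_measurable s A : (<<s coord_boxes X s >>) A -> measurable A.
Proof.
move: A; apply: smallest_sub; first exact: sigma_algebra_measurable.
exact: coord_boxes_measurable.
Qed.

(** A |-> P(A and B) and A |-> P(A) P(B) are finite measures that agree on a pi-system, hence on the
    sigma-algebra it generates. *)
Lemma pi_system_indep (G : set (set Om)) (B : set Om) : G `<=` measurable ->
  setI_closed G -> G setT -> measurable B ->
  (forall A, G A -> P (A `&` B) = P A * P B)%E ->
  forall A, (<<s G >>) A -> P (A `&` B) = (P A * P B)%E.
Proof.
move=> Gm GI GT mB GB A GA.
have PB : (0 <= fine (P B))%R by exact: fine_ge0.
have PBE : P B = (fine (P B))%:E by rewrite fineK// fin_num_measure.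
have cover : \bigcup_(k : nat) (setT : set Om) = setT by rewrite bigcup_const//; exists 0%N.
have h1 C : G C -> mrestr P mB C = mscale (NngNum PB) P C.
  by move=> GC; rewrite /mrestr /mscale/= -PBE GB// muleC.
have h2 (k : nat) : (mrestr P mB setT < +oo)%E by rewrite /mrestr/= setTI PBE ltry.
transitivity (mscale (NngNum PB) P A); last by rewrite /mscale/= -PBE muleC.
exact: (g_sigma_algebra_measure_unique G Gm (fun=> setT) (fun=> GT) cover
  (mrestr P mB) (mscale (NngNum PB) P) GI h1 h2 A GA).
Qed.

(** Boxes are independent by hypothesis. The pi-system argument is then applied twice: first to
    enlarge the [s] side with a fixed box on [t], then to enlarge the [t] side. *)
Lemma coord_indep s t : uniq (s ++ t) -> forall A B,
  (<<s coord_boxes X s >>) A -> (<<s coord_boxes X t >>) B ->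
  P (A `&` B) = (P A * P B)%E.
Proof.
move=> ust; have := ust; rewrite cat_uniq => /and3P[us /hasPn st ut].
have box_prob r B : uniq r -> (forall i, measurable (B i)) ->
    P (coord_box X r B) = (\prod_(i <- r) P (X i @^-1` B i))%E.
  by move=> ur mB; apply: indepX.2.
have boxbox A B : coord_boxes X s A -> coord_boxes X t B ->
    P (A `&` B) = (P A * P B)%E.
  move=> [C [mC ->]] [D [mD ->]].
  (* As [s] and [t] are disjoint, two boxes merge into one box over [s ++ t]. *)
  pose E i := if i \in s then C i else D i.
  have -> : coord_box X s C `&` coord_box X t D = coord_box X (s ++ t) E.
    apply/seteqP; split=> w.
      move=> [/coord_boxP h /coord_boxP h']; apply/coord_boxP => i.
      rewrite mem_cat /E; case: ifP => [si _|_ /= it]; [exact: h|exact: h'].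
    move=> /coord_boxP h; split; apply/coord_boxP => i ii.
      by have := h i; rewrite mem_cat ii /E ii; apply.
    by have := h i; rewrite mem_cat ii orbT /E (negbTE (st _ ii)); apply.
  rewrite !box_prob//; last by move=> i; rewrite /E; case: ifP.
  rewrite big_cat; congr (_ * _)%E; apply: eq_big_seq => i ii; rewrite /E.
    by rewrite ii.
  by rewrite (negbTE (st _ ii)).
move=> A B sA tB.
have step1 C : coord_boxes X t C -> P (A `&` C) = (P A * P C)%E.
  move=> tC; apply: (pi_system_indep (coord_boxes X s)) => //.
  - exact: coord_boxes_measurable.
  - exact: coord_boxes_setI.
  - exact: coord_boxes_setT.
  - exact: coord_boxes_measurable tC.
  - by move=> D sD; apply: boxbox.
rewrite setIC muleC; apply: (pi_system_indep (coord_boxes X t)) => //.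
- exact: coord_boxes_measurable.
- exact: coord_boxes_setI.
- exact: coord_boxes_setT.
- exact: coord_sigma_measurable sA.
- by move=> D tD; rewrite setIC muleC; apply: step1.
Qed.

(* [Phi] sees the coordinates in [s] through its first argument only, so the second argument
   may be replaced by an independent copy. *)
Lemma coord_indep_integral s t (d2 : measure_display) (T2 : measurableType d2)
  (Y : Om -> T2) : uniq (s ++ t) ->
  measurable_fun setT (Y : g_sigma_algebraType (coord_boxes X t) -> T2) ->
  forall Phi : g_sigma_algebraType (coord_boxes X s) * T2 -> \bar R,
  measurable_fun setT Phi -> (forall z, 0 <= Phi z)%E ->
  (\int[P]_w Phi (w, Y w) = \int[P]_w \int[P]_w' Phi (w, Y w'))%E.
Proof.
move=> ust mY Phi mPhi Phi0.
apply: (indep_integral _ _ (g_sigma_algebraType (coord_boxes X s)) T2 (fun w => w) Y) => //.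
- by move=> _ A mA; rewrite setTI; exact: coord_sigma_measurable mA.
- move=> _ A mA; apply: (@coord_sigma_measurable t); exact: mY.
- move=> A B mA mB; apply: (coord_indep s t) => //.
  by have := mY measurableT B mB; rewrite setTI.
Qed.

Lemma integral_prod_indep s (phi : I -> R -> R) : uniq s ->
  (forall i, measurable_fun setT (phi i)) -> (forall i r, 0 <= phi i r) ->
  (\int[P]_w (\prod_(i <- s) phi i (X i w))%:E =
   \prod_(i <- s) \int[P]_w (phi i (X i w))%:E)%E.
Proof.
move=> + mphi phi0; elim: s => [|i s IHs] us.
  under eq_integral do rewrite big_nil.
  by rewrite big_nil integral_cst//= mul1e probability_setT.
rewrite big_cons -IHs; last by case/andP: us.
have ust : uniq (s ++ [:: i]) by rewrite cats1 rcons_uniq.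
have mi : measurable_fun setT (fun w => (phi i (X i w))%:E).
  by apply/measurable_EFinP; apply: measurableT_comp => //; exact: indepX.1.
have mprod (dT : measure_display) (T : measurableType dT) (Z : I -> T -> R) (r : seq I) :
    (forall j, j \in r -> measurable_fun setT (Z j)) ->
    measurable_fun setT (fun w => \prod_(j <- r) phi j (Z j w)).
  elim: r => [|j r IHr] mZ.
    by under eq_fun do rewrite big_nil; exact: measurable_cst.
  under eq_fun do rewrite big_cons.
  apply: measurable_funM.
    by apply: measurableT_comp => //; apply: mZ; rewrite mem_head.
  by apply: IHr => k kr; apply: mZ; rewrite inE kr orbT.
under eq_integral do rewrite big_cons.
rewrite (@coord_indep_integral s [:: i] _ R (X i) ust _
  (fun z => (phi i z.2 * \prod_(j <- s) phi j (X j z.1))%:E)).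
- have inner w : (\int[P]_w' (phi i (X i w') * \prod_(j <- s) phi j (X j w))%:E =
      \int[P]_w' (phi i (X i w'))%:E * (\prod_(j <- s) phi j (X j w))%:E)%E.
    under eq_integral do rewrite EFinM.
    apply: ge0_integralZr => //.
    - by move=> ? _; rewrite lee_fin.
    - by rewrite lee_fin prodr_ge0.
  under eq_integral do rewrite inner.
  apply: ge0_integralZl => //.
  - apply/measurable_EFinP; apply: mprod => j _; exact: indepX.1.
  - by move=> w _; rewrite lee_fin prodr_ge0.
  - by apply: integral_ge0 => w _; rewrite lee_fin.
- by apply: coord_measurable; rewrite mem_head.
- apply/measurable_EFinP; apply: measurable_funM.
    by apply: measurableT_comp => //; exact: measurable_snd.
  apply: (mprod _ (g_sigma_algebraType (coord_boxes X s) * R)%type (fun j z => X j z.1)) => j js.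
  by apply: (measurableT_comp (coord_measurable X s j js)).
- by move=> z; rewrite lee_fin mulr_ge0// prodr_ge0.
Qed.

End Independence.

(** * Gaussian measures *)

Section Density.
Local Open Scope ereal_scope.
Context {dT : measure_display} {T : measurableType dT} {R : realType}.
Variables (mu : {measure set T -> \bar R}) (f : T -> R).
Hypotheses (mf : measurable_fun setT f) (f0 : forall x, (0 <= f x)%R).

Definition density_measure (A : set T) : \bar R := \int[mu]_(x in A) (f x)%:E.

Let density0 : density_measure set0 = 0.
Proof. by rewrite /density_measure integral_set0. Qed.

Let density_ge0 A : 0 <= density_measure A.
Proof. by apply: integral_ge0 => x _; rewrite lee_fin. Qed.

Let density_sigma_additive : semi_sigma_additive density_measure.
Proof.
move=> A mA tA mUA; rewrite /density_measure ge0_integral_bigcup//; last 2 first.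
- by apply/measurable_EFinP; exact: measurable_funTS.
- by move=> x _; rewrite lee_fin.
apply: is_cvg_ereal_nneg_natsum_cond => n _ _.
by apply: integral_ge0 => x _; rewrite lee_fin.
Qed.

Definition density_pack : {measure set T -> \bar R} :=
  HB.pack density_measure (isMeasure.Build _ _ _
  density_measure density0 density_ge0 density_sigma_additive).

Import HBNNSimple.

(** Linearity settles simple functions and monotone convergence the rest. [nu] is an arbitrary
    measure agreeing with the density on measurable sets, so that it can be a normal law or an image
    law. *)
Lemma integral_density (nu : {measure set T -> \bar R}) :
  (forall A, measurable A -> nu A = density_measure A) ->
  forall g : T -> \bar R, measurable_fun setT g -> (forall x, 0 <= g x) ->
  \int[nu]_x g x = \int[mu]_x (g x * (f x)%:E).
Proof.
move=> nuE g mg g0.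
have mfE : measurable_fun setT (fun x => (f x)%:E) by exact/measurable_EFinP.
pose h := nnsfun_approx measurableT mg.
have -> : \int[nu]_x g x = lim (\int[nu]_x (EFin \o h n) x @[n --> \oo]).
  have gE x : g x = lim ((EFin \o h n) x @[n --> \oo]).
    by apply/esym/cvg_lim => //; exact: cvg_nnsfun_approx.
  under eq_integral do rewrite gE.
  apply: monotone_convergence => //.
  - by move=> n; apply/measurable_EFinP.
  - by move=> n x _; rewrite lee_fin.
  - by move=> x _ a b ab; rewrite lee_fin; exact/lefP/nd_nnsfun_approx.
have -> : \int[mu]_x (g x * (f x)%:E) =
    lim (\int[mu]_x ((h n x)%:E * (f x)%:E) @[n --> \oo]).
  have gE x : g x * (f x)%:E = lim ((h n x)%:E * (f x)%:E @[n --> \oo]).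
    by apply/esym/cvg_lim => //; apply: cvgeZr => //; exact: cvg_nnsfun_approx.
  under eq_integral do rewrite gE.
  apply: monotone_convergence => //.
  - by move=> n; apply: emeasurable_funM => //; exact/measurable_EFinP.
  - by move=> n x _; rewrite mule_ge0 ?lee_fin.
  - move=> x _ a b ab; rewrite lee_wpmul2r ?lee_fin//.
    exact/lefP/nd_nnsfun_approx.
suff suf n : \int[mu]_x ((h n x)%:E * (f x)%:E) = \int[nu]_x (h n x)%:E.
  by under [in RHS]eq_fun do rewrite suf.
transitivity (\int[nu]_x
   (\sum_(y \in range (h n)) (y * \1_(h n @^-1` [set y]) x)%:E)); last first.
  by apply: eq_integral => t _; rewrite /= fimfunE -fsumEFin.
have indich (r : R) : measurable_fun setT (fun x => (r * \1_(h n @^-1` [set r]) x)%:E).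
  by apply: (measurable_comp measurableT) => //; exact: measurable_funM.
rewrite ge0_integral_fsum//; last by move=> y x _; exact: nnfun_muleindic_ge0.
transitivity (\int[mu]_x (\sum_(y \in range (h n))
    (y * \1_(h n @^-1` [set y]) x)%:E * (f x)%:E)).
  apply: eq_integral => x _.
  rewrite -ge0_mule_fsuml => [|y]; last exact: nnfun_muleindic_ge0.
  by rewrite fsumEFin // -(fimfunE _ x).
rewrite ge0_integral_fsum//; last 2 first.
  - by move=> y; apply: emeasurable_funM.
  - by move=> y x _; rewrite mule_ge0 ?lee_fin// -lee_fin nnfun_muleindic_ge0.
apply: eq_fsbigr => r rhn.
under [RHS]eq_integral do rewrite EFinM.
rewrite integralZl_indic_nnsfun => //.
under eq_integral do rewrite EFinM -muleA.
rewrite ge0_integralZl//.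
- under eq_integral do rewrite muleC.
  rewrite (eq_integral ((EFin \o f) \_ (h n @^-1` [set r]))); last first.
    by move=> x xE; rewrite epatch_indic.
  rewrite -integral_mkcond integral_indic// setIT nuE//.
- by apply: emeasurable_funM => //; exact/measurable_EFinP.
- by move=> t _; rewrite mule_ge0 ?lee_fin.
- by move: rhn; rewrite inE => -[t _ <-]; rewrite lee_fin.
Qed.

End Density.

Section NormalLaw.
Context {R : realType}.
Local Notation lambda := (@lebesgue_measure R).
Local Notation N01 := (@normal_prob R 0 1).

Lemma lebesgue_shift (h : R) (phi : R -> \bar R) : measurable_fun setT phi ->
  (forall x, 0 <= phi x)%E ->
  (\int[lambda]_x phi x = \int[lambda]_x phi (x + h)%R)%E.
Proof.
move=> mphi phi0.
have mh : measurable_fun setT (fun x : measurableTypeR R => x + h : measurableTypeR R).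
  by apply: measurable_funD => //; exact: measurable_cst.
pose sh : {mfun measurableTypeR R >-> measurableTypeR R} :=
  HB.pack (fun x => x + h) (isMeasurableFun.Build _ _ _ _ _ mh).
have E A : measurable A -> lambda A = pushforward lambda sh A.
  apply: lebesgue_measure_unique => _ [[a b] _ <-] /=.
  rewrite /pushforward/=.
  have -> : (fun x => x + h) @^-1` `]a, b]%classic = `]a - h, b - h]%classic.
    by apply/seteqP; split=> x /=; rewrite !in_itv/= ltrBlDr lerBrDr.
  rewrite !lebesgue_measure_itv/= !lte_fin ltrD2r.
  by case: ifP => // _; rewrite -!EFinB; congr (_%:E); ring.
transitivity (\int[pushforward lambda sh]_x phi x)%E.
  by apply: eq_measure_integral => A mA _; exact: E.
by rewrite ge0_integral_pushforward.
Qed.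

Lemma integral_normal01 (g : R -> \bar R) : measurable_fun setT g ->
  (forall x, 0 <= g x)%E ->
  (\int[N01]_x g x = \int[lambda]_x (g x * (normal_pdf 0 1 x)%:E))%E.
Proof.
move=> mg g0; apply: integral_density => //; first exact: measurable_normal_pdf.
by move=> x; exact: normal_pdf_ge0.
Qed.

Lemma normal_pdf_tilt (h x : R) :
  expR (h * x - h ^+ 2 / 2) * normal_pdf 0 1 x = normal_pdf 0 1 (x - h).
Proof.
rewrite !normal_pdfE ?oner_eq0// mulrCA; congr (_ * _).
by rewrite /normal_fun -expRD; congr expR; field.
Qed.

(** One-dimensional Cameron-Martin formula on sets: completing the square turns the tilted density
    into a translated one, and Lebesgue measure is translation invariant. *)
Lemma normal01_tilt (h : R) (B : set R) : measurable B ->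
  (\int[N01]_(x in B) (expR (h * x - h ^+ 2 / 2))%:E =
   N01 ((fun x => x + h)%R @^-1` B))%E.
Proof.
move=> mB.
have mt : measurable_fun setT (fun x : R => expR (h * x - h ^+ 2 / 2)).
  by apply: measurableT_comp => //; apply: measurable_funB.
have mr : measurable_fun setT ((fun x : R => (expR (h * x - h ^+ 2 / 2))%:E) \_ B).
  apply: (measurable_restrictT _ mB).1.
  by apply/measurable_funTS/measurable_EFinP.
rewrite integral_mkcond integral_normal01; last 2 first.
- exact: mr.
- by move=> x; apply: erestrict_ge0 => y _; rewrite lee_fin expR_ge0.
rewrite (lebesgue_shift h); last 2 first.
- apply: emeasurable_funM; first exact: mr.
  by apply/measurable_EFinP; exact: measurable_normal_pdf.
- move=> x; rewrite mule_ge0 ?lee_fin ?normal_pdf_ge0//.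
  by apply: erestrict_ge0 => y _; rewrite lee_fin expR_ge0.
rewrite /normal_prob [RHS]integral_mkcond; apply: eq_integral => x _.
rewrite /patch; have -> : (x \in (fun x => x + h) @^-1` B) = (x + h \in B).
  by apply/idP/idP; rewrite !inE.
case: ifP => _; last by rewrite mul0e.
by rewrite -EFinM normal_pdf_tilt addrK.
Qed.

(** With s = (1 - 2a)^(-1/2), the integrand times the standard density is s times the density of
    N(0, s^2). *)
Lemma normal01_exp_sq (a : R) : a < 2^-1 ->
  (\int[N01]_x (expR (a * x ^+ 2))%:E = ((Num.sqrt (1 - 2 * a))^-1)%:E)%E.
Proof.
move=> a2; have a0 : 0 < 1 - 2 * a by lra.
pose s := (Num.sqrt (1 - 2 * a))^-1.
have s0 : 0 < s by rewrite invr_gt0 sqrtr_gt0.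
have s2 : s ^+ 2 = (1 - 2 * a)^-1 by rewrite exprVn sqr_sqrtr ?ltW.
rewrite integral_normal01; last 2 first.
- apply/measurable_EFinP; apply: measurableT_comp => //.
  by apply: measurable_funM => //; exact: measurable_funX.
- by move=> x; rewrite lee_fin expR_ge0.
transitivity (\int[lambda]_x (s%:E * (normal_pdf 0 s x)%:E))%E; last first.
  rewrite ge0_integralZl//; last 3 first.
  - by apply/measurable_EFinP; exact: measurable_normal_pdf.
  - by move=> x _; rewrite lee_fin normal_pdf_ge0.
  - by rewrite lee_fin ltW.
  by rewrite integral_normal_pdf mule1.
apply: eq_integral => x _; rewrite -!EFinM; congr (_%:E).
rewrite !normal_pdfE ?oner_eq0 ?gt_eqF// /normal_peak /normal_fun.
rewrite expr1n mul1r mulrCA -expRD !mulrA; congr (_ * expR _).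
  rewrite -mulrnAr sqrtrM ?sqr_ge0// sqrtr_sqr gtr0_norm// invfM mulrA divff ?gt_eqF//.
  by rewrite mul1r.
rewrite s2; field; rewrite gt_eqF//.
Qed.

End NormalLaw.

(** * Algebra of continuity for the Euclidean norm *)

Section EContinuityAlgebra.
Context {R : realType} {d : nat}.
Implicit Types (f g : 'rV[R]_d -> R) (x v : 'rV[R]_d).

(** Continuity is recast as convergence along this filter, so that the limit rules for sums,
    products and inverses of real functions apply. *)
Definition enbhs x : set_system 'rV[R]_d :=
  filter_from [set r : R | 0 < r] (fun r => [set y | enorm (y - x) < r]).

Global Instance enbhs_filter x : Filter (enbhs x).
Proof.
apply: filter_from_filter; first by exists 1 => /=.
move=> r s /= r0 s0; exists (Num.min r s) => /=; first by rewrite lt_min r0.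
by move=> y /=; rewrite lt_min => /andP[].
Qed.

Lemma econtinuousP f :
  econtinuous f <-> forall x, (f @ enbhs x --> f x)%classic.
Proof.
split=> [cf x|cf x e e0].
  apply/cvgrPdist_lt => e e0; have [r r0 Hr] := cf x e e0.
  by exists r => // y /= /Hr; rewrite distrC.
have /cvgrPdist_lt /(_ e e0) [r /= r0 Hr] := cf x.
by exists r => // y /Hr; rewrite /= distrC.
Qed.

Lemma econtinuous_cst (c : R) : econtinuous (fun _ : 'rV[R]_d => c).
Proof. by apply/econtinuousP => x; exact: cvg_cst. Qed.

Lemma econtinuousD f g : econtinuous f -> econtinuous g ->
  econtinuous (fun z => f z + g z).
Proof.
by move=> /econtinuousP cf /econtinuousP cg; apply/econtinuousP => x; exact: cvgD.
Qed.

Lemma econtinuousM f g : econtinuous f -> econtinuous g ->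
  econtinuous (fun z => f z * g z).
Proof.
by move=> /econtinuousP cf /econtinuousP cg; apply/econtinuousP => x; exact: cvgM.
Qed.

Lemma econtinuous_comp f (h : R -> R) : econtinuous f -> continuous h ->
  econtinuous (fun z => h (f z)).
Proof.
move=> /econtinuousP cf ch; apply/econtinuousP => x.
by apply: (cvg_comp f h); [exact: cf|exact: ch].
Qed.

Lemma econtinuousN f : econtinuous f -> econtinuous (fun z => - f z).
Proof.
by move=> /econtinuousP cf; apply/econtinuousP => x; exact: cvgN.
Qed.

Lemma econtinuousB f g : econtinuous f -> econtinuous g ->
  econtinuous (fun z => f z - g z).
Proof. by move=> cf cg; apply: econtinuousD => //; exact: econtinuousN. Qed.

Lemma econtinuousX f n : econtinuous f -> econtinuous (fun z => f z ^+ n).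
Proof.
move=> cf; elim: n => [|n IHn]; first exact: econtinuous_cst.
by under eq_fun do rewrite exprS; exact: econtinuousM.
Qed.

Lemma econtinuousV f : econtinuous f -> (forall z, f z != 0) ->
  econtinuous (fun z => (f z)^-1).
Proof.
by move=> /econtinuousP cf f0; apply/econtinuousP => x; exact: cvgV.
Qed.

Lemma econtinuous_sum (I : Type) (s : seq I) (F : I -> 'rV[R]_d -> R) :
  (forall i, econtinuous (F i)) -> econtinuous (fun z => \sum_(i <- s) F i z).
Proof.
move=> cF; elim: s => [|i s IHs].
  by under eq_fun do rewrite big_nil; exact: econtinuous_cst.
by under eq_fun do rewrite big_cons; exact: econtinuousD.
Qed.

Lemma econtinuous_lip f (L : R) : (forall x y, `|f x - f y| <= L * enorm (x - y)) ->
  econtinuous f.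
Proof.
move=> Lf x e e0; exists (e / (`|L| + 1)); first by rewrite divr_gt0// ltr_wpDl.
move=> y; rewrite ltr_pdivlMr ?ltr_wpDl// => h.
rewrite (le_lt_trans (Lf _ _))// (le_lt_trans _ h)// mulrC ler_wpM2l//.
by rewrite (le_trans (ler_norm _))// lerDl.
Qed.

Lemma econtinuous_coord i : econtinuous (fun z : 'rV[R]_d => z 0 i).
Proof.
apply: (@econtinuous_lip _ 1) => x y; rewrite mul1r.
by have := enorm_coord (x - y) i; rewrite !mxE.
Qed.

Lemma econtinuous_enorm : econtinuous (@enorm R d).
Proof.
apply: (@econtinuous_lip _ 1) => x y; rewrite mul1r ler_norml; apply/andP; split.
  have := enormD (y - x) x; rewrite subrK enormBC; lra.
have := enormD (x - y) y; rewrite subrK; lra.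
Qed.

Lemma econtinuous_dotv v : econtinuous (dotv v).
Proof.
by apply: econtinuous_sum => i; apply: econtinuousM;
  [exact: econtinuous_cst|exact: econtinuous_coord].
Qed.

Lemma econtinuous_vcomp f (X : 'rV[R]_d -> 'rV[R]_d) : econtinuous f ->
  (forall i, econtinuous (fun z => X z 0 i)) -> econtinuous (fun z => f (X z)).
Proof.
move=> cf cX x e e0; have [r r0 Hr] := cf (X x) e e0.
pose f' z := \sum_(i < d) `|X z 0 i - X x 0 i|.
have cf' : econtinuous f'.
  apply: econtinuous_sum => i; apply: econtinuous_comp; last exact: norm_continuous.
  by apply: econtinuousB => //; exact: econtinuous_cst.
have [s s0 Hs] := cf' x r r0; exists s => // y /Hs.
have -> : f' x = 0 by rewrite /f' big1// => i _; rewrite subrr normr0.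
rewrite subr0 => h; apply: Hr; apply: le_lt_trans h; apply: (le_trans _ (ler_norm _)).
rewrite (le_trans (enorm_le_sum _))// /f'.
by apply: ler_sum => i _; rewrite !mxE.
Qed.

Lemma econtinuous_shift f x (s : R) : econtinuous f ->
  econtinuous (fun z => f (x + s *: z)).
Proof.
move=> cf; apply: econtinuous_vcomp => // i; under eq_fun do rewrite !mxE.
apply: econtinuousD; first exact: econtinuous_cst.
by apply: econtinuousM; [exact: econtinuous_cst|exact: econtinuous_coord].
Qed.

Lemma econtinuous_locally_lipschitz f : locally_lipschitz f -> econtinuous f.
Proof.
move=> lf x e e0; have [r [r0 [L Lf]]] := lf x.
have L0 : 0 < `|L| + 1 by rewrite ltr_wpDl.
exists (Num.min r (e / (`|L| + 1))); first by rewrite lt_min r0 divr_gt0.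
move=> y; rewrite lt_min ltr_pdivlMr// => /andP[yr h].
have xx : enorm (x - x) < r by rewrite subrr enorm0.
rewrite (le_lt_trans (Lf _ _ yr xx))// (le_lt_trans _ h)// mulrC ler_wpM2l//.
by rewrite (le_trans (ler_norm _))// lerDl.
Qed.

End EContinuityAlgebra.

Definition row_coord {R : realType} {d : nat} (i : 'I_d) (z : 'rV[R]_d) : R := z 0 i.

Notation gspace R d := (g_sigma_algebraType
  (coord_boxes (@row_coord R d) (index_enum 'I_d))).

(** * The standard Gaussian law on row vectors *)

Section GaussianLaw.
Context {R : realType} {d : nat}.
Local Notation N01 := (@normal_prob R 0 1).

(** Boxes form a generating pi-system, so prescribing their probabilities determines the law. *)
Definition std_gaussian_law (gam : probability (gspace R d) R) : Prop :=
  forall B, (forall i, measurable (B i)) ->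
  gam (coord_box row_coord (index_enum 'I_d) B) = (\prod_(i < d) N01 (B i))%E.

Lemma measurable_row_coord i : measurable_fun setT (row_coord i : gspace R d -> R).
Proof. by apply: coord_measurable; rewrite mem_index_enum. Qed.

Lemma measurable_econtinuous (phi : 'rV[R]_d -> R) : econtinuous phi ->
  measurable_fun setT (phi : gspace R d -> R).
Proof.
by move=> cphi; apply: (measurable_econtinuous_comp _ (gspace R d) (fun z => z) phi) => //;
  exact: measurable_row_coord.
Qed.

Lemma gspace_measure_unique (m1 m2 : {measure set (gspace R d) -> \bar R}) :
  (forall B, (forall i, measurable (B i)) ->
    m1 (coord_box row_coord (index_enum 'I_d) B) =
    m2 (coord_box row_coord (index_enum 'I_d) B)) ->
  (m1 setT < +oo)%E -> forall A, measurable A -> m1 A = m2 A.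
Proof.
move=> H fin A mA; pose G := coord_boxes (@row_coord R d) (index_enum 'I_d).
have cover : \bigcup_(k : nat) (setT : set (gspace R d)) = setT.
  by rewrite bigcup_const//; exists 0%N.
apply: (@measure_unique _ R (gspace R d) G (fun=> setT)) => //.
- exact: coord_boxes_setI.
- by move=> _; exact: coord_boxes_setT.
- by move=> _ [B [mB ->]]; exact: H.
Qed.

Variable gam : probability (gspace R d) R.
Hypothesis gamP : std_gaussian_law gam.

Lemma gaussian_box_seq (s : seq 'I_d) B : uniq s -> (forall i, measurable (B i)) ->
  gam (coord_box row_coord s B) = (\prod_(i <- s) N01 (B i))%E.
Proof.
move=> us mB.
have -> : coord_box row_coord s B = coord_box row_coord (index_enum 'I_d)
    (fun i => if i \in s then B i else setT).
  apply/seteqP; split=> z /coord_boxP h; apply/coord_boxP => i si.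
    by case: ifP => // /h.
  by have := h i; rewrite mem_index_enum si; apply.
rewrite gamP => [|i]; last by case: ifP.
rewrite (bigID (fun i => i \in s))/= [X in (_ * X)%E]big1 ?mule1.
  by rewrite -big_uniq//=; apply: eq_big_seq => i ->.
by move=> i /negbTE ->; rewrite probability_setT.
Qed.

Lemma gaussian_coord i B : measurable B -> gam (row_coord i @^-1` B) = N01 B.
Proof.
move=> mB; have := gaussian_box_seq [:: i] (fun=> B) isT (fun=> mB).
by rewrite /coord_box !big_seq1.
Qed.

Lemma gaussian_indep : mutually_independent_rv gam (@row_coord R d).
Proof.
split=> [i|s B us mB]; first exact: measurable_row_coord.
have := gaussian_box_seq s B us mB; rewrite /coord_box => ->.
by apply: eq_bigr => i _; rewrite gaussian_coord.
Qed.

Lemma gaussian_coord_integral i (phi : R -> \bar R) : measurable_fun setT phi ->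
  (forall x, 0 <= phi x)%E ->
  (\int[gam]_z phi (row_coord i z) = \int[N01]_x phi x)%E.
Proof.
move=> mphi phi0.
have mc : measurable_fun setT (row_coord i : gspace R d -> measurableTypeR R).
  exact: measurable_row_coord.
pose c : {mfun gspace R d >-> measurableTypeR R} :=
  HB.pack (row_coord i : gspace R d -> measurableTypeR R)
    (isMeasurableFun.Build _ _ _ _ _ mc).
rewrite -[LHS](ge0_integral_distribution c mphi phi0).
by apply: eq_measure_integral => A mA _; exact: gaussian_coord.
Qed.

Lemma gaussian_prod (phi : 'I_d -> R -> R) :
  (forall i, measurable_fun setT (phi i)) -> (forall i r, 0 <= phi i r) ->
  (\int[gam]_z (\prod_(i < d) phi i (row_coord i z))%:E =
   \prod_(i < d) \int[N01]_x (phi i x)%:E)%E.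
Proof.
move=> mphi phi0.
have := integral_prod_indep gam _ gaussian_indep (index_enum 'I_d) phi
  (index_enum_uniq _) mphi phi0.
move=> ->; apply: eq_bigr => i _.
apply: (gaussian_coord_integral i (fun x => (phi i x)%:E)).
  exact/measurable_EFinP.
by move=> x; rewrite lee_fin.
Qed.

Lemma prod_EFin (F : 'I_d -> R) : (\prod_(i < d) (F i)%:E = (\prod_(i < d) F i)%:E)%E.
Proof. by elim/big_rec2 : _ => // i x y _ ->; rewrite EFinM. Qed.

Lemma gaussian_exp_sq (a : R) : a < 2^-1 ->
  (\int[gam]_z (expR (a * enorm z ^+ 2))%:E = ((Num.sqrt (1 - 2 * a))^-1 ^+ d)%:E)%E.
Proof.
move=> a2; transitivity (\int[gam]_z (\prod_(i < d) expR (a * row_coord i z ^+ 2))%:E)%E.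
  apply: eq_integral => z _; rewrite -expR_sum -mulr_sumr enorm_sqr /dotv; congr (expR (_ * _))%:E.
rewrite (gaussian_prod (fun i x => expR (a * x ^+ 2))).
- under eq_bigr do rewrite normal01_exp_sq//.
  by rewrite prod_EFin prodr_const card_ord.
- move=> i; apply: measurableT_comp => //.
  by apply: measurable_funM => //; exact: measurable_funX.
- by move=> i r; exact: expR_ge0.
Qed.

(** Cameron-Martin in dimension d. The image law and the law with the tilted density are compared on
    boxes, where the density and the indicator both factor over coordinates and the one-dimensional
    formula applies. *)
Lemma gaussian_shift (h : 'rV[R]_d) (phi : gspace R d -> \bar R) :
  measurable_fun setT phi -> (forall z, 0 <= phi z)%E ->
  (\int[gam]_z phi (z + h)%R =
   \int[gam]_z (phi z * (expR (dotv h z - enorm h ^+ 2 / 2))%:E))%E.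
Proof.
move=> mphi phi0.
have msh : measurable_fun setT (fun z : gspace R d => (z + h : gspace R d)%R).
  apply: measurable_to_coord => i _; under eq_fun do rewrite /row_coord mxE.
  by apply: measurable_funD; [exact: measurable_row_coord|exact: measurable_cst].
pose sh : {mfun gspace R d >-> gspace R d} :=
  HB.pack (fun z : gspace R d => (z + h : gspace R d)%R) (isMeasurableFun.Build _ _ _ _ _ msh).
pose rho (z : gspace R d) : R := expR (dotv h z - enorm h ^+ 2 / 2).
have mrho : measurable_fun setT rho.
  apply: measurable_econtinuous; apply: econtinuous_comp; last exact: continuous_expR.
  by apply: econtinuousB; [exact: econtinuous_dotv|exact: econtinuous_cst].
have rho0 z : 0 <= rho z by exact: expR_ge0.
rewrite -[LHS](ge0_integral_distribution sh mphi phi0).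
apply: (integral_density gam rho mrho rho0) => //.
move=> A mA; apply: (gspace_measure_unique (distribution gam sh)
  (density_pack gam rho mrho rho0)) => //; last first.
  by have := probability_setT (distribution gam sh) => /= ->; rewrite ltry.
move=> B mB.
transitivity (gam (coord_box row_coord (index_enum 'I_d)
    (fun i => (fun x => x + h 0 i) @^-1` B i))).
  apply: (congr1 gam); apply/seteqP; split=> z /= /coord_boxP H; apply/coord_boxP => i /H;
  by rewrite /row_coord/= mxE.
rewrite gamP; last first.
  move=> i; rewrite -[X in measurable X]setTI.
  have mD : measurable_fun setT (fun x : R => x + h 0 i) by exact: measurable_funD.
  exact: mD.
have mt (i : 'I_d) : measurable_fun setT (fun x : R => expR (h 0 i * x - h 0 i ^+ 2 / 2)).
  by apply: measurableT_comp => //; apply: measurable_funB.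
rewrite /density_pack/= /density_measure integral_mkcond.
transitivity (\int[gam]_z (\prod_(i < d) (\1_(B i) (row_coord i z) *
    expR (h 0 i * row_coord i z - h 0 i ^+ 2 / 2)))%:E)%E.
  rewrite (gaussian_prod (fun i x => \1_(B i) x * expR (h 0 i * x - h 0 i ^+ 2 / 2))).
  - apply: eq_bigr => i _; rewrite -normal01_tilt// integral_mkcond.
    apply: eq_integral => x _; rewrite /patch indicE; case: ifP => _.
      by rewrite mul1r.
    by rewrite mul0r.
  - by move=> i; apply: measurable_funM => //; exact: measurable_indic.
  - by move=> i r; rewrite mulr_ge0 ?expR_ge0// indicE ler0n.
apply: eq_integral => z _; rewrite /patch.
case: ifPn => [|]; rewrite ?inE ?notin_setE.
  move=> /coord_boxP H.
  rewrite /rho; congr (_%:E); rewrite big_split/= big1 ?mul1r.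
    rewrite -expR_sum sumrB -mulr_suml enorm_sqr /dotv; congr expR.
  by move=> i _; rewrite indicE mem_set//; apply: H; rewrite mem_index_enum.
move=> H; have [i Hi] : exists i, ~ B i (row_coord i z).
  apply: contrapT => H'; apply: H; apply/coord_boxP => i _.
  by apply: contrapT => Hi; apply: H'; exists i.
by rewrite (bigD1 i)//= indicE memNset// !mul0r.
Qed.

End GaussianLaw.

(** * Elementary real inequalities *)

Section ScalarInequalities.
Context {R : realType}.
Implicit Types (a b c t y : R).

(** Each induction step uses that a - b and a^(n+1) - b^(n+1) have the same sign, which bounds the
    cross terms by the pure powers. *)
Lemma exprD_le_pow2 a b n : 0 <= a -> 0 <= b ->
  (a + b) ^+ n.+1 <= 2 ^+ n * (a ^+ n.+1 + b ^+ n.+1).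
Proof.
move=> a0 b0; elim: n => [|n IHn]; first by rewrite expr0 mul1r !expr1.
have sm : 0 <= (a - b) * (a ^+ n.+1 - b ^+ n.+1).
  have [ab|ab] := leP a b.
    have : a ^+ n.+1 <= b ^+ n.+1 by rewrite lerXn2r.
    by move=> h; apply: mulr_le0; lra.
  have : b ^+ n.+1 <= a ^+ n.+1 by rewrite lerXn2r ?nnegrE// ltW.
  by move=> h; apply: mulr_ge0; lra.
rewrite exprS (le_trans (ler_wpM2l _ IHn)) ?addr_ge0// mulrCA [in leRHS]exprSr -mulrA.
rewrite ler_wpM2l ?exprn_ge0// !(exprS _ n.+1); lra.
Qed.

Lemma exprD3_le_pow3 a b c n : 0 <= a -> 0 <= b -> 0 <= c ->
  (a + b + c) ^+ n.+1 <= 3 ^+ n * (a ^+ n.+1 + b ^+ n.+1 + c ^+ n.+1).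
Proof.
move=> a0 b0 c0; elim: n => [|n IHn]; first by rewrite expr0 mul1r !expr1.
have sm x y : 0 <= x -> 0 <= y -> 0 <= (x - y) * (x ^+ n.+1 - y ^+ n.+1).
  move=> x0 y0; have [xy|xy] := leP x y.
    have : x ^+ n.+1 <= y ^+ n.+1 by rewrite lerXn2r.
    by move=> h; apply: mulr_le0; lra.
  have : y ^+ n.+1 <= x ^+ n.+1 by rewrite lerXn2r ?nnegrE// ltW.
  by move=> h; apply: mulr_ge0; lra.
rewrite exprS (le_trans (ler_wpM2l _ IHn)) ?addr_ge0// mulrCA [in leRHS]exprSr -mulrA.
rewrite ler_wpM2l ?exprn_ge0// !(exprS _ n.+1).
have := sm a b a0 b0; have := sm b c b0 c0; have := sm a c a0 c0; lra.
Qed.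

Lemma expR_ge1 y : 0 <= y -> 1 <= expR y.
Proof. by move=> y0; rewrite -expR0 ler_expR. Qed.

Lemma expR_sub1_le y : expR y - 1 <= y * expR y.
Proof.
have := expR_ge1Dx (- y); rewrite expRN => h.
have e0 := expR_gt0 y; move: h; rewrite -(ler_pM2r e0) mulVf ?gt_eqF//; lra.
Qed.

Lemma expR_taylor1 y : 0 <= expR y - 1 - y <= y ^+ 2 * expR `|y|.
Proof.
have h1 := expR_ge1Dx y; have h2 := expR_sub1_le y.
apply/andP; split; first lra.
have [y0|y0] := leP 0 y.
  rewrite ger0_norm//; have : y * (expR y - 1) <= y * (y * expR y) by rewrite ler_wpM2l.
  by rewrite expr2 -mulrA; lra.
have e1 : 1 <= expR `|y| by exact: expR_ge1.
have y2 : y ^+ 2 <= y ^+ 2 * expR `|y| by rewrite ler_peMr// sqr_ge0.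
apply: le_trans y2; have : - y * (1 - expR y) <= - y * - y by rewrite ler_wpM2l//; lra.
rewrite expr2; lra.
Qed.

(** First-order expansion in [t] of the Cameron-Martin density, for p = <h, z> and w = |h|^2 / 2,
    with a remainder uniform over |t| <= 1. *)
Lemma exp_tilt_error (t p q : R) : `|t| <= 1 -> 0 <= q -> `|p| <= q ->
  forall w, 0 <= w -> w <= q ->
  `|expR (t * p - t ^+ 2 * w) - 1 - t * p| <= t ^+ 2 * ((2 * q) ^+ 2 * expR (2 * q) + q).
Proof.
move=> t1 q0 pq w w0 wq; set y := t * p - _.
have yq : `|y| <= `|t| * (2 * q).
  rewrite (le_trans (ler_normB _ _))// !normrM.
  have : `|t| * `|p| <= `|t| * q by rewrite ler_wpM2l.
  have tw : `|t| * `|t| * `|w| <= `|t| * q.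
    rewrite -mulrA ler_wpM2l// (ger0_norm w0) -[leRHS]mul1r.
    by apply: ler_pM.
  lra.
have yq2 : `|y| <= 2 * q by rewrite (le_trans yq)// ler_piMl// mulr_ge0.
have /andP[e0 e1] := expR_taylor1 y.
have h : y ^+ 2 * expR `|y| <= t ^+ 2 * (2 * q) ^+ 2 * expR (2 * q).
  apply: ler_pM; rewrite ?sqr_ge0 ?expR_ge0 ?ler_expR//.
  by rewrite -exprMn -(real_normK (num_real y)) -(real_normK (num_real (t * _))) lerXn2r ?nnegrE// normrM (@ger0_norm _ (2 * q)) ?mulr_ge0.
have hw : t ^+ 2 * w <= t ^+ 2 * q by rewrite ler_wpM2l ?sqr_ge0.
have tw0 : 0 <= t ^+ 2 * w by rewrite mulr_ge0 ?sqr_ge0.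
have -> : expR y - 1 - t * p = (expR y - 1 - y) - t ^+ 2 * w by rewrite /y; ring.
rewrite mulrDr mulrA ler_norml; apply/andP; split; last lra.
have : 0 <= t ^+ 2 * (2 * q) ^+ 2 * expR (2 * q) by rewrite mulr_ge0 ?expR_ge0// mulr_ge0 ?sqr_ge0.
lra.
Qed.

Lemma poly_le_exp_sq (a : R) n : 0 < a -> exists2 C : R, 0 <= C &
  forall t, 0 <= t -> (1 + t) ^+ n <= C * expR (a * t ^+ 2).
Proof.
move=> a0; pose C := 2 ^+ n * (2 + n`!%:R / a ^+ n).
exists C; first by rewrite mulr_ge0 ?exprn_ge0// addr_ge0// divr_ge0 ?exprn_ge0 ?ltW.
move=> t t0.
have e1 : 1 <= expR (a * t ^+ 2) by apply: expR_ge1; rewrite mulr_ge0 ?sqr_ge0 ?ltW.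
have h2 : (1 + t) ^+ n <= 2 ^+ n * (1 + t ^+ n).
  case: n {C} => [|n]; first by rewrite !expr0; lra.
  have := exprD_le_pow2 1 t n ler01 t0; rewrite expr1n => h; apply: le_trans h _.
  rewrite ler_wpM2r// ?addr_ge0 ?exprn_ge0//.
  by rewrite [leRHS]exprS ler_peMl ?exprn_ge0// ler1n.
have h3 : t ^+ n <= 1 + t ^+ n * t ^+ n.
  have := sqr_ge0 (t ^+ n - 1); have : 0 <= t ^+ n by rewrite exprn_ge0.
  rewrite !expr2; lra.
have h4 : t ^+ n * t ^+ n <= n`!%:R / a ^+ n * expR (a * t ^+ 2).
  have at0 : 0 <= a * t ^+ 2 by rewrite mulr_ge0 ?sqr_ge0 ?ltW.
  have an0 : 0 < a ^+ n by rewrite exprn_gt0.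
  have nf : 0 < n`!%:R :> R by rewrite ltr0n fact_gt0.
  have hn : (a * t ^+ 2) ^+ n / n`!%:R <= expR (a * t ^+ 2).
    case: n {C h2 h3 an0 nf} => [|n]; first by rewrite expr0 fact0 divr1.
    by have := expR_ge1Dxn n at0; lra.
  move: hn; rewrite ler_pdivrMr// exprMn -exprM mulnC exprM expr2 => hn.
  rewrite mulrAC ler_pdivlMr// mulrC [leRHS]mulrC; exact: hn.
apply: le_trans h2 _; rewrite /C -mulrA ler_wpM2l ?exprn_ge0//.
rewrite mulrDl; lra.
Qed.

End ScalarInequalities.

(** * Integration of functions of polynomial growth *)

Section GaussianExpectation.
Context {R : realType} {d : nat}.
Implicit Types (phi psi : 'rV[R]_d -> R).

Definition pgrowth phi : Prop := exists C : R, exists N : nat, 0 <= C /\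
  forall z, `|phi z| <= C * (1 + enorm z) ^+ N.

(** A class stable under the algebraic operations in which Gaussian integrability is automatic. *)
Definition tame phi : Prop := econtinuous phi /\ pgrowth phi.

Lemma one_enorm_ge1 (z : 'rV[R]_d) : 1 <= 1 + enorm z.
Proof. by rewrite lerDl. Qed.

Lemma pgrowth_le phi (C : R) N : (forall z, `|phi z| <= C * (1 + enorm z) ^+ N) ->
  pgrowth phi.
Proof.
move=> H; exists `|C|, N; split => // z; rewrite (le_trans (H z))// ler_wpM2r ?ler_norm//.
by rewrite exprn_ge0// addr_ge0.
Qed.

Lemma tame_cst (c : R) : tame (fun=> c).
Proof.
split; first exact: econtinuous_cst.
by apply: (pgrowth_le _ `|c| 0) => z; rewrite expr0 mulr1.
Qed.

Lemma pgrowthD phi psi : pgrowth phi -> pgrowth psi -> pgrowth (fun z => phi z + psi z).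
Proof.
move=> [C [N [C0 HC]]] [D [M [D0 HD]]]; apply: (pgrowth_le _ (C + D) (N + M)) => z.
rewrite (le_trans (ler_normD _ _))// mulrDl lerD//.
  rewrite (le_trans (HC z))// ler_wpM2l// exprD ler_peMr ?exprn_ge0 ?addr_ge0//.
  by rewrite exprn_ege1// one_enorm_ge1.
rewrite (le_trans (HD z))// ler_wpM2l// exprD ler_peMl ?exprn_ge0 ?addr_ge0//.
by rewrite exprn_ege1// one_enorm_ge1.
Qed.

Lemma pgrowthM phi psi : pgrowth phi -> pgrowth psi -> pgrowth (fun z => phi z * psi z).
Proof.
move=> [C [N [C0 HC]]] [D [M [D0 HD]]]; apply: (pgrowth_le _ (C * D) (N + M)) => z.
by rewrite normrM exprD mulrACA ler_pM.
Qed.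

Lemma tameD phi psi : tame phi -> tame psi -> tame (fun z => phi z + psi z).
Proof.
by move=> [c1 p1] [c2 p2]; split; [exact: econtinuousD|exact: pgrowthD].
Qed.

Lemma tameM phi psi : tame phi -> tame psi -> tame (fun z => phi z * psi z).
Proof.
by move=> [c1 p1] [c2 p2]; split; [exact: econtinuousM|exact: pgrowthM].
Qed.

Lemma tameZ (a : R) phi : tame phi -> tame (fun z => a * phi z).
Proof. by move=> tp; apply: tameM => //; exact: tame_cst. Qed.

Lemma tameN phi : tame phi -> tame (fun z => - phi z).
Proof. by move=> /(tameZ (- 1)); under eq_fun do rewrite mulN1r. Qed.

Lemma tameB phi psi : tame phi -> tame psi -> tame (fun z => phi z - psi z).
Proof. by move=> tp tq; apply: tameD => //; exact: tameN. Qed.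

Lemma tameX phi n : tame phi -> tame (fun z => phi z ^+ n).
Proof.
move=> tp; elim: n => [|n IHn]; first exact: tame_cst.
by under eq_fun do rewrite exprS; exact: tameM.
Qed.

Lemma tame_enorm : tame (@enorm R d).
Proof.
split; first exact: econtinuous_enorm.
apply: (pgrowth_le _ 1 1) => z; rewrite expr1 mul1r ger0_norm//; lra.
Qed.

Lemma tame_coord i : tame (fun z : 'rV[R]_d => z 0 i).
Proof.
split; first exact: econtinuous_coord.
apply: (pgrowth_le _ 1 1) => z; rewrite expr1 mul1r.
have := enorm_coord z i; lra.
Qed.

Lemma tame_dotv v : tame (@dotv R d v).
Proof.
split; first exact: econtinuous_dotv.
apply: (pgrowth_le _ (enorm v) 1) => z; rewrite expr1.
by rewrite (le_trans (dotv_cauchy_abs _ _))// ler_wpM2l// lerDr.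
Qed.

Lemma tame_sum (I : Type) (s : seq I) (F : I -> 'rV[R]_d -> R) :
  (forall i, tame (F i)) -> tame (fun z => \sum_(i <- s) F i z).
Proof.
move=> cF; elim: s => [|i s IHs].
  by under eq_fun do rewrite big_nil; exact: tame_cst.
by under eq_fun do rewrite big_cons; exact: tameD.
Qed.

Lemma tame_le phi psi : econtinuous phi -> tame psi ->
  (forall z, `|phi z| <= psi z) -> tame phi.
Proof.
move=> cphi [_ [C [N [C0 H]]]] h; split => //; exists C, N; split => // z.
by rewrite (le_trans (h z))// (le_trans (ler_norm _)).
Qed.

Variable gam : probability (gspace R d) R.
Hypothesis gamP : std_gaussian_law gam.

Local Notation Eg phi := (\int[gam]_z phi z)%R.

(** The rate [4^-1] stays below the threshold [2^-1] at which the exponential moment of |z|^2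
    becomes infinite. *)
Lemma exp_bounded_integrable phi (C : R) : econtinuous phi ->
  (forall z, `|phi z| <= C * expR (4^-1 * enorm z ^+ 2)) ->
  gam.-integrable setT (EFin \o (phi : gspace R d -> R)).
Proof.
move=> cphi H; apply/integrableP; split.
  by apply/measurable_EFinP; exact: measurable_econtinuous.
have C0 : 0 <= C.
  by have := le_trans (normr_ge0 _) (H 0); rewrite pmulr_lge0// expR_gt0.
have me : measurable_fun setT (fun z : gspace R d => (expR (4^-1 * enorm z ^+ 2))%:E).
  apply/measurable_EFinP; apply: measurable_econtinuous.
  apply: econtinuous_comp; last exact: continuous_expR.
  apply: econtinuousM; first exact: econtinuous_cst.
  by apply: econtinuousX; exact: econtinuous_enorm.
apply: (@le_lt_trans _ _ (\int[gam]_z (C%:E * (expR (4^-1 * enorm z ^+ 2))%:E))%E).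
  apply: ge0_le_integral => //.
  - apply: measurableT_comp => //; apply/measurable_EFinP.
    exact: measurable_econtinuous.
  - by apply: emeasurable_funM => //; exact: measurable_cst.
  - by move=> z _; rewrite -EFinM lee_fin; exact: H.
rewrite ge0_integralZl//.
have a2 : 4^-1 < 2^-1 :> R by lra.
by rewrite (gaussian_exp_sq gam gamP _ a2) -EFinM ltry.
Qed.

Lemma tame_exp_bounded phi (a : R) : 0 < a -> pgrowth phi -> exists2 C : R, 0 <= C &
  forall z, `|phi z| <= C * expR (a * enorm z ^+ 2).
Proof.
move=> a0 [C [N [C0 H]]]; have [D D0 HD] := poly_le_exp_sq a N a0.
exists (C * D); first exact: mulr_ge0.
by move=> z; rewrite (le_trans (H z))// -mulrA ler_wpM2l// HD.
Qed.

Lemma tame_integrable phi : tame phi ->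
  gam.-integrable setT (EFin \o (phi : gspace R d -> R)).
Proof.
have a0 : 0 < 4^-1 :> R by lra.
move=> [cp /(tame_exp_bounded _ _ a0) [C _ H]]; exact: exp_bounded_integrable H.
Qed.

Lemma EgE phi : tame phi -> ((Eg phi)%:E = \int[gam]_z (phi z)%:E)%E.
Proof.
move=> tp; rewrite /Rintegral fineK//.
by apply: integrable_fin_num => //; exact: tame_integrable.
Qed.

Lemma Eg_cst (c : R) : Eg (fun=> c) = c.
Proof. by rewrite Rintegral_cst// -[X in fine X]/(gam setT) probability_setT mulr1. Qed.

Lemma EgD phi psi : tame phi -> tame psi ->
  Eg (fun z => phi z + psi z) = Eg phi + Eg psi.
Proof. by move=> tp tq; apply: RintegralD => //; exact: tame_integrable. Qed.

Lemma EgZ (a : R) phi : tame phi -> Eg (fun z => a * phi z) = a * Eg phi.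
Proof. by move=> tp; apply: RintegralZl => //; exact: tame_integrable. Qed.

Lemma EgB phi psi : tame phi -> tame psi ->
  Eg (fun z => phi z - psi z) = Eg phi - Eg psi.
Proof. by move=> tp tq; apply: RintegralB => //; exact: tame_integrable. Qed.

Lemma Eg_le phi psi : tame phi -> tame psi -> (forall z, phi z <= psi z) ->
  Eg phi <= Eg psi.
Proof.
by move=> tp tq H; apply: le_Rintegral => //; exact: tame_integrable.
Qed.

Lemma Eg_ge0 phi : (forall z, 0 <= phi z) -> 0 <= Eg phi.
Proof. by move=> H; apply: Rintegral_ge0. Qed.

Lemma Eg_abs_le phi psi : tame phi -> tame psi -> (forall z, `|phi z| <= psi z) ->
  `|Eg phi| <= Eg psi.
Proof.
move=> tp tq H; rewrite ler_norml; apply/andP; split.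
  rewrite lerNl -mulN1r -EgZ//; apply: Eg_le => // [|z]; first exact: tameZ.
  by rewrite mulN1r (le_trans _ (H z))// -normrN ler_norm.
by apply: Eg_le => // z; rewrite (le_trans _ (H z))// ler_norm.
Qed.

Lemma Eg_sum (I : Type) (s : seq I) (F : I -> 'rV[R]_d -> R) :
  (forall i, tame (F i)) ->
  Eg (fun z => \sum_(i <- s) F i z) = \sum_(i <- s) Eg (F i).
Proof.
move=> tF; elim: s => [|i s IHs].
  by under eq_Rintegral do rewrite big_nil; rewrite big_nil Eg_cst.
under eq_Rintegral do rewrite big_cons.
by rewrite big_cons EgD ?IHs//; exact: tame_sum.
Qed.

End GaussianExpectation.

(** * Gaussian moments and differentiation by shifting *)

Section GaussianMoments.
Context {R : realType} {d : nat}.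
Variable gam : probability (gspace R d) R.
Hypothesis gamP : std_gaussian_law gam.
Hypothesis hd : (0 < d)%N.

Local Notation Eg phi := (\int[gam]_z phi z)%R.
Local Notation "a `^ b" := (powR a b).

(* Chernoff-type bound: compare [t ^ p] with [exp (a t ^ 2)] at the optimal [a = p / (2 (p + d))]. *)
Lemma Eg_moment (p : nat) :
  Eg (fun z => enorm z ^+ p) <= (p%:R + d%:R) `^ (p%:R / 2).
Proof.
have d0 : 0 < d%:R :> R by rewrite ltr0n.
have p0 : 0 <= p%:R :> R by [].
set D : R := p%:R + d%:R; have D0 : 0 < D by rewrite ltr_wpDl.
pose a : R := p%:R / (2 * D).
have aE : 1 - 2 * a = d%:R / D by rewrite /a /D; field; rewrite gt_eqF.
have a2 : a < 2^-1.
  have : 0 < d%:R / D by rewrite divr_gt0.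
  lra.
pose W : R := D `^ (p%:R / 2) * expR (- (p%:R / 2)).
have W0 : 0 <= W by rewrite mulr_ge0 ?powR_ge0 ?expR_ge0.
have pt (z : 'rV[R]_d) : enorm z ^+ p <= W * expR (a * enorm z ^+ 2).
  set t := enorm z.
  have We0 : 0 <= W * expR (a * t ^+ 2) by rewrite mulr_ge0 ?expR_ge0.
  rewrite -ler_sqr ?nnegrE ?exprn_ge0 ?enorm_ge0//.
  (* This is 1 + x <= e^x at x = t^2 / D - 1, tight at t^2 = D; its p-th power is the square of the
     claim. *)
  have h : t ^+ 2 <= D * expR (t ^+ 2 / D - 1).
    rewrite -ler_pdivrMl// mulrC; have := expR_ge1Dx (t ^+ 2 / D - 1); lra.
  rewrite -exprM mulnC exprM (le_trans (lerXn2r p _ _ h)) ?nnegrE ?sqr_ge0//.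
    by rewrite mulr_ge0 ?expR_ge0 ?ltW.
  have DD : (D `^ (p%:R / 2)) ^+ 2 = D ^+ p.
    rewrite -(powR_mulrn 2) ?powR_ge0// -powRrM divfK ?pnatr_eq0//.
    by rewrite powR_mulrn// ltW.
  rewrite !exprMn -expRM_natl DD -mulrA; apply: ler_wpM2l.
    by rewrite exprn_ge0// ltW.
  rewrite -!expRM_natl -expRD ler_expR /a.
  by rewrite le_eqVlt; apply/orP; left; apply/eqP; field; rewrite gt_eqF.
(* Here 1 - 2a = d / (p + d), so the left side is (1 + p/d)^(d/2). The bound cancels the factor
   e^(-p/2) of [W]. *)
have sq : (Num.sqrt (1 - 2 * a))^-1 ^+ d <= expR (p%:R / 2).
  have -> : p%:R / 2 = d%:R * (p%:R / (2 * d%:R)) :> R by field; rewrite gt_eqF.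
  rewrite expRM_natl lerXn2r ?nnegrE ?expR_ge0 ?invr_ge0 ?sqrtr_ge0//.
  have dD0 : 0 <= d%:R / D by rewrite divr_ge0 ?(ltW D0).
  rewrite aE -(sqrtrV dD0) invf_div.
  rewrite -[leRHS]ger0_norm ?expR_ge0// -sqrtr_sqr ler_wsqrtr// -expRM_natl.
  have -> : 2 * (p%:R / (2 * d%:R)) = p%:R / d%:R :> R by field; rewrite gt_eqF.
  rewrite (le_trans _ (expR_ge1Dx _))// /D mulrDl divff ?gt_eqF//; lra.
rewrite -lee_fin EgE//; last by apply: tameX; exact: tame_enorm.
have me : measurable_fun setT (fun z : gspace R d => (expR (a * enorm z ^+ 2))%:E).
  apply/measurable_EFinP; apply: measurable_econtinuous.
  apply: econtinuous_comp; last exact: continuous_expR.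
  apply: econtinuousM; first exact: econtinuous_cst.
  by apply: econtinuousX; exact: econtinuous_enorm.
apply: (@le_trans _ _ (\int[gam]_z (W%:E * (expR (a * enorm z ^+ 2))%:E))%E).
  apply: ge0_le_integral => //.
  - by move=> z _; rewrite lee_fin exprn_ge0// enorm_ge0.
  - apply/measurable_EFinP; apply: measurable_econtinuous.
    by apply: econtinuousX; exact: econtinuous_enorm.
  - by apply: emeasurable_funM => //; exact: measurable_cst.
  - by move=> z _; rewrite -EFinM lee_fin; exact: pt.
rewrite ge0_integralZl// (gaussian_exp_sq gam gamP _ a2) -EFinM lee_fin.
rewrite (le_trans (ler_wpM2l W0 sq))// /W -mulrA -expRD addNr expR0 mulr1//.
Qed.

(** The general moment bound would give 2 + d. The sharp value comes from 1 + a E|z|^2 <= E exp(a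
    |z|^2) = (1 - 2a)^(-d/2) as a tends to 0. *)
Lemma Eg_enorm_sq : Eg (fun z => enorm z ^+ 2) <= d%:R.
Proof.
have tE : tame (fun z : 'rV[R]_d => enorm z ^+ 2) by apply: tameX; exact: tame_enorm.
pose M : R := Eg (fun z => enorm z ^+ 2); change (M <= d%:R).
have M0 : 0 <= M by apply: Eg_ge0 => z; rewrite sqr_ge0.
have key (a : R) : 0 < a -> a * (2 + d%:R) < 1 -> M * (1 - a * (2 + d%:R)) <= d%:R.
  move=> a0 a1; have a2 : a < 2^-1.
    have : 0 <= a * d%:R by rewrite mulr_ge0 ?(ltW a0).
    lra.
  have b0 : 0 < 1 - 2 * a by lra.
  pose y : R := a * d%:R / (1 - 2 * a).
  have y1 : y < 1 by rewrite ltr_pdivrMr//; lra.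
  have h1 : 1 + a * M <= expR y.
    rewrite -lee_fin.
    apply: (@le_trans _ _ (\int[gam]_z (expR (a * enorm z ^+ 2))%:E)%E).
      have -> : 1 + a * M = Eg (fun z => 1 + a * enorm z ^+ 2).
        by rewrite EgD ?Eg_cst ?EgZ//; [exact: tame_cst|exact: tameZ].
      rewrite EgE//; last by apply: tameD; [exact: tame_cst|exact: tameZ].
      apply: ge0_le_integral => //.
      - by move=> z _; rewrite lee_fin addr_ge0// mulr_ge0 ?sqr_ge0 ?ltW.
      - apply/measurable_EFinP; apply: measurable_econtinuous.
        by apply: econtinuousD; [exact: econtinuous_cst|exact: (tameZ a _ tE).1].
      - apply/measurable_EFinP; apply: measurable_econtinuous.
        apply: econtinuous_comp; last exact: continuous_expR.
        exact: (tameZ a _ tE).1.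
      - by move=> z _; rewrite lee_fin expR_ge1Dx.
    rewrite (gaussian_exp_sq gam gamP _ a2) lee_fin.
    have -> : y = d%:R * (a / (1 - 2 * a)) by rewrite /y; field; rewrite gt_eqF.
    rewrite expRM_natl lerXn2r ?nnegrE ?expR_ge0 ?invr_ge0 ?sqrtr_ge0//.
    rewrite -(sqrtrV (ltW b0)).
    rewrite -[leRHS]ger0_norm ?expR_ge0// -sqrtr_sqr ler_wsqrtr// -expRM_natl.
    rewrite (le_trans _ (expR_ge1Dx _))//.
    by rewrite le_eqVlt; apply/orP; left; apply/eqP; field; rewrite gt_eqF.
  have h2 : expR y * (1 - y) <= 1.
    have := expR_ge1Dx (- y); rewrite expRN -(ler_pM2l (expR_gt0 y)) divff ?gt_eqF ?expR_gt0//.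
  have h3 : (1 + a * M) * (1 - y) <= 1.
    by rewrite (le_trans _ h2)// ler_wpM2r// subr_ge0 ltW.
  have h4 : (1 + a * M) * (1 - y) * (1 - 2 * a) <= 1 - 2 * a.
    by rewrite -[leRHS]mul1r ler_wpM2r ?(ltW b0).
  have yE : y * (1 - 2 * a) = a * d%:R by rewrite /y divfK ?gt_eqF.
  have h5 : (1 + a * M) * (1 - 2 * a - a * d%:R) <= 1 - 2 * a.
    by move: h4; rewrite -mulrA mulrBl mul1r yE.
  rewrite -(ler_pM2l a0); move: h5; rewrite !mulrBr !mulrDl; lra.
apply/ler_addgt0Pr => e e0.
have q0 : 0 < 2 + d%:R :> R by rewrite ltr_wpDr.
(* Small enough for [key] to apply and for its error term a M (2 + d) to be at most [e]. *)
pose a := Num.min (2^-1 / (2 + d%:R)) (e / ((M + 1) * (2 + d%:R))).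
have M1 : 0 < M + 1 by rewrite ltr_wpDl.
have a0 : 0 < a by rewrite lt_min !divr_gt0// mulr_gt0.
have a1 : a * (2 + d%:R) <= 2^-1 by rewrite -ler_pdivlMr// ge_min lexx.
have a3 : a * ((M + 1) * (2 + d%:R)) <= e.
  by rewrite -ler_pdivlMr ?mulr_gt0// ge_min lexx orbT.
have a4 : a * (2 + d%:R) < 1 by lra.
have := key a a0 a4.
have : 0 <= a * (2 + d%:R) by rewrite mulr_ge0 ?ltW.
rewrite mulrBr mulr1; lra.
Qed.

(** Jensen is replaced by the tangent inequality |z| <= |z|^2 / (2 s) + s / 2 at s = sqrt d. *)
Lemma Eg_enorm : Eg (fun z => enorm z) <= Num.sqrt d%:R.
Proof.
have s0 : 0 < Num.sqrt d%:R :> R by rewrite sqrtr_gt0 ltr0n.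
have tE : tame (fun z : 'rV[R]_d => enorm z ^+ 2) by apply: tameX; exact: tame_enorm.
set s := Num.sqrt _ in s0 *.
have ss : s ^+ 2 = d%:R by rewrite sqr_sqrtr.
apply: (@le_trans _ _ (Eg (fun z => s^-1 / 2 * enorm z ^+ 2 + s / 2))).
  apply: Eg_le => // [||z]; first exact: tame_enorm.
    by apply: tameD; [exact: tameZ|exact: tame_cst].
  rewrite -(ler_pM2l s0).
  have -> : s * (s^-1 / 2 * enorm z ^+ 2 + s / 2) = enorm z ^+ 2 / 2 + s ^+ 2 / 2.
    by field; rewrite gt_eqF.
  have := sqr_ge0 (enorm z - s); rewrite !expr2; lra.
rewrite EgD//; [|exact: tameZ|exact: tame_cst].
rewrite EgZ// Eg_cst.
have : s^-1 / 2 * Eg (fun z => enorm z ^+ 2) <= s^-1 / 2 * s ^+ 2.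
  by rewrite ler_wpM2l ?divr_ge0 ?invr_ge0 ?(ltW s0)// ss Eg_enorm_sq.
have -> : s^-1 / 2 * s ^+ 2 = s / 2 by field; rewrite gt_eqF.
lra.
Qed.

Lemma Eg_shift (h : 'rV[R]_d) (phi : 'rV[R]_d -> R) : econtinuous phi ->
  (forall z, 0 <= phi z) ->
  Eg (fun z => phi (z + h)) =
  Eg (fun z => phi z * expR (dotv h z - enorm h ^+ 2 / 2)).
Proof.
move=> cphi phi0; rewrite /Rintegral; congr fine.
rewrite (gaussian_shift gam gamP h (fun z => (phi z)%:E)) //.
  by apply/measurable_EFinP; exact: measurable_econtinuous.
Qed.

(** The translation is moved from [phi] to the Gaussian density, which is smooth in [t]; hence the
    mean is differentiable without any differentiability of [phi]. *)
Lemma Eg_shift_diff (w : 'rV[R]_d) (phi : 'rV[R]_d -> R) : tame phi ->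
  (forall z, 0 <= phi z) -> exists C : R, forall t : R, `|t| <= 1 ->
  `|Eg (fun z => phi (z + t *: w)) - Eg phi - t * Eg (fun z => phi z * dotv w z)|
    <= C * t ^+ 2.
Proof.
move=> tphi phi0.
pose q (z : 'rV[R]_d) := enorm w * enorm z + enorm w ^+ 2.
have q0 z : 0 <= q z by rewrite addr_ge0 ?mulr_ge0 ?sqr_ge0 ?enorm_ge0.
have tq : tame q.
  by apply: tameD; [apply: tameZ; exact: tame_enorm|exact: tame_cst].
pose Theta z := phi z * ((2 * q z) ^+ 2 * expR (2 * q z) + q z).
have cTheta : econtinuous Theta.
  apply: econtinuousM; first exact: tphi.1.
  apply: econtinuousD; last exact: tq.1.
  apply: econtinuousM; first by apply: (tameX _ 2 (tameZ 2 _ tq)).1.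
  by apply: econtinuous_comp; [exact: (tameZ 2 _ tq).1|exact: continuous_expR].
(* Polynomial factors get the rate [8^-1], which leaves |z|^2 / 8 to absorb the factor exp(2 q). *)
have a0 : 0 < 8^-1 :> R by [].
have [C1 C10 H1] := tame_exp_bounded _ _ a0 (tameM _ _ tphi (tameX _ 2 (tameZ 2 _ tq))).2.
have [C2 C20 H2] := tame_exp_bounded _ _ a0 (tameM _ _ tphi tq).2.
have [C3 C30 H3] := tame_exp_bounded _ _ a0
  (tameM _ _ tphi (tameD _ _ (tame_cst 1) tq)).2.
have e84 (z : 'rV[R]_d) : expR (8^-1 * enorm z ^+ 2) <= expR (4^-1 * enorm z ^+ 2).
  by rewrite ler_expR ler_wpM2r ?sqr_ge0//; lra.
(* 10 = 2 + 8: the exponent 2 q contributes 2 |w|^2, and 2 |w||z| <= |z|^2 / 8 + 8 |w|^2. *)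
pose CT := C1 * expR (10 * enorm w ^+ 2) + C2.
have HTheta z : `|Theta z| <= CT * expR (4^-1 * enorm z ^+ 2).
  have -> : Theta z = phi z * (2 * q z) ^+ 2 * expR (2 * q z) + phi z * q z.
    by rewrite /Theta mulrDr mulrA.
  rewrite (le_trans (ler_normD _ _))// /CT [leRHS]mulrDl lerD//; last first.
    by rewrite (le_trans (H2 z))// ler_wpM2l.
  rewrite normrM (ger0_norm (expR_ge0 _)).
  rewrite (le_trans (ler_wpM2r (expR_ge0 _) (H1 z)))// -!mulrA ler_wpM2l//.
  rewrite -!expRD ler_expR /q.
  have := sqr_ge0 (enorm z - 8 * enorm w); rewrite !expr2; lra.
have iTheta := exp_bounded_integrable gam gamP _ _ cTheta HTheta.
have w2q z : enorm w ^+ 2 / 2 <= q z.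
  have : 0 <= enorm w * enorm z by rewrite mulr_ge0 ?enorm_ge0.
  by rewrite /q; have := sqr_ge0 (enorm w); lra.
have pq z : `|dotv w z| <= q z.
  by rewrite (le_trans (dotv_cauchy_abs _ _))// lerDl sqr_ge0.
exists (Eg Theta) => t t1.
pose A z := phi z * expR (dotv (t *: w) z - enorm (t *: w) ^+ 2 / 2).
have err z : `|A z - phi z - t * (phi z * dotv w z)| <= t ^+ 2 * Theta z.
  have -> : A z - phi z - t * (phi z * dotv w z) =
      phi z * (expR (t * dotv w z - t ^+ 2 * (enorm w ^+ 2 / 2)) - 1 - t * dotv w z).
    rewrite /A dotvZl enormZ exprMn real_normK ?num_real// !mulrA; ring.
  rewrite normrM (ger0_norm (phi0 z)) /Theta [leRHS]mulrCA ler_wpM2l//.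
  apply: exp_tilt_error => //; rewrite ?divr_ge0 ?sqr_ge0//.
have cA : econtinuous A.
  apply: econtinuousM; first exact: tphi.1.
  apply: econtinuous_comp; last exact: continuous_expR.
  by apply: econtinuousB; [exact: econtinuous_dotv|exact: econtinuous_cst].
have t21 : t ^+ 2 <= 1 by rewrite -(real_normK (num_real t)) exprn_ile1.
have iA : gam.-integrable setT (EFin \o (A : gspace R d -> R)).
  apply: (exp_bounded_integrable gam gamP _ (CT + C3) cA) => z.
  have -> : A z = (A z - phi z - t * (phi z * dotv w z)) + phi z * (1 + t * dotv w z) by ring.
  rewrite (le_trans (ler_normD _ _))// [leRHS]mulrDl lerD//.
    rewrite (le_trans (err z))// (le_trans _ (HTheta z))// ger0_norm.
      rewrite ler_piMl// /Theta mulr_ge0// addr_ge0//.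
      by rewrite mulr_ge0 ?sqr_ge0 ?expR_ge0.
    by rewrite /Theta mulr_ge0// addr_ge0// mulr_ge0 ?sqr_ge0 ?expR_ge0.
  apply: (@le_trans _ _ (`|phi z * (1 + q z)|)).
    rewrite !normrM ler_wpM2l// (le_trans (ler_normD _ _))// normr1.
    have q1 : 0 <= 1 + q z by rewrite addr_ge0.
    rewrite (ger0_norm q1) lerD2l normrM.
    by rewrite (le_trans _ (pq z))// ler_piMl.
  by rewrite (le_trans (H3 z))// ler_wpM2l.
have iphi := tame_integrable gam gamP _ tphi.
have tpw : tame (fun z => t * (phi z * dotv w z)).
  by apply: tameZ; apply: tameM => //; exact: tame_dotv.
have ipw := tame_integrable gam gamP _ tpw.
rewrite Eg_shift//; last exact: tphi.1.
rewrite -/(A _) -EgZ//; last by apply: tameM => //; exact: tame_dotv.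
have i3 : gam.-integrable setT (EFin \o (fun z : gspace R d => A z - phi z)).
  exact: (integrableB measurableT iA iphi).
have i4 : gam.-integrable setT
    (EFin \o (fun z : gspace R d => A z - phi z - t * (phi z * dotv w z))).
  exact: (integrableB measurableT i3 ipw).
rewrite -RintegralB// -RintegralB//.
apply: (le_trans (le_normr_Rintegral _ i4)) => //.
rewrite mulrC -RintegralZl//; apply: le_Rintegral => //.
- exact: integrable_norm.
- exact: (integrableZl measurableT (t ^+ 2) iTheta).
Qed.

(** Shifting a constant changes nothing, so the linear term t E<w, z> is O(t^2) and must vanish. *)
Lemma Eg_dotv (w : 'rV[R]_d) : Eg (dotv w) = 0.
Proof.
have [C HC] := Eg_shift_diff w (fun=> 1) (tame_cst 1) (fun=> ler01).
have {}HC (t : R) : 0 < t -> t <= 1 -> `|Eg (dotv w)| <= C * t.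
  move=> t0 t1; have := HC t; rewrite (ger0_norm (ltW t0)) => /(_ t1).
  rewrite !Eg_cst subrr sub0r normrN normrM gtr0_norm//.
  under eq_Rintegral do rewrite mul1r.
  by rewrite expr2 mulrCA ler_pM2l.
apply/normr0_eq0/eqP; rewrite eq_le normr_ge0 andbT.
apply/ler_addgt0Pr => e e0; rewrite add0r.
pose t := Num.min 1 (e / (`|C| + 1)).
have C0 : 0 < `|C| + 1 by rewrite ltr_wpDl.
have t0 : 0 < t by rewrite lt_min ltr01 divr_gt0.
have t1 : t <= 1 by rewrite ge_min lexx.
rewrite (le_trans (HC t t0 t1))//.
have : t * (`|C| + 1) <= e by rewrite -ler_pdivlMr// ge_min lexx orbT.
have : C * t <= `|C| * t by rewrite ler_pM2r// ler_norm.
lra.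
Qed.

End GaussianMoments.

(** * Gaussian smoothing *)

Lemma quad_is_derive {R : realType} (phi : R -> R) (x l C : R) :
  (forall t, `|t| <= 1 -> `|phi (x + t) - phi x - t * l| <= C * t ^+ 2) ->
  is_derive x 1 phi l.
Proof.
move=> H.
have cvgl : (h^-1 *: ((phi \o shift x) (h *: (1 : R)) - phi x) @[h --> 0^'] --> l)%classic.
  apply/cvgrPdist_lt => e e0.
  have C0 : 0 < `|C| + 1 by rewrite ltr_wpDl.
  near=> h.
  have h0 : h != 0 by near: h; exact: nbhs_dnbhs_neq.
  have h1 : `|h| <= 1.
    near: h; apply: (@dnbhs0_le _ R^o) => //.
  have h2 : `|h| < e / (`|C| + 1).
    near: h; apply: (@dnbhs0_lt _ R^o); by rewrite divr_gt0.
  have hp : 0 < `|h| by rewrite normr_gt0.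
  rewrite /= [h *: 1]mulr1 distrC -(ltr_pM2l hp) -normrM.
  have -> : h * (h^-1 *: (phi (h + x) - phi x) - l) = phi (x + h) - phi x - h * l.
    by rewrite mulrBr /GRing.scale/= mulVKf// (addrC h).
  rewrite (le_lt_trans (H h h1))// -(real_normK (num_real h)).
  rewrite ltr_pdivlMr// in h2.
  have : C * `|h| ^+ 2 <= `|C| * `|h| ^+ 2 by rewrite ler_wpM2r ?ler_norm ?sqr_ge0.
  have : `|h| * (`|h| * (`|C| + 1)) < `|h| * e by rewrite ltr_pM2l.
  have := sqr_ge0 `|h|; rewrite !expr2; lra.
split; first by apply/cvg_ex; exists l.
exact/cvg_lim.
Unshelve. all: by end_near.
Qed.

Section VectorFields.
Context {R : realType} {d : nat}.

Lemma econtinuous_lip_ball (f : 'rV[R]_d -> R) :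
  (forall r : R, exists L : R, forall x y, enorm x <= r -> enorm y <= r ->
     `|f x - f y| <= L * enorm (x - y)) -> econtinuous f.
Proof.
move=> H; apply: econtinuous_locally_lipschitz => x.
have [L HL] := H (enorm x + 1); exists 1; split => //; exists L => y z yx zx.
have en (w : 'rV[R]_d) : enorm (w - x) < 1 -> enorm w <= enorm x + 1.
  by move=> h; rewrite -[w](subrK x) (le_trans (enormD _ _))// addrC lerD2l ltW.
by apply: HL; exact: en.
Qed.

Lemma tame_vcomp (phi : 'rV[R]_d -> R) (X : 'rV[R]_d -> 'rV[R]_d) : tame phi ->
  (forall i, tame (fun z => X z 0 i)) -> tame (fun z => phi (X z)).
Proof.
move=> [cphi [C [N [C0 HC]]]] tX.
pose S z := \sum_(i < d) `|X z 0 i|.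
have tS : tame S.
  apply: tame_sum => i; split.
    by apply: econtinuous_comp; [exact: (tX i).1|exact: norm_continuous].
  have [_ [D [M [D0 HD]]]] := tX i; exists D, M; split => // z; by rewrite normr_id.
have cX : econtinuous (fun z => phi (X z)).
  by apply: econtinuous_vcomp => // i; exact: (tX i).1.
have tP : tame (fun z => C * (1 + S z) ^+ N).
  by apply: tameZ; apply: tameX; apply: tameD => //; exact: tame_cst.
apply: (tame_le _ _ cX tP) => z; rewrite (le_trans (HC _))// ler_wpM2l//.
by rewrite lerXn2r ?nnegrE ?addr_ge0 ?sumr_ge0// lerD2l enorm_le_sum.
Qed.

End VectorFields.

Section Smoothing.
Context {R : realType} {d : nat}.
Variable gam : probability (gspace R d) R.
Hypothesis gamP : std_gaussian_law gam.
Hypothesis hd : (0 < d)%N.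
Variables (f : 'rV[R]_d -> R) (R1 R2 s c1 : R) (m : nat).
Hypotheses (R10 : 0 <= R1) (R20 : 0 <= R2) (s0 : 0 < s) (s1 : s <= 1) (c10 : 0 <= c1).
Hypothesis f0 : forall x, 0 <= f x.
Hypothesis flip : forall y z (r : R), enorm y <= r -> enorm z <= r ->
  `|f y - f z| <= (R1 * r ^+ m + R2) * enorm (y - z).
(* [c1] stands for [2 ^ (m - 1)]; the factor [R1] covers [m = 0], where [R1 = 0]. *)
Hypothesis hc1 : forall a b : R, 0 <= a -> 0 <= b ->
  R1 * (a + b) ^+ m <= R1 * c1 * (a ^+ m + b ^+ m).

Local Notation Eg phi := (\int[gam]_z phi z)%R.
Local Notation "a `^ b" := (powR a b).
Local Notation L r := (R1 * r ^+ m + R2).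
Implicit Types (x y z v h : 'rV[R]_d).

Let M1 : R := (m%:R + 1 + d%:R) `^ ((m%:R + 1) / 2).
Let sd : R := Num.sqrt d%:R.

Lemma L_ge0 (r : R) : 0 <= r -> 0 <= L r.
Proof. by move=> r0; rewrite addr_ge0// mulr_ge0// exprn_ge0. Qed.

Lemma f_incr x y : `|f (x + y) - f x| <= L (enorm x + enorm y) * enorm y.
Proof.
have := flip (x + y) x (enorm x + enorm y) (enormD _ _).
by rewrite lerDl enorm_ge0 addrAC subrr add0r => /(_ isT).
Qed.

Lemma f_econtinuous : econtinuous f.
Proof.
by apply: econtinuous_lip_ball => r; exists (L r) => x y xr yr; exact: flip.
Qed.

Lemma tame_L (a b : R) : tame (fun z : 'rV[R]_d => L (a + b * enorm z)).
Proof.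
apply: tameD; last exact: tame_cst.
by apply: tameZ; apply: tameX; apply: tameD;
  [exact: tame_cst|apply: tameZ; exact: tame_enorm].
Qed.

Lemma tame_f x : tame (fun z => f (x + s *: z)).
Proof.
have tb : tame (fun z => f x + L (enorm x + s * enorm z) * (s * enorm z)).
  apply: tameD; first exact: tame_cst.
  by apply: tameM; [exact: tame_L|apply: tameZ; exact: tame_enorm].
apply: (tame_le _ _ _ tb); first by apply: econtinuous_shift; exact: f_econtinuous.
move=> z; have := f_incr x (s *: z); rewrite enormZ (gtr0_norm s0) => h.
rewrite -[X in `|X|](subrK (f x)) addrC (le_trans (ler_normD _ _))//.
by rewrite lerD// ger0_norm.
Qed.

Definition smooth x : R := Eg (fun z => f (x + s *: z)).

(** Coordinatewise mean of the zeroth-order direction; [smooth_diff] identifies it as the gradient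
    of [smooth]. *)
Definition smooth_grad x : 'rV[R]_d :=
  \row_i Eg (fun z => s^-1 * (f (x + s *: z) - f x) * z 0 i).

Definition zo_dir x z : 'rV[R]_d := (s^-1 * (f (x + s *: z) - f x)) *: z.

Lemma tame_quot x : tame (fun z => s^-1 * (f (x + s *: z) - f x)).
Proof. by apply: tameZ; apply: tameB; [exact: tame_f|exact: tame_cst]. Qed.

Lemma tame_zo_dir x i : tame (fun z => zo_dir x z 0 i).
Proof.
under eq_fun do rewrite mxE.
by apply: tameM; [exact: tame_quot|exact: tame_coord].
Qed.

Lemma Eg_zo_dir x v : Eg (fun z => dotv v (zo_dir x z)) = dotv v (smooth_grad x).
Proof.
rewrite /dotv Eg_sum//; last by move=> i; apply: tameZ; exact: tame_zo_dir.
apply: eq_bigr => i _; rewrite EgZ//; last exact: tame_zo_dir.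
by rewrite mxE; congr (_ * _); apply: eq_Rintegral => z _; rewrite mxE.
Qed.

(** Stein form of the gradient: subtracting [f x] does not change the mean because the Gaussian is
    centred. *)
Lemma dotv_smooth_grad x v :
  dotv v (smooth_grad x) = s^-1 * Eg (fun z => f (x + s *: z) * dotv v z).
Proof.
have tv := tame_dotv (d := d) (R := R) v.
rewrite -Eg_zo_dir.
have -> : Eg (fun z => dotv v (zo_dir x z)) =
    Eg (fun z => s^-1 * (f (x + s *: z) * dotv v z) - s^-1 * f x * dotv v z).
  by apply: eq_Rintegral => z _; rewrite /zo_dir dotvZr; ring.
have t1 : tame (fun z => f (x + s *: z) * dotv v z) by apply: tameM => //; exact: tame_f.
rewrite EgB//; [|exact: tameZ|exact: tameZ].
by rewrite !EgZ// (Eg_dotv gam gamP) mulr0 subr0.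
Qed.

(** Moving x by t v amounts to shifting the Gaussian variable by t v / s, which is where the factor
    [s^-1] of the gradient comes from. *)
Lemma smooth_diff x v : exists C : R, forall t : R, `|t| <= 1 ->
  `|smooth (x + t *: v) - smooth x - t * dotv v (smooth_grad x)| <= C * t ^+ 2.
Proof.
have [C HC] := Eg_shift_diff gam gamP (s^-1 *: v) _ (tame_f x) (fun z => f0 _).
exists C => t /HC.
have -> : Eg (fun z => f (x + s *: (z + t *: (s^-1 *: v)))) = smooth (x + t *: v).
  apply: eq_Rintegral => z _; congr f; rewrite scalerDr !scalerA mulrAC divff ?gt_eqF//.
  by rewrite mul1r addrA addrAC.
have -> : Eg (fun z => f (x + s *: z) * dotv (s^-1 *: v) z) = dotv v (smooth_grad x).
  rewrite dotv_smooth_grad -EgZ//.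
    by apply: eq_Rintegral => z _; rewrite dotvZl mulrCA.
  by apply: tameM; [exact: tame_f|exact: tame_dotv].
by [].
Qed.

Lemma smooth_is_derive x v (t : R) :
  is_derive t 1 (fun u : R => smooth (x + u *: v)) (dotv v (smooth_grad (x + t *: v))).
Proof.
have [C HC] := smooth_diff (x + t *: v) v.
apply: (quad_is_derive _ _ _ C) => u /HC.
by have -> : x + t *: v + u *: v = x + (t + u) *: v by rewrite scalerDl addrA.
Qed.

(** In the Stein form the difference falls on [f] alone, so the Lipschitz property of [f] suffices,
    at the price of [s^-1]. *)
Lemma smooth_grad_lip x y v (r : R) : enorm x <= r -> enorm y <= r ->
  `|dotv v (smooth_grad y) - dotv v (smooth_grad x)| <=
  s^-1 * enorm (y - x) * enorm v * Eg (fun z => L (r + s * enorm z) * enorm z).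
Proof.
move=> xr yr; have r0 : 0 <= r by rewrite (le_trans _ xr).
have tv := tame_dotv (d := d) (R := R) v.
have tLz : tame (fun z : 'rV[R]_d => L (r + s * enorm z) * enorm z).
  by apply: tameM; [exact: tame_L|exact: tame_enorm].
have tf z' : tame (fun z => f (z' + s *: z) * dotv v z).
  by apply: tameM => //; exact: tame_f.
rewrite !dotv_smooth_grad -mulrBr -EgB// normrM gtr0_norm ?invr_gt0// -!mulrA.
rewrite ler_wpM2l ?invr_ge0 ?(ltW s0)// !mulrA -EgZ//.
apply: Eg_abs_le => //; [exact: tameB|exact: tameZ|].
move=> z; rewrite -mulrBl normrM.
have -> : enorm (y - x) * enorm v * (L (r + s * enorm z) * enorm z) =
    (L (r + s * enorm z) * enorm (y - x)) * (enorm v * enorm z) by ring.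
apply: ler_pM => //; last exact: dotv_cauchy_abs.
have en w : enorm w <= r -> enorm (w + s *: z) <= r + s * enorm z.
  by move=> wr; rewrite (le_trans (enormD _ _))// enormZ (gtr0_norm s0) lerD2r.
have := flip _ _ _ (en _ yr) (en _ xr).
by rewrite opprD addrACA subrr addr0.
Qed.

Lemma smooth_lip x y (r : R) : enorm x <= r -> enorm y <= r ->
  `|smooth x - smooth y| <= Eg (fun z => L (r + s * enorm z)) * enorm (x - y).
Proof.
move=> xr yr; have tLz := tame_L r s.
rewrite /smooth -EgB//; [|exact: tame_f|exact: tame_f].
rewrite mulrC -EgZ//; apply: Eg_abs_le => //; [|exact: tameZ|].
  by apply: tameB; exact: tame_f.
move=> z; have en w : enorm w <= r -> enorm (w + s *: z) <= r + s * enorm z.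
  by move=> wr; rewrite (le_trans (enormD _ _))// enormZ (gtr0_norm s0) lerD2r.
have := flip _ _ _ (en _ xr) (en _ yr).
by rewrite opprD addrACA subrr addr0 mulrC.
Qed.

Lemma smooth_ge0 x : 0 <= smooth x.
Proof. by apply: Eg_ge0 => z; exact: f0. Qed.

Lemma smooth_econtinuous : econtinuous smooth.
Proof.
apply: econtinuous_lip_ball => r; exists (Eg (fun z => L (r + s * enorm z))) => x y xr yr.
exact: smooth_lip.
Qed.

Lemma smooth_grad_econtinuous i : econtinuous (fun x => smooth_grad x 0 i).
Proof.
apply: econtinuous_lip_ball => r.
exists (s^-1 * Eg (fun z => L (r + s * enorm z) * enorm z)) => x y xr yr.
have := smooth_grad_lip y x (delta_mx 0 i) r yr xr.
rewrite !(dotvC (delta_mx 0 i)) !dotv_delta enorm_delta mulr1 => h.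
by rewrite (le_trans h)// mulrAC.
Qed.

Lemma tame_smooth : tame smooth.
Proof.
split; first exact: smooth_econtinuous.
have tm : tame (fun z : 'rV[R]_d => enorm z ^+ m) by apply: tameX; exact: tame_enorm.
pose K0 := R1 * c1 * Eg (fun z => enorm z ^+ m) + R2.
have tb : tame (fun z : 'rV[R]_d => smooth 0 + (R1 * c1 * enorm z ^+ m + K0) * enorm z).
  apply: tameD; first exact: tame_cst.
  apply: tameM; last exact: tame_enorm.
  by apply: tameD; [exact: tameZ|exact: tame_cst].
have [_ [C [N [C0 HC]]]] := tb; exists C, N; split => // z.
apply: le_trans (HC z); apply: le_trans (ler_norm _).
rewrite -[smooth z](subrK (smooth 0)) addrC (le_trans (ler_normD _ _))//.
rewrite lerD//; first by rewrite ger0_norm// smooth_ge0.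
have z0 : enorm (0 : 'rV[R]_d) <= enorm z by rewrite enorm0.
rewrite (le_trans (smooth_lip _ _ _ (lexx _) z0))// subr0 ler_wpM2r//.
have tmz : tame (fun u : 'rV[R]_d => R1 * c1 * enorm u ^+ m) by exact: tameZ.
apply: (@le_trans _ _ (Eg (fun u => R1 * c1 * enorm u ^+ m + (R1 * c1 * enorm z ^+ m + R2)))).
  apply: Eg_le => //; first exact: tame_L.
    by apply: tameD => //; exact: tame_cst.
  move=> u; rewrite addrA lerD2r addrC -mulrDr (le_trans (hc1 _ _ _ _))//.
    by rewrite mulr_ge0// ltW.
  rewrite ler_wpM2l ?mulr_ge0// lerD2l lerXn2r ?nnegrE//.
    by rewrite mulr_ge0// ltW.
  by rewrite ler_piMl.
rewrite EgD// ?Eg_cst ?EgZ//; [|exact: tame_cst].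
by rewrite /K0; lra.
Qed.

(** Used with a = |x| and b the length travelled from x. Splitting off [b] first charges it a single
    factor [c1], while |x| and the noise pay [c1 ^+ 2]. *)
Lemma Eg_L_enorm (a b : R) : 0 <= a -> 0 <= b ->
  Eg (fun z => L (a + b + s * enorm z) * enorm z) <=
  R1 * c1 * b ^+ m * sd + c1 ^+ 2 * R1 * a ^+ m * sd + c1 ^+ 2 * R1 * M1 + R2 * sd.
Proof.
move=> a0 b0; have tn := @tame_enorm R d.
have tX n : tame (fun z : 'rV[R]_d => enorm z ^+ n) by exact: tameX.
pose k := R1 * c1 * b ^+ m + c1 ^+ 2 * R1 * a ^+ m + R2.
apply: (@le_trans _ _ (Eg (fun z => k * enorm z + c1 ^+ 2 * R1 * enorm z ^+ m.+1))).
  apply: Eg_le => // [||z].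
  - by apply: tameM => //; exact: tame_L.
  - by apply: tameD; apply: tameZ.
  have e0 : 0 <= enorm z by [].
  have se0 : 0 <= s * enorm z by rewrite mulr_ge0// ltW.
  have -> : k * enorm z + c1 ^+ 2 * R1 * enorm z ^+ m.+1 =
      (k + c1 ^+ 2 * R1 * enorm z ^+ m) * enorm z by rewrite (exprS (enorm z)); ring.
  rewrite ler_wpM2r//.
  have ase : 0 <= a + s * enorm z by rewrite addr_ge0.
  have -> : a + b + s * enorm z = b + (a + s * enorm z) by ring.
  have h1 := hc1 _ _ b0 ase.
  have h2 : R1 * c1 * (a + s * enorm z) ^+ m <= c1 * (R1 * c1 * (a ^+ m + enorm z ^+ m)).
    rewrite mulrAC mulrC ler_wpM2l// (le_trans (hc1 _ _ a0 se0))// ler_wpM2l ?mulr_ge0//.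
    by rewrite lerD2l lerXn2r ?nnegrE// ler_piMl.
  rewrite /k; move: h1 h2; rewrite expr2; lra.
rewrite EgD//; [|exact: tameZ|exact: tameZ].
rewrite !EgZ//.
have k0 : 0 <= k by rewrite !addr_ge0 ?mulr_ge0 ?exprn_ge0.
have c20 : 0 <= c1 ^+ 2 * R1 by rewrite mulr_ge0// sqr_ge0.
have e1 := ler_wpM2l k0 (Eg_enorm gam gamP hd).
have e2 := ler_wpM2l c20 (Eg_moment gam gamP hd m.+1).
rewrite -natr1 in e2; rewrite -/M1 -/sd in e1 e2.
move: e1 e2; rewrite /k; lra.
Qed.

Lemma smooth_descent x h :
  smooth (x + h) <= smooth x + dotv h (smooth_grad x)
   + s^-1 * enorm h ^+ 2 * (2^-1 * (c1 ^+ 2 * R1 * M1 + R2 * sd)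
                            + c1 ^+ 2 / 2 * R1 * sd * enorm x ^+ m)
   + s^-1 * enorm h ^+ (m + 2) * (c1 * R1 * (m%:R + 2)^-1 * sd).
Proof.
pose A := s^-1 * enorm h ^+ 2 * (c1 ^+ 2 * R1 * M1 + R2 * sd + c1 ^+ 2 * R1 * sd * enorm x ^+ m).
pose B := s^-1 * enorm h ^+ (m + 2) * (c1 * R1 * sd).
have m2 : 0 < m%:R + 2 :> R by rewrite ltr_wpDl.
have gd (t : R) : 0 <= t -> t <= 1 ->
    dotv h (smooth_grad (x + t *: h)) - dotv h (smooth_grad x) <= A * t + B * t ^+ m.+1.
  move=> t0 t1; pose r := enorm x + t * enorm h.
  have r0 : 0 <= t * enorm h by rewrite mulr_ge0.
  have xr : enorm x <= r by rewrite lerDl.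
  have yr : enorm (x + t *: h) <= r.
    by rewrite (le_trans (enormD _ _))// enormZ ger0_norm.
  rewrite (le_trans (ler_norm _))// (le_trans (smooth_grad_lip x _ h r xr yr))//.
  rewrite addrAC subrr add0r enormZ (ger0_norm t0).
  have q0 : 0 <= s^-1 * (t * enorm h) * enorm h by rewrite !mulr_ge0// invr_ge0 ltW.
  apply: (le_trans (ler_wpM2l q0 (Eg_L_enorm _ _ (enorm_ge0 x) r0))).
  rewrite le_eqVlt; apply/orP; left; apply/eqP.
  by rewrite /A /B addn2 !exprS exprMn; ring.
(* The primitive of the bound A t + B t^(m+1) is subtracted, so the derivative is nonpositive and
   the mean value theorem replaces integration along the segment. *)
pose psi (t : R) := smooth (x + t *: h) - t * dotv h (smooth_grad x)
  - (A / 2 * t ^+ 2 + B / (m%:R + 2) * t ^+ m.+2).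
pose dpsi (t : R) := dotv h (smooth_grad (x + t *: h)) - dotv h (smooth_grad x)
  - (A * t + B * t ^+ m.+1).
have dP (t : R) : is_derive t 1 psi (dpsi t).
  have dX n : is_derive t (1 : R) (fun u : R => u ^+ n.+1) (n.+1%:R * t ^+ n).
    have := @is_deriveX R R^o id n.+1 t 1 1 (is_derive_id _ _).
    have -> : (id : R -> R) ^+ n.+1 = (fun u => u ^+ n.+1).
      by apply/funext => u; rewrite exprfctE.
    by rewrite /GRing.scale/= mulr1.
  have d1 := smooth_is_derive x h t.
  have d2 : is_derive t (1 : R) (fun u : R => u * dotv h (smooth_grad x)) (dotv h (smooth_grad x)).
    have := @is_deriveM _ R^o id (cst (dotv h (smooth_grad x))) t 1 1 0 (is_derive_id _ _) (is_derive_cst _ _ _).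
    by rewrite /GRing.scale/= mulr0 add0r mulr1.
  have d3 (c : R) n : is_derive t (1 : R) (fun u : R => c * u ^+ n.+1) (c * (n.+1%:R * t ^+ n)).
    have := @is_deriveZ _ _ _ _ c t 1 _ (dX n).
    by rewrite /GRing.scale/=.
  have d4 := is_deriveD (d3 (A / 2) 1%N) (d3 (B / (m%:R + 2)) m.+1).
  have d5 := is_deriveB (is_deriveB d1 d2) d4.
  apply: is_derive_eq d5 _.
  rewrite /dpsi; congr (_ - _); rewrite expr1; congr (_ + _); first by field.
  by rewrite -[m.+2]addn2 natrD; field; rewrite gt_eqF.
have [c] := @MVT R psi dpsi 0 1 ltr01 (fun t _ => dP t)
  (derivable_within_continuous (fun t _ => @ex_derive _ _ _ _ _ _ _ (dP t))).
rewrite in_itv/= => /andP[c0 cl] psiE.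
have dc : dpsi c <= 0 by rewrite /dpsi subr_le0; apply: gd; exact: ltW.
have : psi 1 - psi 0 <= 0 by rewrite psiE subr0 mulr1.
rewrite /psi scale1r scale0r addr0 !mul1r !mul0r !expr1n !expr0n/= !mulr0 !mulr1.
have -> : s^-1 * enorm h ^+ 2 * (2^-1 * (c1 ^+ 2 * R1 * M1 + R2 * sd)
    + c1 ^+ 2 / 2 * R1 * sd * enorm x ^+ m) = A / 2 by rewrite /A; field; rewrite gt_eqF.
have -> : s^-1 * enorm h ^+ (m + 2) * (c1 * R1 * (m%:R + 2)^-1 * sd) = B / (m%:R + 2).
  by rewrite /B; field; rewrite !gt_eqF.
lra.
Qed.

Lemma smooth_le x :
  smooth x <= f x + ((c1 * R1 * enorm x ^+ m + R2) * sd + c1 * R1 * M1).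
Proof.
have tn := @tame_enorm R d.
have tX n : tame (fun z : 'rV[R]_d => enorm z ^+ n) by exact: tameX.
pose k := c1 * R1 * enorm x ^+ m + R2.
have k0 : 0 <= k by rewrite addr_ge0// !mulr_ge0// exprn_ge0.
apply: (@le_trans _ _ (Eg (fun z => f x + (k * enorm z + c1 * R1 * enorm z ^+ m.+1)))).
  apply: Eg_le => // [||z].
  - exact: tame_f.
  - by apply: tameD; [exact: tame_cst|apply: tameD; apply: tameZ].
  have se0 : 0 <= s * enorm z by rewrite mulr_ge0// ltW.
  have sz : s * enorm z <= enorm z by rewrite ler_piMl.
  rewrite -lerBlDl (le_trans (ler_norm _))// (le_trans (f_incr _ _))//.
  rewrite enormZ (gtr0_norm s0) (le_trans (ler_wpM2l _ sz))//.
    by apply: L_ge0; rewrite addr_ge0.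
  have -> : k * enorm z + c1 * R1 * enorm z ^+ m.+1 =
      (k + c1 * R1 * enorm z ^+ m) * enorm z by rewrite (exprS (enorm z)); ring.
  rewrite ler_wpM2r//.
  have h1 := hc1 _ _ (enorm_ge0 x) se0.
  have h2 : R1 * c1 * (s * enorm z) ^+ m <= R1 * c1 * enorm z ^+ m.
    by rewrite ler_wpM2l ?mulr_ge0// lerXn2r ?nnegrE.
  by rewrite /k; lra.
rewrite EgD//; [|exact: tame_cst|by apply: tameD; apply: tameZ].
rewrite Eg_cst EgD//; [|exact: tameZ|exact: tameZ].
rewrite !EgZ// lerD2l.
have c20 : 0 <= c1 * R1 by rewrite mulr_ge0.
have e1 := ler_wpM2l k0 (Eg_enorm gam gamP hd).
have e2 := ler_wpM2l c20 (Eg_moment gam gamP hd m.+1).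
rewrite -natr1 in e2; rewrite -/M1 -/sd in e1 e2.
by rewrite lerD.
Qed.

(** The growth bound gives |V| <= R2 |z|^2 + c1 R1 |x|^m |z|^2 + c1 R1 |z|^(m+2); the factor 3^(p-1)
    comes from the p-th power of these three terms. *)
Lemma zo_dir_moment x p : (0 < p)%N ->
  Eg (fun z => enorm (zo_dir x z) ^+ p) <=
  3 ^+ p.-1 * (R2 ^+ p * (2 * p%:R + d%:R) ^+ p
    + c1 ^+ p * R1 ^+ p * ((m%:R + 2) * p%:R + d%:R) `^ ((m%:R + 2) * p%:R / 2))
  * (enorm x ^+ (m * p) + 1).
Proof.
move=> p0; have tn := @tame_enorm R d.
have tX n : tame (fun z : 'rV[R]_d => enorm z ^+ n) by exact: tameX.
have [C1 C1E] : exists C1 : R, C1 = c1 * R1 by exists (c1 * R1).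
have C10 : 0 <= C1 by rewrite C1E mulr_ge0.
pose k1 := R2 ^+ p; pose k2 := C1 ^+ p * enorm x ^+ (m * p); pose k3 := C1 ^+ p.
have k10 : 0 <= k1 by rewrite exprn_ge0.
have k30 : 0 <= k3 by rewrite exprn_ge0.
have k20 : 0 <= k2 by rewrite mulr_ge0// exprn_ge0.
have t3 : 0 <= 3 ^+ p.-1 :> R by rewrite exprn_ge0.
have bound z : enorm (zo_dir x z) ^+ p <=
    3 ^+ p.-1 * ((k1 + k2) * enorm z ^+ (2 * p) + k3 * enorm z ^+ ((m + 2) * p)).
  set t := enorm z; have t0 : 0 <= t by exact: enorm_ge0.
  have st0 : 0 <= s * t by rewrite mulr_ge0// ltW.
  have h : enorm (zo_dir x z) <=
      R2 * t ^+ 2 + C1 * enorm x ^+ m * t ^+ 2 + C1 * t ^+ (m + 2).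
    rewrite /zo_dir enormZ normrM gtr0_norm ?invr_gt0//.
    have := f_incr x (s *: z); rewrite enormZ (gtr0_norm s0) -/t => fi.
    have h1 := hc1 _ _ (enorm_ge0 x) st0.
    have h2 : R1 * c1 * (s * t) ^+ m <= R1 * c1 * t ^+ m.
      by rewrite ler_wpM2l ?mulr_ge0// lerXn2r ?nnegrE// ler_piMl.
    have h3 : s^-1 * `|f (x + s *: z) - f x| <= L (enorm x + s * t) * t.
      by rewrite ler_pdivrMl// mulrCA.
    apply: (le_trans (ler_wpM2r t0 h3)).
    have h4 : L (enorm x + s * t) <= C1 * enorm x ^+ m + C1 * t ^+ m + R2.
      by rewrite C1E; lra.
    rewrite -[leLHS]mulrA -expr2; apply: (le_trans (ler_wpM2r (sqr_ge0 t) h4)).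
    by rewrite exprD; lra.
  have a1 : 0 <= R2 * t ^+ 2 by rewrite mulr_ge0// sqr_ge0.
  have a2 : 0 <= C1 * enorm x ^+ m * t ^+ 2 by rewrite !mulr_ge0// ?exprn_ge0.
  have a3 : 0 <= C1 * t ^+ (m + 2) by rewrite mulr_ge0// exprn_ge0.
  have hp := exprD3_le_pow3 _ _ _ p.-1 a1 a2 a3; rewrite (prednK p0) in hp.
  apply: le_trans (le_trans (lerXn2r p _ _ h) hp) _; rewrite ?nnegrE ?addr_ge0//.
  have tt : t ^+ p * t ^+ p = t ^+ (2 * p) by rewrite -exprD addnn mul2n.
  rewrite ler_wpM2l// !exprMn -!exprM !tt /k1 /k2 /k3; lra.
have tz : tame (fun z => enorm (zo_dir x z) ^+ p).
  by apply: tameX; apply: tame_vcomp => //; exact: tame_zo_dir.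
have tb1 : tame (fun z : 'rV[R]_d => (k1 + k2) * enorm z ^+ (2 * p)) by exact: tameZ.
have tb2 : tame (fun z : 'rV[R]_d => k3 * enorm z ^+ ((m + 2) * p)) by exact: tameZ.
apply: (le_trans (Eg_le gam gamP _ _ tz (tameZ (3 ^+ p.-1) _ (tameD _ _ tb1 tb2)) bound)).
rewrite EgZ//; last exact: tameD.
rewrite EgD// !EgZ// -mulrA ler_wpM2l//.
pose m1 := (2 * p%:R + d%:R : R) ^+ p.
pose m2 : R := ((m%:R + 2) * p%:R + d%:R) `^ ((m%:R + 2) * p%:R / 2).
have e1 : Eg (fun z => enorm z ^+ (2 * p)) <= m1.
  apply: (le_trans (Eg_moment gam gamP hd (2 * p))).
  rewrite natrM mulrAC divff ?pnatr_eq0// mul1r powR_mulrn//.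
have e2 : Eg (fun z => enorm z ^+ ((m + 2) * p)) <= m2.
  by apply: (le_trans (Eg_moment gam gamP hd ((m + 2) * p))); rewrite natrM natrD.
have p1 : 1 <= p%:R :> R by rewrite ler1n.
(* Lets the |x|^m term, which carries a moment of order 2p only, share the constant of the moment of
   order (m+2) p. *)
have m12 : m1 <= m2.
  have b0 : 1 <= 2 * p%:R + d%:R :> R by rewrite ler_wpDr//; lra.
  have mp0 : 0 <= m%:R * p%:R :> R by rewrite mulr_ge0.
  have -> : m1 = (2 * p%:R + d%:R) `^ p%:R by rewrite powR_mulrn// (le_trans ler01).
  apply: (@le_trans _ _ ((2 * p%:R + d%:R) `^ ((m%:R + 2) * p%:R / 2))).
    by rewrite ler_powR//; lra.
  apply: ge0_ler_powR; rewrite ?nnegrE; lra.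
have m10 : 0 <= m1 by rewrite exprn_ge0// addr_ge0// mulr_ge0.
have xp0 : 0 <= enorm x ^+ (m * p) by rewrite exprn_ge0.
have f1 : (k1 + k2) * Eg (fun z => enorm z ^+ (2 * p)) <= (k1 + k2) * m1.
  by rewrite ler_wpM2l// addr_ge0.
have f2 := ler_wpM2l k30 e2.
have f3 : k2 * m1 <= k2 * m2 by rewrite ler_wpM2l.
have f4 : 0 <= k1 * m1 * enorm x ^+ (m * p) by rewrite !mulr_ge0.
have k3E : c1 ^+ p * R1 ^+ p = k3 by rewrite /k3 C1E exprMn.
rewrite -/m1 -/m2 k3E -/k1.
have -> : (k1 * m1 + k3 * m2) * (enorm x ^+ (m * p) + 1) =
   k1 * m1 * enorm x ^+ (m * p) + k2 * m2 + k1 * m1 + k3 * m2 by rewrite /k2 -/k3; ring.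
lra.
Qed.

End Smoothing.

(** * One step of the method, and the comparison with the Goldstein distance *)

Section SmoothingStep.
Context {R : realType} {d : nat}.
Variable gam : probability (gspace R d) R.
Hypothesis gamP : std_gaussian_law gam.
Hypothesis hd : (0 < d)%N.
Variables (f : 'rV[R]_d -> R) (R1 R2 s c1 : R) (m : nat).
Hypotheses (R10 : 0 <= R1) (R20 : 0 <= R2) (s0 : 0 < s) (s1 : s <= 1) (c10 : 0 <= c1).
Hypothesis f0 : forall x, 0 <= f x.
Hypothesis flip : forall y z (r : R), enorm y <= r -> enorm z <= r ->
  `|f y - f z| <= (R1 * r ^+ m + R2) * enorm (y - z).
Hypothesis hc1 : forall a b : R, 0 <= a -> 0 <= b ->
  R1 * (a + b) ^+ m <= R1 * c1 * (a ^+ m + b ^+ m).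

Local Notation Eg phi := (\int[gam]_z phi z)%R.
Local Notation "a `^ b" := (powR a b).
Implicit Types (x y z v h : 'rV[R]_d).

Let M1 : R := (m%:R + 1 + d%:R) `^ ((m%:R + 1) / 2).
Let sd : R := Num.sqrt d%:R.
Let F x := smooth gam f s x.
Let G x := smooth_grad gam f s x.
Let V x z := zo_dir f s x z.
Let H (p : nat) : R := 3 ^+ p.-1 * (R2 ^+ p * (2 * p%:R + d%:R) ^+ p
    + c1 ^+ p * R1 ^+ p * ((m%:R + 2) * p%:R + d%:R) `^ ((m%:R + 2) * p%:R / 2)).

Let tF : tame F.
Proof. exact: (tame_smooth gam gamP f R1 R2 s c1 m). Qed.

Let tV x i : tame (fun z => V x z 0 i).
Proof. exact: (tame_zo_dir f R1 R2 s m). Qed.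

Lemma tame_smooth_step x (a : R) : tame (fun z => F (x - a *: V x z)).
Proof.
apply: tame_vcomp => // i; under eq_fun do rewrite !mxE.
apply: tameB; first exact: tame_cst.
by apply: tameZ; have := tV x i; under eq_fun do rewrite mxE.
Qed.

Lemma H_ge0 p : 0 <= H p.
Proof.
rewrite mulr_ge0 ?exprn_ge0// addr_ge0// mulr_ge0 ?exprn_ge0 ?powR_ge0//.
by rewrite mulr_ge0 ?exprn_ge0.
Qed.

(** With c1 = 2^(m-1) this is the sum of the last three terms of K, the total of the descent
    remainders. *)
Definition step_excess : R :=
  2^-1 * H 2 * (c1 ^+ 2 * R1 * M1 + R2 * sd) + c1 ^+ 2 / 2 * H 2 * R1 * sd
  + c1 * R1 * H (m + 2) * (m%:R + 2)^-1 * sd.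

Lemma step_excess_ge0 : 0 <= step_excess.
Proof.
have h2 := H_ge0 2; have hm := H_ge0 (m + 2).
have M10 : 0 <= M1 by exact: powR_ge0.
have sd0 : 0 <= sd by exact: sqrtr_ge0.
have i2 : 0 <= (m%:R + 2)^-1 :> R by rewrite invr_ge0 addr_ge0.
have c20 : 0 <= c1 ^+ 2 by exact: sqr_ge0.
rewrite /step_excess; set c2 := c1 ^+ 2 in c20 *.
have A0 : 0 <= c2 * R1 * M1 + R2 * sd by rewrite addr_ge0 ?mulr_ge0.
move: (H 2) h2 (H (m + 2)) hm => a a0 b b0.
by rewrite !addr_ge0 ?mulr_ge0.
Qed.

(** For y = |x|^m: the normalization of the step, raised to the power m + 2, absorbs the growth of
    the moment of order m + 2 of the direction. *)
Lemma power_sum_le (y : R) n : 0 <= y -> y ^+ n.+2 + 1 <= (y ^+ 2 + 1) ^+ n.+2.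
Proof.
move=> y0; have y2 : 0 <= y ^+ 2 by exact: sqr_ge0.
have b1 : 1 <= y ^+ 2 + 1 by rewrite lerDr.
have [y1|y1] := leP y 1.
  apply: (@le_trans _ _ (y ^+ 2 + 1)).
    by rewrite lerD2r -addn2 exprD ler_piMl// exprn_ile1.
  by rewrite -[leLHS]expr1; apply: ler_weXn2l.
have sup n' : (y ^+ 2) ^+ n'.+1 + 1 <= (y ^+ 2 + 1) ^+ n'.+1.
  elim: n' => [|k IH]; first by rewrite !expr1.
  rewrite [leRHS]exprS; apply: le_trans (ler_wpM2l _ IH); last lra.
  rewrite mulrDr mulr1 mulrDl mul1r -exprS; have : 0 <= (y ^+ 2) ^+ k.+1 by rewrite exprn_ge0.
  lra.
apply: le_trans (sup n.+1); rewrite lerD2r -exprM mul2n -addnn exprD.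
by rewrite ler_peMl ?exprn_ge0// exprn_ege1// ltW.
Qed.

(** Averaging the descent inequality over the direction. The step is divided by |x|^(2m) + 1 exactly
    so that both remainders are bounded uniformly in [x]. *)
Lemma smooth_step x (tau N : R) : 0 <= tau -> tau <= 1 -> s^-1 * tau ^+ 2 <= N ->
  Eg (fun z => F (x - (tau / (enorm x ^+ (2 * m) + 1)) *: V x z))
  + tau * (enorm (G x) ^+ 2 / (enorm x ^+ (2 * m) + 1)) <= F x + N * step_excess.
Proof.
move=> tau0 tau1 hN.
set y := enorm x ^+ m; have y0 : 0 <= y by rewrite exprn_ge0.
have xyE : enorm x ^+ (2 * m) = y ^+ 2 by rewrite mulnC exprM.
rewrite xyE; set D := y ^+ 2 + 1; have D1 : 1 <= D by rewrite lerDr sqr_ge0.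
have D0 : 0 < D by rewrite (lt_le_trans ltr01).
set a := tau / D; have a0 : 0 <= a by rewrite divr_ge0// ltW.
have sd0 : 0 <= sd by exact: sqrtr_ge0.
have M10 : 0 <= M1 by exact: powR_ge0.
have i2 : 0 <= (m%:R + 2)^-1 :> R by rewrite invr_ge0 addr_ge0.
have si0 : 0 <= s^-1 by rewrite invr_ge0 ltW.
pose A0 := c1 ^+ 2 * R1 * M1 + R2 * sd.
have A00 : 0 <= A0 by rewrite addr_ge0// !mulr_ge0// sqr_ge0.
pose B0 := c1 ^+ 2 / 2 * R1 * sd.
have B00 : 0 <= B0 by rewrite !mulr_ge0// sqr_ge0.
pose Q := 2^-1 * A0 + B0 * y.
have Q0 : 0 <= Q by rewrite addr_ge0 ?mulr_ge0.
pose W := c1 * R1 * (m%:R + 2)^-1 * sd.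
have W0 : 0 <= W by rewrite !mulr_ge0.
have tn p : tame (fun z => enorm (V x z) ^+ p).
  by apply: tameX; apply: tame_vcomp; [exact: tame_enorm|exact: tV].
have tg : tame (fun z => dotv (G x) (V x z)).
  by apply: tame_vcomp; [exact: tame_dotv|exact: tV].
have pt z : F (x - a *: V x z) <= F x - a * dotv (G x) (V x z)
    + (s^-1 * a ^+ 2 * Q * enorm (V x z) ^+ 2
       + s^-1 * a ^+ (m + 2) * W * enorm (V x z) ^+ (m + 2)).
  have := smooth_descent gam gamP hd f R1 R2 s c1 m R10 R20 s0 s1 c10 f0 flip hc1 x
    (- (a *: V x z)).
  rewrite -/(F _) -/(F _) -/(G x) -/sd -/M1 dotvNl dotvZl enormN enormZ (ger0_norm a0).
  rewrite -/y -/A0 (dotvC (G x)) => h; apply: (le_trans h).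
  rewrite le_eqVlt; apply/orP; left; apply/eqP.
  by rewrite !exprMn /Q /W /B0; ring.
pose q1 := s^-1 * a ^+ 2 * Q; pose q2 := s^-1 * a ^+ (m + 2) * W.
have t1 : tame (fun z => F x - a * dotv (G x) (V x z)).
  by apply: tameB; [exact: tame_cst|exact: tameZ].
have t2 : tame (fun z => q1 * enorm (V x z) ^+ 2 + q2 * enorm (V x z) ^+ (m + 2)).
  by apply: tameD; apply: tameZ.
have := Eg_le gam gamP _ _ (tame_smooth_step x a) (tameD _ _ t1 t2) pt.
rewrite EgD// EgB//; [|exact: tame_cst|exact: tameZ].
rewrite Eg_cst EgZ// EgD//; [|exact: tameZ|exact: tameZ].
rewrite !EgZ// (Eg_zo_dir gam gamP f R1 R2 s m)// -/(G x) -enorm_sqr => main.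
have e1 := zo_dir_moment gam gamP hd f R1 R2 s c1 m R10 R20 s0 s1 c10 f0 flip hc1 x 2 isT.
have e2 := zo_dir_moment gam gamP hd f R1 R2 s c1 m R10 R20 s0 s1 c10 f0 flip hc1 x (m + 2)
  (ltn_addl m (isT : (0 < 2)%N)).
rewrite !exprM -/y -/(H _) in e1 e2.
have q10 : 0 <= q1.
  by apply: mulr_ge0 => //; apply: mulr_ge0 => //; exact: sqr_ge0.
have q20 : 0 <= q2.
  by apply: mulr_ge0 => //; apply: mulr_ge0 => //; exact: exprn_ge0.
have g1 : q1 * Eg (fun z => enorm (V x z) ^+ 2) <= N * (H 2 * (2^-1 * A0 + B0)).
  apply: (le_trans (ler_wpM2l q10 e1)); rewrite -/D.
  have -> : q1 * (H 2 * D) = s^-1 * tau ^+ 2 * (H 2 * (Q / D)).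
    by rewrite /q1 /a; field; rewrite !gt_eqF.
  (* One factor [D] of the squared step is spent on the second moment; the other one absorbs [Q],
     which is affine in y <= y^2 + 1. *)
  have QD : Q / D <= 2^-1 * A0 + B0.
    rewrite ler_pdivrMr// /Q mulrDl.
    have yD : y <= D by rewrite /D; have := sqr_ge0 (y - 1); rewrite !expr2; lra.
    have : 2^-1 * A0 <= 2^-1 * A0 * D by rewrite ler_peMr// mulr_ge0.
    have : B0 * y <= B0 * D by rewrite ler_wpM2l.
    lra.
  apply: ler_pM => //.
  - by rewrite mulr_ge0// sqr_ge0.
  - by rewrite mulr_ge0 ?H_ge0// divr_ge0// ltW.
  - by rewrite ler_wpM2l// H_ge0.
have g2 : q2 * Eg (fun z => enorm (V x z) ^+ (m + 2)) <= N * (W * H (m + 2)).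
  apply: (le_trans (ler_wpM2l q20 e2)).
  have -> : q2 * (H (m + 2) * (y ^+ (m + 2) + 1)) =
      s^-1 * tau ^+ 2 * (tau ^+ m * ((y ^+ (m + 2) + 1) / D ^+ (m + 2)) * (W * H (m + 2))).
    rewrite /q2 /a expr_div_n [tau ^+ (m + 2)]exprD; field.
    by rewrite !gt_eqF// exprn_gt0.
  have WH : 0 <= W * H (m + 2) by rewrite mulr_ge0// H_ge0.
  have r1 : (y ^+ (m + 2) + 1) / D ^+ (m + 2) <= 1.
    by rewrite ler_pdivrMr ?exprn_gt0// mul1r addn2 power_sum_le.
  have r0 : 0 <= (y ^+ (m + 2) + 1) / D ^+ (m + 2).
    by rewrite divr_ge0 ?exprn_ge0 ?(ltW D0)// addr_ge0// exprn_ge0.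
  have tm : tau ^+ m * ((y ^+ (m + 2) + 1) / D ^+ (m + 2)) <= 1.
    by rewrite -[leRHS]mul1r ler_pM// ?exprn_ge0// exprn_ile1.
  apply: ler_pM => //.
  - by rewrite mulr_ge0// sqr_ge0.
  - by rewrite mulr_ge0// mulr_ge0// exprn_ge0.
  - by rewrite -[leRHS]mul1r ler_wpM2r.
have aE : tau * (enorm (G x) ^+ 2 / D) = a * enorm (G x) ^+ 2 by rewrite /a; ring.
rewrite aE.
have -> : N * step_excess = N * (H 2 * (2^-1 * A0 + B0)) + N * (W * H (m + 2)).
  by rewrite /step_excess /A0 /B0 /W; ring.
lra.
Qed.

(** A radius may be inflated by this ratio at the cost of a factor 2 in its n-th power, since the
    power is at most e^(1/2). *)
Lemma one_plus_small_pow (n : nat) : (1 + (2 * n.+1%:R)^-1) ^+ n <= 2 :> R.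
Proof.
have q0 : 0 < 2 * n.+1%:R :> R by rewrite mulr_gt0.
have h : (1 + (2 * n.+1%:R)^-1) ^+ n <= expR (2^-1) :> R.
  apply: (@le_trans _ _ (expR ((2 * n.+1%:R)^-1) ^+ n)).
    by rewrite lerXn2r ?nnegrE ?expR_ge0 ?expR_ge1Dx// addr_ge0// invr_ge0 ltW.
  rewrite -expRM_natl ler_expR ler_pdivrMr// mulrA mulVf// mul1r.
  by rewrite ler_nat.
have := expR_sub1_le (2^-1 : R); lra.
Qed.

Lemma goldstein_le_grad x (D delta : R) : 0 < delta -> 0 < D ->
  D <= R1 * enorm x ^+ m + R2 ->
  (forall eta : R, 0 < eta -> exists2 v, enorm v = 1 & forall y (t : R), 0 <= t ->
     enorm (y - x) <= delta -> enorm (y + t *: v - x) <= delta ->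
     f (y + t *: v) - f y <= t * (- D + eta)) ->
  D <= enorm (G x)
    + (R1 * (c1 + 1) * enorm x ^+ m + 2 * R2) * (s / (3 / 4 * delta)) ^+ d
      * (d%:R + d%:R) `^ (d%:R / 2)
    + 2 * R1 * c1 * s ^+ m * (m%:R + d%:R) `^ (m%:R / 2).
Proof.
move=> de0 D0 DL Hv.
(* The remaining delta / 4 is kept for the displacement t v. *)
set d' := 3 / 4 * delta; have d'0 : 0 < d' by rewrite /d' !mulr_gt0.
pose K1 := R1 * (c1 + 1) * enorm x ^+ m + 2 * R2.
pose K2 := 2 * R1 * c1 * s ^+ m.
pose y := enorm x ^+ m; have y0 : 0 <= y by rewrite exprn_ge0.
have K10 : 0 <= K1 by rewrite addr_ge0 ?mulr_ge0 ?addr_ge0.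
have K20 : 0 <= K2 by rewrite !mulr_ge0// exprn_ge0// ltW.
set Ed := (_ + _) `^ (d%:R / 2); set Em := (_ + _) `^ (m%:R / 2).
pose rho : R := (2 * m.+1%:R)^-1.
have rho0 : 0 < rho by rewrite invr_gt0 mulr_gt0.
have rhom : (1 + rho) ^+ m <= 2 by exact: one_plus_small_pow.
apply/ler_addgt0Pr => e e0; have e20 : 0 < e / 2 by rewrite divr_gt0.
have [v v1 Hf] := Hv _ e20.
have [C HC] := smooth_diff gam gamP f R1 R2 s m s0 f0 flip x v.
(* The four bounds serve, in order: the expansion of F, staying in the delta-ball, inflating the
   radius by 1 + rho only, and a second-order remainder below e / 2. *)
pose t := Num.min (Num.min 1 (delta / 4)) (Num.min (rho * d') (e / 2 / (`|C| + 1))).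
have C0 : 0 < `|C| + 1 by rewrite ltr_wpDl.
have t0 : 0 < t by rewrite !lt_min ltr01 !divr_gt0//= mulr_gt0.
have /andP[/andP[t1 t2] /andP[t3 t4]] : [&& t <= 1 & t <= delta / 4] &&
    [&& t <= rho * d' & t <= e / 2 / (`|C| + 1)].
  by rewrite -!le_min lexx.
have pt z : f (x + t *: v + s *: z) - f (x + s *: z) <= t * (- D + e / 2)
    + (t * K1 * (s / d') ^+ d * enorm z ^+ d + t * K2 * enorm z ^+ m).
  have sz0 : 0 <= s * enorm z by rewrite mulr_ge0// ltW.
  have n1 : 0 <= t * K1 * (s / d') ^+ d * enorm z ^+ d.
    by rewrite !mulr_ge0 ?exprn_ge0 ?(ltW t0)// divr_ge0// ltW.
  have n2 : 0 <= t * K2 * enorm z ^+ m.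
    by apply: mulr_ge0; [apply: mulr_ge0 => //; exact: ltW|exact: exprn_ge0].
  rewrite (addrAC x).
  have [near|far] := leP (s * enorm z) d'.
    have h1 : enorm (x + s *: z - x) <= delta.
      rewrite addrAC subrr add0r enormZ (gtr0_norm s0) (le_trans near)// /d'; lra.
    have h2 : enorm (x + s *: z + t *: v - x) <= delta.
      have -> : x + s *: z + t *: v - x = s *: z + t *: v.
        by rewrite -(addrA x) (addrAC x) subrr add0r.
      rewrite (le_trans (enormD _ _))//.
      rewrite !enormZ (gtr0_norm s0) (gtr0_norm t0) v1.
      by move: near; rewrite /d'; lra.
    have := Hf (x + s *: z) t (ltW t0) h1 h2; lra.
  have := f_incr f R1 R2 m flip (x + s *: z) (t *: v).
  rewrite enormZ (gtr0_norm t0) v1 mulr1 => h.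
  have xs : enorm (x + s *: z) <= enorm x + s * enorm z.
    by rewrite (le_trans (enormD _ _))// enormZ (gtr0_norm s0).
  have ts : t <= rho * (s * enorm z).
    by rewrite (le_trans t3)// ler_pM2l// ltW.
  have xr : enorm (x + s *: z) + t <= enorm x + (1 + rho) * (s * enorm z).
    by rewrite mulrDl mul1r addrA lerD.
  have r0 : 0 <= (1 + rho) * (s * enorm z) by rewrite mulr_ge0// addr_ge0// ltW.
  have h1 : R1 * (enorm (x + s *: z) + t) ^+ m <= R1 * c1 * y + K2 * enorm z ^+ m.
    apply: (@le_trans _ _ (R1 * (enorm x + (1 + rho) * (s * enorm z)) ^+ m)).
      rewrite ler_wpM2l// lerXn2r ?nnegrE// addr_ge0// ltW//.
    apply: (le_trans (hc1 _ _ (enorm_ge0 x) r0)); rewrite mulrDr lerD2l.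
    have -> : K2 * enorm z ^+ m = R1 * c1 * (2 * (s * enorm z) ^+ m).
      by rewrite /K2 exprMn; ring.
    by rewrite ler_wpM2l ?mulr_ge0// exprMn ler_wpM2r// exprn_ge0.
  (* Markov's inequality in pointwise form: on the far region this power is at least the
     indicator. *)
  have z1 : 1 <= (s / d') ^+ d * enorm z ^+ d.
    rewrite -exprMn exprn_ege1// mulrAC ler_pdivlMr// mul1r ltW//.
  have k1 : K1 <= K1 * ((s / d') ^+ d * enorm z ^+ d) by rewrite ler_peMr.
  have key : R1 * (enorm (x + s *: z) + t) ^+ m + R2 <=
      - D + e / 2 + K1 * ((s / d') ^+ d * enorm z ^+ d) + K2 * enorm z ^+ m.
    move: k1 h1 DL; rewrite {1}/K1 -/y; lra.
  have := ler_wpM2l (ltW t0) key.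
  have := le_trans (ler_norm _) h; lra.
have td : tame (fun z : 'rV[R]_d => enorm z ^+ d) by apply: tameX; exact: tame_enorm.
have tm : tame (fun z : 'rV[R]_d => enorm z ^+ m) by apply: tameX; exact: tame_enorm.
have tf x' : tame (fun z => f (x' + s *: z)) by exact: (tame_f f R1 R2 s m).
have t5 : tame (fun z : 'rV[R]_d => t * K1 * (s / d') ^+ d * enorm z ^+ d + t * K2 * enorm z ^+ m).
  by apply: tameD; apply: tameZ.
have := Eg_le gam gamP _ _ (tameB _ _ (tf (x + t *: v)) (tf x))
  (tameD _ _ (tame_cst (t * (- D + e / 2))) t5) pt.
rewrite EgB// EgD//; last exact: tame_cst.
rewrite Eg_cst EgD//; [|exact: tameZ|exact: tameZ].
rewrite !EgZ// -!/(smooth _ _ _ _) => hE.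
have tn1 : `|t| <= 1 by rewrite ger0_norm// ltW.
have := HC t tn1; rewrite ler_norml => /andP[hC _].
have Ct : C * t <= e / 2.
  have : t * (`|C| + 1) <= e / 2 by rewrite -ler_pdivlMr.
  have : C * t <= `|C| * t by rewrite ler_pM2r// ler_norm.
  lra.
have vg : - enorm (G x) <= dotv v (G x).
  have := dotv_cauchy_abs v (G x); rewrite v1 mul1r ler_norml => /andP[].
  by [].
have ed := Eg_moment gam gamP hd d; have em := Eg_moment gam gamP hd m.
rewrite -/Ed in ed; rewrite -/Em in em.
have sd0 : 0 <= (s / d') ^+ d by rewrite exprn_ge0// divr_ge0// ltW.
have ed' : K1 * (s / d') ^+ d * Eg (fun z => enorm z ^+ d) <= K1 * (s / d') ^+ d * Ed.
  by rewrite ler_wpM2l// mulr_ge0.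
have em' : K2 * Eg (fun z => enorm z ^+ m) <= K2 * Em by rewrite ler_wpM2l.
(* Both estimates of F(x + t v) - F(x) are compared and divided by [t]. *)
have fin : dotv v (G x) - C * t <= - D + e / 2 + K1 * (s / d') ^+ d * Eg (fun z => enorm z ^+ d)
    + K2 * Eg (fun z => enorm z ^+ m).
  rewrite -(ler_pM2l t0); move: hE hC; rewrite -/(G x) expr2; lra.
rewrite -/K1 -/K2; lra.
Qed.

Lemma norm_sq_le_smooth x (k B : R) : 0 <= k ->
  (forall z, enorm x ^+ 2 <= k * f (x + s *: z) + 4 * enorm z ^+ 2 + B) ->
  enorm x ^+ 2 <= k * F x + 4 * d%:R + B.
Proof.
move=> k0 Hx.
have td : tame (fun z : 'rV[R]_d => 4 * enorm z ^+ 2).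
  by apply: tameZ; apply: tameX; exact: tame_enorm.
have tf : tame (fun z => f (x + s *: z)) by exact: (tame_f f R1 R2 s m).
have tk : tame (fun z => k * f (x + s *: z)) by exact: tameZ.
have := Eg_le gam gamP _ _ (tame_cst (enorm x ^+ 2))
  (tameD _ _ (tameD _ _ tk td) (tame_cst B)) Hx.
rewrite !EgD//; [|exact: tameD|exact: tame_cst].
rewrite !Eg_cst !EgZ//; last by apply: tameX; exact: tame_enorm.
rewrite -/(smooth _ _ _ _) -/(F x); have := Eg_enorm_sq gam gamP; lra.
Qed.

End SmoothingStep.

(** * The random trajectory *)

Section LowerIntegral.
Context {dO : measure_display} {Om : measurableType dO} {R : realType}.
Variable P : {measure set Om -> \bar R}.
Import HBNNSimple.

(* The integral of a nonnegative function is a supremum over simple minorants, hence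
   monotone without any measurability assumption. *)
Lemma ge0_le_integral_nomeas (f g : Om -> \bar R) : (forall w, 0 <= f w)%E ->
  (forall w, f w <= g w)%E -> (\int[P]_w f w <= \int[P]_w g w)%E.
Proof.
move=> f0 fg; have g0 w : (0 <= g w)%E by exact: le_trans (fg w).
rewrite !ge0_integralTE//; apply: le_ereal_sup => _ [h hf <-].
by exists h => // w; exact: le_trans (hf w) (fg w).
Qed.

End LowerIntegral.

Section GaussianProcess.
Context {R : realType} {d : nat} {dO : measure_display} {Om : measurableType dO}.
Variable P : probability Om R.
Variable u : nat -> Om -> 'rV[R]_d.
Hypothesis hu : iid_std_gaussian P u.

Let X (ki : nat * 'I_d) (w : Om) : R := u ki.1 w 0 ki.2.

Lemma noise_coord_measurable k i : measurable_fun setT (fun w => u k w 0 i).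
Proof. exact: (hu.1.1 (k, i)). Qed.

Lemma noise_measurable k : measurable_fun setT (u k : Om -> gspace R d).
Proof.
by apply: measurable_to_coord => i _; exact: noise_coord_measurable.
Qed.

Definition noise k : {mfun Om >-> gspace R d} :=
  HB.pack (u k : Om -> gspace R d) (isMeasurableFun.Build _ _ _ _ _ (noise_measurable k)).

Lemma noise_law k : std_gaussian_law (distribution P (noise k)).
Proof.
move=> B mB.
pose s : seq (nat * 'I_d) := [seq (k, i) | i <- index_enum 'I_d].
have us : uniq s.
  by rewrite map_inj_uniq ?index_enum_uniq// => i j [].
have := hu.1.2 s (fun ki => B ki.2) us (fun ki => mB ki.2).
rewrite !big_map => h.
transitivity (P (\big[setI/setT]_(i <- index_enum 'I_d)
    ((fun w : Om => u k w 0 i) @^-1` B i))).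
  congr (P _); apply/seteqP; split=> w.
    by move=> /coord_boxP H; rewrite -bigcap_seq => i /= si; exact: H.
  by rewrite -bigcap_seq => H; apply/coord_boxP => i si; exact: (H i).
by rewrite h; apply: eq_bigr => i _; exact: hu.2.
Qed.

Let gam : probability (gspace R d) R := distribution P (noise 0).

Lemma noise_integral k (phi : gspace R d -> \bar R) : measurable_fun setT phi ->
  (forall z, 0 <= phi z)%E -> (\int[P]_w phi (u k w) = \int[gam]_z phi z)%E.
Proof.
move=> mphi phi0.
rewrite -[LHS](ge0_integral_distribution (noise k) mphi phi0).
apply: eq_measure_integral => A mA _.
apply: (gspace_measure_unique (distribution P (noise k)) gam) => //.
  by move=> B mB; exact: (etrans (noise_law k B mB) (esym (noise_law 0 B mB))).
by have := probability_setT (distribution P (noise k)) => /= ->; rewrite ltry.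
Qed.

Variables (x : nat -> Om -> 'rV[R]_d) (x0 : 'rV[R]_d)
  (Phi : 'rV[R]_d -> 'rV[R]_d -> 'rV[R]_d).
Hypothesis hx0 : forall w, x 0%N w = x0.
Hypothesis hxS : forall k w, x k.+1 w = Phi (x k w) (u k w).
Hypothesis mPhi : forall (dT : measure_display) (T : measurableType dT)
  (Y Z : T -> 'rV[R]_d),
  (forall i, measurable_fun setT (fun t => Y t 0 i)) ->
  (forall i, measurable_fun setT (fun t => Z t 0 i)) ->
  forall i, measurable_fun setT (fun t => Phi (Y t) (Z t) 0 i).

Let past k : seq (nat * 'I_d) := [seq (j, i) | j <- iota 0 k, i <- index_enum 'I_d].
Let present k : seq (nat * 'I_d) := [seq (k, i) | i <- index_enum 'I_d].

Lemma past_present_uniq k : uniq (past k ++ present k).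
Proof.
rewrite cat_uniq; apply/and3P; split.
- by apply: allpairs_uniq; rewrite ?iota_uniq ?index_enum_uniq// => -[a b] [a' b'] _ _.
- apply/hasPn => _ /mapP[i _ ->]; apply/negP => /allpairsP[[j i'] [/= jk _ [kj _]]].
  by move: jk; rewrite mem_iota -kj ltnn andbF.
- by rewrite map_inj_uniq ?index_enum_uniq// => i j [].
Qed.

(** The iterates depend on earlier noise only. The horizon [K] is fixed during the induction so that
    all iterates are measured by one sigma-algebra. *)
Lemma process_past_measurable K k i : (k <= K)%N ->
  measurable_fun setT
    ((fun w => x k w 0 i) : g_sigma_algebraType (coord_boxes X (past K)) -> R).
Proof.
elim: k i => [|k IHk] i kK.
  by under eq_fun do rewrite hx0; exact: measurable_cst.
under eq_fun do rewrite hxS.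
apply: (mPhi _ (g_sigma_algebraType (coord_boxes X (past K))) (x k) (u k)) => j.
  by apply: IHk; exact: ltnW.
apply: (coord_measurable X (past K) (k, j)).
by apply: allpairs_f; rewrite ?mem_iota ?mem_index_enum//= add0n.
Qed.

Lemma process_measurable k i : measurable_fun setT (fun w => x k w 0 i).
Proof.
elim: k i => [|k IHk] i.
  by under eq_fun do rewrite hx0; exact: measurable_cst.
under eq_fun do rewrite hxS.
by apply: (mPhi _ Om (x k) (u k)) => j; [exact: IHk|exact: noise_coord_measurable].
Qed.

(** Plays the role of conditioning on the past: x^k is a function of the past coordinates, so the
    current noise may be integrated out first under its law. *)
Lemma process_decouple k (Psi : 'rV[R]_d -> 'rV[R]_d -> R) :
  (forall (dT : measure_display) (T : measurableType dT) (Y Z : T -> 'rV[R]_d),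
    (forall i, measurable_fun setT (fun t => Y t 0 i)) ->
    (forall i, measurable_fun setT (fun t => Z t 0 i)) ->
    measurable_fun setT (fun t => Psi (Y t) (Z t))) ->
  (forall y z, 0 <= Psi y z) ->
  (\int[P]_w (Psi (x k w) (u k w))%:E =
   \int[P]_w \int[gam]_z (Psi (x k w) z)%:E)%E.
Proof.
move=> mPsi Psi0.
pose Th (p : g_sigma_algebraType (coord_boxes X (past k)) * gspace R d) : \bar R :=
  (Psi (x k p.1) p.2)%:E.
have mTh : measurable_fun setT Th.
  apply/measurable_EFinP; apply: (mPsi _
    (g_sigma_algebraType (coord_boxes X (past k)) * gspace R d)%type
    (fun p => x k p.1) (fun p => p.2)) => i.
    exact: (measurableT_comp (process_past_measurable k k i (leqnn k)) measurable_fst).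
  exact: (measurableT_comp (measurable_row_coord i) measurable_snd).
have mY : measurable_fun setT
    (u k : g_sigma_algebraType (coord_boxes X (present k)) -> gspace R d).
  apply: measurable_to_coord => i _.
  by apply: (coord_measurable X (present k) (k, i)); apply: map_f; rewrite mem_index_enum.
have Th0 p : (0 <= Th p)%E by rewrite lee_fin.
have := coord_indep_integral P X hu.1 (past k) (present k) _ (gspace R d) (u k)
  (past_present_uniq k) mY Th mTh Th0.
rewrite /Th/= => ->; apply: eq_integral => w _.
apply: (noise_integral k (fun z => (Psi (x k w) z)%:E)).
  apply/measurable_EFinP; apply: (mPsi _ (gspace R d) (fun=> x k w) (fun z => z)) => i.
    exact: measurable_cst.
  exact: measurable_row_coord.
by move=> z; rewrite lee_fin.
Qed.

Variables (F A : 'rV[R]_d -> R) (tau C : R).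
Hypotheses (F0 : forall y, 0 <= F y) (A0 : forall y, 0 <= A y)
  (cF : econtinuous F) (cA : econtinuous A) (tau0 : 0 < tau) (C0 : 0 <= C).
Hypothesis tPhi : forall y, tame (fun z => F (Phi y z)).
Hypothesis hstep : forall y,
  \int[gam]_z F (Phi y z) + tau * A y <= F y + C.

Lemma comp_process_measurable (phi : 'rV[R]_d -> R) k : econtinuous phi ->
  measurable_fun setT (fun w => phi (x k w)).
Proof.
move=> cphi; apply: measurable_econtinuous_comp => // i.
exact: process_measurable.
Qed.

Lemma process_step k :
  (\int[P]_w (F (x k.+1 w))%:E + \int[P]_w (tau * A (x k w))%:E <=
   \int[P]_w (F (x k w))%:E + C%:E)%E.
Proof.
have mF j : measurable_fun setT (fun w => (F (x j w))%:E).
  by apply/measurable_EFinP; exact: comp_process_measurable.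
have mA : measurable_fun setT (fun w => (tau * A (x k w))%:E).
  apply/measurable_EFinP; apply: measurable_funM => //.
  exact: comp_process_measurable.
have tA0 y : 0 <= tau * A y by rewrite mulr_ge0// ltW.
rewrite -ge0_integralD//; last 2 first.
- by move=> w _; rewrite lee_fin.
- by move=> w _; rewrite lee_fin.
have -> : (\int[P]_w ((F (x k.+1 w))%:E + (tau * A (x k w))%:E) =
    \int[P]_w (F (Phi (x k w) (u k w)) + tau * A (x k w))%:E)%E.
  by apply: eq_integral => w _; rewrite hxS EFinD.
rewrite (process_decouple k (fun y z => F (Phi y z) + tau * A y)); last 2 first.
- move=> dT T Y Z mY mZ; apply: measurable_funD.
    by apply: measurable_econtinuous_comp => // i; exact: mPhi.
  by apply: measurable_funM => //; apply: measurable_econtinuous_comp.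
- by move=> y z; rewrite addr_ge0.
have -> : (\int[P]_w (F (x k w))%:E + C%:E = \int[P]_w (F (x k w) + C)%:E)%E.
  under [RHS]eq_integral do rewrite EFinD.
  rewrite ge0_integralD//; last by move=> w _; rewrite lee_fin.
  by rewrite integral_cst//= probability_setT mule1.
apply: ge0_le_integral_nomeas => w.
  by apply: integral_ge0 => z _; rewrite lee_fin addr_ge0.
have tt : tame (fun z => F (Phi (x k w) z) + tau * A (x k w)).
  by apply: tameD; [exact: tPhi|exact: tame_cst].
rewrite -(EgE gam (noise_law 0) _ tt) lee_fin.
rewrite EgD//; [|exact: noise_law|exact: tame_cst].
by rewrite Eg_cst; exact: hstep.
Qed.

Lemma process_sum n :
  (\int[P]_w (F (x n w))%:E + \sum_(k < n) \int[P]_w (tau * A (x k w))%:E <=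
   (F x0 + n%:R * C)%:E)%E.
Proof.
elim: n => [|n IHn].
  rewrite big_ord0 adde0 mul0r addr0; under eq_integral do rewrite hx0.
  by rewrite integral_cst//= probability_setT mule1.
rewrite big_ord_recr/= [X in (_ + X)%E]addeC addeA.
apply: (le_trans (leeD (process_step n) (lexx _))).
rewrite addeAC; apply: (le_trans (leeD IHn (lexx _))).
by rewrite -EFinD lee_fin -natr1 mulrDl mul1r addrA.
Qed.

Lemma process_bound n (K : R) : F x0 + n%:R * C <= K ->
  forall k, (k <= n)%N -> (\int[P]_w (F (x k w))%:E <= K%:E)%E.
Proof.
move=> hK k kn; apply: (@le_trans _ _ (F x0 + k%:R * C)%:E).
  apply: le_trans (process_sum k); rewrite leeDl//.
  apply: sume_ge0 => i _; apply: integral_ge0 => w _.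
  by rewrite lee_fin mulr_ge0// ltW.
by rewrite lee_fin (le_trans _ hK)// lerD2l ler_wpM2r// ler_nat.
Qed.

(** If all n + 1 means exceeded the claimed bound, their sum would exceed the telescoped total
    [K]. *)
Lemma process_min n (K : R) : F x0 + n.+1%:R * C <= K ->
  exists2 k, (k <= n)%N & (\int[P]_w (A (x k w))%:E <= (K / (tau * n.+1%:R))%:E)%E.
Proof.
move=> hK; apply: contrapT => /forall2NP H.
have tn : 0 < tau * n.+1%:R by rewrite mulr_gt0.
have big k : (k <= n)%N -> ((K / n.+1%:R)%:E < \int[P]_w (tau * A (x k w))%:E)%E.
  move=> kn; have [//|/negP] := H k; rewrite -ltNge => h.
  under eq_integral do rewrite EFinM.
  rewrite ge0_integralZl_EFin//; last 3 first.
  - by move=> w _; rewrite lee_fin.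
  - by apply/measurable_EFinP; exact: comp_process_measurable.
  - exact: ltW.
  have -> : (K / n.+1%:R)%:E = (tau%:E * (K / (tau * n.+1%:R))%:E)%E.
    have : 0 < n.+1%:R :> R by [].
    by move: (n.+1%:R : R) => N N0; rewrite -EFinM; congr (_%:E); field; rewrite !gt_eqF.
  by rewrite lte_pmul2l// lte_fin.
have := process_sum n.+1; rewrite leNgt => /negP; apply.
apply: (@le_lt_trans _ _ K%:E); first by rewrite lee_fin.
have F0' : (0 <= \int[P]_w (F (x n.+1 w))%:E)%E.
  by apply: integral_ge0 => w _; rewrite lee_fin.
apply: (@lt_le_trans _ _ (\sum_(k < n.+1) \int[P]_w (tau * A (x k w))%:E)%E); last first.
  by rewrite leeDr.
have -> : K%:E = (\sum_(k < n.+1) (K / n.+1%:R)%:E)%E.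
  by rewrite sumEFin sumr_const card_ord; congr (_%:E); rewrite -[RHS]mulr_natr divfK.
rewrite !big_ord_recl/=.
(* The integrals may be infinite a priori: the strict inequality is taken in the first summand, and
   the other constants are finite. *)
apply: lte_leD; [by rewrite sumEFin|exact: big|].
by apply: lee_sum => i _; apply: ltW; apply: big.
Qed.

End GaussianProcess.

(** * The iterates of the theorem and the constant K *)

Section DescentAlongTrajectory.
Context {R : realType} {d : nat}.
Hypothesis hd : (0 < d)%N.
Variables (f : 'rV[R]_d -> R) (R1 R2 : R) (m : nat).
Hypothesis hSPB : SPB f R1 R2 m.
Hypothesis hinf : exists lb : R, forall x, lb <= f x.
Context {dO : measure_display} {Om : measurableType dO}.
Variables (P : probability Om R) (u : nat -> Om -> 'rV[R]_d).
Hypothesis hu : iid_std_gaussian P u.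
Variables (T : nat) (s : R).
Hypotheses (s0 : 0 < s) (s1 : s <= 1).
Variables (x0 : 'rV[R]_d) (x : nat -> Om -> 'rV[R]_d).
Hypothesis hx0 : forall w, x 0%N w = x0.
Hypothesis hxS : forall k w, x k.+1 w = x k w -
  (s / Num.sqrt (T%:R + 1) / (enorm (x k w) ^+ (2 * m) + 1)) *:
    ((s^-1 * (f (x k w + s *: u k w) - f (x k w))) *: u k w).

Local Notation "a `^ b" := (powR a b).

Let c1 : R := 2 `^ (m%:R - 1).
Let sd : R := Num.sqrt d%:R.
Let M1 : R := (m%:R + 1 + d%:R) `^ ((m%:R + 1) / 2).
Let K : R := Kconst d m R1 R2 (f x0) (inf_f f) (enorm x0).
Let gam : probability (gspace R d) R := distribution P (noise P u hu 0).

(** Subtracting the infimum makes the function nonnegative, as the integral lemmas require, and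
    leaves finite differences unchanged. *)
Definition excess_val (y : 'rV[R]_d) : R := f y - inf_f f.

Definition traj_smooth (y : 'rV[R]_d) : R := smooth gam excess_val s y.
Definition traj_grad (y : 'rV[R]_d) : 'rV[R]_d := smooth_grad gam excess_val s y.

Let tau : R := s / Num.sqrt (T%:R + 1).
Let Phi (y z : 'rV[R]_d) : 'rV[R]_d :=
  y - (tau / (enorm y ^+ (2 * m) + 1)) *: zo_dir excess_val s y z.

Let gamP : std_gaussian_law gam.
Proof. exact: noise_law. Qed.

Let R10 : 0 <= R1. Proof. by case: hSPB. Qed.
Let R20 : 0 < R2. Proof. by case: hSPB. Qed.
Let c10 : 0 < c1. Proof. by rewrite powR_gt0. Qed.

Let ft0 y : 0 <= excess_val y.
Proof.
rewrite subr_ge0; apply: ge_inf; last by exists y.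
by have [lb hlb] := hinf; exists lb => _ [z _ <-].
Qed.

Let flip y z (r : R) : enorm y <= r -> enorm z <= r ->
  `|excess_val y - excess_val z| <= (R1 * r ^+ m + R2) * enorm (y - z).
Proof.
rewrite /excess_val opprB addrA subrK => yr zr.
exact: (spb_lipschitz_ball f R1 R2 m y z r hSPB).
Qed.

Lemma powR2_pred_le (a b : R) : 0 <= a -> 0 <= b ->
  R1 * (a + b) ^+ m <= R1 * (2 `^ (m%:R - 1)) * (a ^+ m + b ^+ m).
Proof.
move=> a0 b0; have [_ _ [_ H] _ _] := hSPB.
have [m0|] := posnP m; first by rewrite (H m0) !mul0r.
case: m => // n _; rewrite -[n.+1%:R]natr1 addrK powR_mulrn// -mulrA ler_wpM2l//.
exact: exprD_le_pow2.
Qed.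

Let hc1 (a b : R) : 0 <= a -> 0 <= b ->
  R1 * (a + b) ^+ m <= R1 * c1 * (a ^+ m + b ^+ m).
Proof. exact: powR2_pred_le. Qed.

(** The first line bounds the smoothed value at x0 together with the second; the last term collects
    T + 1 steps, each adding [step_excess] / (T + 1). *)
Lemma Kconst_split : K = excess_val x0
  + ((c1 * R1 * enorm x0 ^+ m + R2) * sd + c1 * R1 * M1)
  + step_excess (d := d) R1 R2 c1 m.
Proof.
have c1X p : 2 `^ ((m%:R - 1) * p%:R) = c1 ^+ p by rewrite powRrM powR_mulrn// ltW.
have c12 : 2 `^ (2 * m%:R - 2) = c1 ^+ 2.
  by rewrite -c1X; congr (_ `^ _); ring.
have c13 : 2 `^ (2 * m%:R - 3) = c1 ^+ 2 / 2.
  have -> : 2 * m%:R - 3 = (2 * m%:R - 2) - 1 :> R by ring.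
  by rewrite powRB ?pnatr_eq0//; rewrite ?c12 ?powRr1// implybT.
rewrite /K /Kconst /Mbreve /Hbreve /step_excess !c1X c12 c13 -/c1 -/sd -/M1 /excess_val.
by ring.
Qed.

Let sT0 : 0 < Num.sqrt (T%:R + 1) :> R.
Proof. by rewrite sqrtr_gt0 ltr_wpDl. Qed.

Let sT2 : Num.sqrt (T%:R + 1) ^+ 2 = T%:R + 1 :> R.
Proof. by rewrite sqr_sqrtr// addr_ge0. Qed.

Let tau0 : 0 < tau. Proof. by rewrite divr_gt0. Qed.

Let tau1 : tau <= 1.
Proof.
rewrite ler_pdivrMr// mul1r (le_trans s1)// -[leLHS]sqrtr1 ler_wsqrtr//.
by rewrite lerDr.
Qed.

(** The choice tau = s / sqrt(T+1) makes the remainders of T + 1 steps add up to a constant. *)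
Let tauN : s^-1 * tau ^+ 2 <= (T%:R + 1)^-1.
Proof.
rewrite expr_div_n sT2 mulrA expr2 mulrA mulVf ?gt_eqF// mul1r.
by rewrite ler_piMl// invr_ge0 addr_ge0.
Qed.

Let step_rec k w : x k.+1 w = Phi (x k w) (u k w).
Proof.
rewrite hxS /Phi /zo_dir /excess_val; congr (_ - _ *: (_ * _ *: _)).
by rewrite opprB addrA subrK.
Qed.

Let den0 (y : 'rV[R]_d) : 0 < enorm y ^+ (2 * m) + 1.
Proof. by rewrite ltr_wpDl// exprn_ge0. Qed.

Let cden : econtinuous (fun y : 'rV[R]_d => (enorm y ^+ (2 * m) + 1)^-1).
Proof.
apply: econtinuousV => [|z]; last by rewrite gt_eqF.
apply: econtinuousD; last exact: econtinuous_cst.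
by apply: econtinuousX; exact: econtinuous_enorm.
Qed.

Let cft : econtinuous excess_val.
Proof. exact: (f_econtinuous excess_val R1 R2 m). Qed.

Let mPhi (dT : measure_display) (T' : measurableType dT) (Y Z : T' -> 'rV[R]_d) :
  (forall i, measurable_fun setT (fun t => Y t 0 i)) ->
  (forall i, measurable_fun setT (fun t => Z t 0 i)) ->
  forall i, measurable_fun setT (fun t => Phi (Y t) (Z t) 0 i).
Proof.
move=> mY mZ i; under eq_fun do rewrite !mxE.
apply: measurable_funB => //; apply: measurable_funM.
  apply: measurable_funM => //.
  exact: (measurable_econtinuous_comp _ _ _ _ mY cden).
apply: measurable_funM => //; apply: measurable_funM => //; apply: measurable_funB.
  apply: (measurable_econtinuous_comp _ _ (fun t => Y t + s *: Z t)) => // j.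
  under eq_fun do rewrite !mxE.
  by apply: measurable_funD => //; apply: measurable_funM.
exact: measurable_econtinuous_comp.
Qed.

Let A (y : 'rV[R]_d) : R := enorm (traj_grad y) ^+ 2 / (enorm y ^+ (2 * m) + 1).

Let cA : econtinuous A.
Proof.
apply: econtinuousM => //; apply: econtinuousX.
apply: econtinuous_vcomp; first exact: econtinuous_enorm.
by move=> i; apply: (smooth_grad_econtinuous gam gamP excess_val R1 R2 s m).
Qed.

Let A0 y : 0 <= A y.
Proof. by rewrite divr_ge0 ?sqr_ge0// ltW. Qed.

Let cF : econtinuous traj_smooth.
Proof. exact: (smooth_econtinuous gam gamP excess_val R1 R2 s m). Qed.

Lemma traj_smooth_ge0 y : 0 <= traj_smooth y.
Proof. exact: smooth_ge0. Qed.

Let C : R := (T%:R + 1)^-1 * step_excess (d := d) R1 R2 c1 m.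

Let C0 : 0 <= C.
Proof.
apply: mulr_ge0; first by rewrite invr_ge0 addr_ge0.
by apply: step_excess_ge0 => //; exact: ltW.
Qed.

Let tPhi y : tame (fun z => traj_smooth (Phi y z)).
Proof.
exact: (tame_smooth_step gam gamP excess_val R1 R2 s c1 m R10 s0 s1 (ltW c10) ft0 flip hc1).
Qed.

Let hstep y : \int[gam]_z traj_smooth (Phi y z) + tau * A y <= traj_smooth y + C.
Proof.
exact: (smooth_step gam gamP hd excess_val R1 R2 s c1 m R10 (ltW R20) s0 s1 (ltW c10)
  ft0 flip hc1 y tau _ (ltW tau0) tau1 tauN).
Qed.

Let hK : traj_smooth x0 + T.+1%:R * C <= K.
Proof.
rewrite Kconst_split /C -natr1 mulrA divff ?mul1r; last by rewrite gt_eqF// ltr_wpDl.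
rewrite lerD2r.
exact: (smooth_le gam gamP hd excess_val R1 R2 s c1 m R10 (ltW R20) s0 s1 (ltW c10)).
Qed.

Lemma trajectory_smooth_bound k : (k <= T.+1)%N ->
  (\int[P]_w (traj_smooth (x k w))%:E <= K%:E)%E.
Proof.
by move=> kT; apply: (process_bound P u hu x x0 Phi hx0 step_rec mPhi traj_smooth A tau C
  traj_smooth_ge0 A0 cF cA tau0 C0 tPhi hstep T.+1 K hK).
Qed.

Lemma trajectory_grad_min : exists2 k, (k <= T)%N &
  (\int[P]_w (enorm (traj_grad (x k w)) ^+ 2 / (enorm (x k w) ^+ (2 * m) + 1))%:E
    <= (K / (s * Num.sqrt (T%:R + 1)))%:E)%E.
Proof.
have [k kT hk] := process_min P u hu x x0 Phi hx0 step_rec mPhi traj_smooth A tau C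
  traj_smooth_ge0 A0 cF cA tau0 C0 tPhi hstep T K hK.
exists k => //; apply: (le_trans hk); rewrite lee_fin.
have -> : tau * T.+1%:R = s * Num.sqrt (T%:R + 1).
  have -> : T.+1%:R = Num.sqrt (T%:R + 1) ^+ 2 :> R by rewrite sT2 natr1.
  by rewrite /tau expr2 mulrA divfK ?gt_eqF.
by [].
Qed.

Lemma trajectory_coord_measurable k i : measurable_fun setT (fun w => x k w 0 i).
Proof. exact: (process_measurable P u hu x x0 Phi hx0 step_rec mPhi). Qed.

Lemma trajectory_comp_measurable (phi : 'rV[R]_d -> R) k : econtinuous phi ->
  measurable_fun setT (fun w => phi (x k w)).
Proof.
move=> cphi; apply: measurable_econtinuous_comp => // i.
exact: trajectory_coord_measurable.
Qed.

Lemma trajectory_gap_econtinuous : econtinuous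
  (fun y => enorm (traj_grad y) ^+ 2 / (enorm y ^+ (2 * m) + 1)).
Proof. exact: cA. Qed.

Lemma traj_smooth_econtinuous : econtinuous traj_smooth.
Proof. exact: cF. Qed.

Lemma Kconst_gt0 : 0 < K.
Proof.
rewrite Kconst_split.
have sd0 : 0 < sd by rewrite sqrtr_gt0 ltr0n.
have M10 : 0 <= M1 by exact: powR_ge0.
have e0 : 0 <= step_excess (d := d) R1 R2 c1 m.
  by apply: step_excess_ge0 => //; exact: ltW.
have R20' := R20; have c1' := ltW c10.
have h1 : 0 <= c1 * R1 * enorm x0 ^+ m by rewrite !mulr_ge0// exprn_ge0.
have h2 : 0 < (c1 * R1 * enorm x0 ^+ m + R2) * sd by rewrite mulr_gt0// ltr_wpDl.
have h3 : 0 <= c1 * R1 * M1 by rewrite !mulr_ge0.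
have := ft0 x0; lra.
Qed.

Lemma goldstein_traj (delta : R) y : 0 < delta ->
  setdist 0 (goldstein_subdiff f delta y) <= enorm (traj_grad y)
    + (R1 * (c1 + 1) * enorm y ^+ m + 2 * R2) * (s / (3 / 4 * delta)) ^+ d
      * (d%:R + d%:R) `^ (d%:R / 2)
    + 2 * R1 * c1 * s ^+ m * (m%:R + d%:R) `^ (m%:R / 2).
Proof.
move=> de0; set D := setdist _ _.
have sp := hSPB; have R2' := ltW R20; have c1' := ltW c10.
have : 0 <= D by exact: setdist_ge0.
rewrite le_eqVlt => /orP[/eqP <-|D0].
  have s' : 0 <= s / (3 / 4 * delta) by rewrite divr_ge0 ?ltW// !mulr_gt0.
  have h1 : 0 <= R1 * (c1 + 1) * enorm y ^+ m + 2 * R2.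
    by rewrite addr_ge0 ?mulr_ge0 ?addr_ge0 ?exprn_ge0.
  have h2 : 0 <= 2 * R1 * c1 * s ^+ m by rewrite !mulr_ge0 ?exprn_ge0 ?(ltW s0).
  apply: addr_ge0; last by apply: mulr_ge0 => //; exact: powR_ge0.
  apply: addr_ge0 => //; apply: mulr_ge0; last exact: powR_ge0.
  by apply: mulr_ge0 => //; exact: exprn_ge0.
apply: (goldstein_le_grad gam gamP hd excess_val R1 R2 s c1 m) => //.
  exact: (spb_goldstein_dist f R1 R2 m delta y sp (ltW de0)).
move=> eta eta0.
have [v v1 Hv] := goldstein_descent f R1 R2 m delta y sp (ltW de0) D0 eta eta0.
exists v => // z t t0 h1 h2; have := Hv z t t0 h1 h2.
by rewrite /excess_val opprB addrA subrK.
Qed.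

(** For each noise value z, |y| <= D + |z| + r, with D the distance from y + s z to the minimizers
    and r^2 the supremum of their squared norms. Quadratic growth bounds D^2, and averaging over z
    gives the terms in F and d. *)
Lemma quadratic_growth_traj (mu : R) y : 0 < mu ->
  argmin_set f !=set0 ->
  (exists B : R, forall w, argmin_set f w -> enorm w <= B) ->
  (forall y, f y - inf_f f >= mu / 2 * setdist y (argmin_set f) ^+ 2) ->
  enorm y ^+ 2 <= 8 * mu^-1 * traj_smooth y + 4 * d%:R
             + 2 * sup [set enorm w ^+ 2 | w in argmin_set f].
Proof.
move=> mu0 [w0 Sw0] [B HB] qg; set S := argmin_set f.
set Sup := sup _.
have Sup_ub w : S w -> enorm w ^+ 2 <= Sup.
  move=> Sw; apply: ub_le_sup; last by exists w.
  exists (B ^+ 2) => _ [w' Sw' <-].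
  by rewrite lerXn2r ?nnegrE ?HB// (le_trans _ (HB _ Sw')).
have Sup0 : 0 <= Sup by rewrite (le_trans _ (Sup_ub w0 Sw0))// sqr_ge0.
set r := Num.sqrt Sup; have r0 : 0 <= r by exact: sqrtr_ge0.
have r2 : r ^+ 2 = Sup by rewrite sqr_sqrtr.
have mi0 : 0 <= 8 * mu^-1 by rewrite mulr_ge0// invr_ge0 ltW.
apply: (norm_sq_le_smooth gam gamP excess_val R1 R2 s m) => // z.
pose D := setdist (y + s *: z) S.
have D0 : 0 <= D by exact: setdist_ge0.
have hD : enorm y - enorm z - r <= D.
  apply: lb_le_inf => [|_ [w Sw <-]]; first by exists (enorm (y + s *: z - w0)), w0.
  have wr : enorm w <= r.
    rewrite -[leLHS]ger0_norm// -sqrtr_sqr ler_wsqrtr//; exact: Sup_ub.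
  have sz : enorm (s *: z) <= enorm z by rewrite enormZ (gtr0_norm s0) ler_piMl.
  have h1 := enormD (y + s *: z - w) (w - s *: z).
  have h2 := enormB w (s *: z).
  move: h1; rewrite addrA subrK addrK; lra.
have fD : 4 * D ^+ 2 <= 8 * mu^-1 * excess_val (y + s *: z).
  have := qg (y + s *: z); rewrite -/(excess_val _) -/D => h.
  have -> : 4 * D ^+ 2 = 8 * mu^-1 * (mu / 2 * D ^+ 2) by field; rewrite gt_eqF.
  exact: ler_wpM2l.
have z0 := enorm_ge0 z; have y0 := enorm_ge0 y.
have h3 : enorm y ^+ 2 <= (D + enorm z + r) ^+ 2.
  rewrite lerXn2r ?nnegrE ?addr_ge0//; lra.
(* (a + b)^2 <= 2 a^2 + 2 b^2, used for (D + |z|) + r and again for D + |z|. *)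
have h4 : (D + enorm z + r) ^+ 2 <= 4 * D ^+ 2 + 4 * enorm z ^+ 2 + 2 * r ^+ 2.
  have := sqr_ge0 (D + enorm z - r); have := sqr_ge0 (D - enorm z).
  rewrite !expr2; lra.
move: h4; rewrite r2; lra.
Qed.

End DescentAlongTrajectory.

(** * Rates *)

Section Rates.
Context {R : realType}.
Local Notation "a `^ b" := (powR a b).

(** The concave power lies below its tangent at 1; for r < 1 this is Young's inequality with
    exponents 1/r and 1/(1-r). *)
Lemma powR_bernoulli (t r : R) : 0 <= t -> 0 < r <= 1 -> t `^ r <= 1 - r + r * t.
Proof.
move=> t0 /andP[r0]; rewrite le_eqVlt => /orP[/eqP ->|r1].
  by rewrite powRr1// subrr add0r mul1r.
have q0 : 0 < 1 - r by lra.
have := @conjugate_powR R (t `^ r) 1 r^-1 (1 - r)^-1 (powR_ge0 _ _) ler01.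
rewrite !invr_gt0 !invrK => /(_ r0 q0); rewrite addrC subrK => /(_ erefl).
rewrite mulr1 -powRrM divff ?gt_eqF// powRr1// powR1; lra.
Qed.

(** Reason for the exponent 1/c with c = 2 ceil(m/2) >= m: it reduces the factor |x|^m + 1 to |x| +
    1, whose square has a controlled mean. *)
Lemma pow_add1_le (a : R) (m c : nat) : 0 <= a -> (0 < m)%N -> (m <= c)%N ->
  (a ^+ m + 1) `^ (c%:R^-1) <= a + 1.
Proof.
move=> a0 m0 mc; have c0 : (0 < c)%N by exact: leq_trans mc.
have a1 : 1 <= a + 1 by rewrite lerDr.
have h n : a ^+ n.+1 + 1 <= (a + 1) ^+ n.+1.
  elim: n => [|n IH]; first by rewrite !expr1.
  rewrite [leRHS]exprS; apply: le_trans (ler_wpM2l _ IH); last lra.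
  rewrite mulrDr mulr1 mulrDl mul1r -exprS; have : 0 <= a ^+ n.+1 by rewrite exprn_ge0.
  lra.
have h1 : a ^+ m + 1 <= (a + 1) ^+ c.
  apply: (@le_trans _ _ ((a + 1) ^+ m)); last exact: ler_weXn2l.
  by have := h m.-1; rewrite prednK.
have ac0 : 0 <= a ^+ m + 1 by rewrite addr_ge0// exprn_ge0.
have cV : 0 <= c%:R^-1 :> R by rewrite invr_ge0.
have := ge0_ler_powR cV _ _ h1; rewrite !nnegrE => /(_ ac0 (exprn_ge0 _ (le_trans ler01 a1))).
rewrite -[X in _ <= X `^ _](powR_mulrn c) ?(le_trans ler01 a1)// -powRrM divff ?pnatr_eq0 -?lt0n//.
by rewrite powRr1// (le_trans ler01 a1).
Qed.

(* The Hoelder and Jensen steps of the averaged bound, linearized at the (squared) means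
   [lam ^ 2] of [A] and [k ^ 2] of [e ^ 2], so that only linear integrals are needed. *)
Lemma holder_linearized (p lam th k : R) : 0 < p -> p <= 2^-1 -> 0 < lam -> 0 < th -> 0 < k ->
  exists c0 cA cX : R, [/\ 0 <= c0, 0 <= cA, 0 <= cX,
    c0 + cA * lam ^+ 2 + cX * k ^+ 2 <= (1 + k) * (2 * lam + 2 * th) `^ p &
    forall A e g D : R, 0 <= A -> 0 <= e -> 0 <= g -> 0 <= D ->
      D <= (Num.sqrt A + th) * g -> g `^ p <= e + 1 ->
      D `^ p <= c0 + cA * A + cX * e ^+ 2].
Proof.
move=> p0 p2 l0 th0 k0.
set Z := 2 * lam + 2 * th; have Z0 : 0 < Z by rewrite /Z; lra.
set zp := Z `^ p; have zp0 : 0 < zp by exact: powR_gt0.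
set B := 1 + k; have B0 : 0 < B by rewrite /B; lra.
(* Weights of the arithmetic-geometric inequality for the product of (sqrt A + th)^p and e + 1,
   balanced at the values [zp] and [B]. At the means the two contributions are at most [h1] each,
   and 2 h1 = B zp. *)
pose h1 : R := 2^-1 * B * zp; pose h2 : R := 2^-1 * zp / B.
have h10 : 0 < h1 by rewrite !mulr_gt0.
have h20 : 0 < h2 by rewrite divr_gt0// mulr_gt0.
have pZ0 : 0 < 2 * p / Z by rewrite divr_gt0// mulr_gt0.
exists (h1 * (1 - 2 * p + 2 * p / Z * (lam / 2 + th)) + h2 * (k + 1)).
exists (h1 * (2 * p / Z / (2 * lam))), (h2 * (1 + k^-1)).
have q1 : 0 <= 1 - 2 * p by lra.
split.
- apply: addr_ge0; apply: mulr_ge0; rewrite ?(ltW h10) ?(ltW h20)//; last lra.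
  by rewrite addr_ge0// mulr_ge0 ?(ltW pZ0)//; lra.
- by rewrite mulr_ge0 ?(ltW h10)// divr_ge0 ?(ltW pZ0)// mulr_ge0// ltW.
- by rewrite mulr_ge0 ?(ltW h20)// addr_ge0// invr_ge0 ltW.
- have -> : h1 * (1 - 2 * p + 2 * p / Z * (lam / 2 + th)) + h2 * (k + 1)
      + h1 * (2 * p / Z / (2 * lam)) * lam ^+ 2 + h2 * (1 + k^-1) * k ^+ 2
      = h1 * (1 - 2 * p + p * ((2 * lam + 2 * th) / Z)) + h2 * (1 + k) ^+ 2.
    by field; rewrite !gt_eqF.
  rewrite -/Z divff ?gt_eqF// mulr1.
  have -> : h2 * (1 + k) ^+ 2 = h1 by rewrite /h2 /h1 -/B; field; rewrite gt_eqF.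
  have : h1 * (1 - 2 * p + p) <= h1 * 1 by rewrite ler_pM2l//; lra.
  have -> : B * zp = h1 + h1 by rewrite /h1; field.
  lra.
move=> A e g D A0 e0 g0 D0 hD hg.
set a := Num.sqrt A + th; have a0 : 0 <= a by rewrite addr_ge0 ?sqrtr_ge0// ltW.
set ap := a `^ p; have ap0 : 0 <= ap by exact: powR_ge0.
have s1 : D `^ p <= ap * (e + 1).
  have := ge0_ler_powR (ltW p0) _ _ hD; rewrite !nnegrE => /(_ D0 (mulr_ge0 a0 g0)) h.
  by rewrite (le_trans h)// powRM// ler_wpM2l.
have s2 : ap * (e + 1) <= 2^-1 * B / zp * ap ^+ 2 + h2 * (e + 1) ^+ 2.
  have Bz : 0 < 2 * B * zp by rewrite !mulr_gt0.
  rewrite -(ler_pM2l Bz).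
  have -> : 2 * B * zp * (2^-1 * B / zp * ap ^+ 2 + h2 * (e + 1) ^+ 2) =
      B ^+ 2 * ap ^+ 2 + zp ^+ 2 * (e + 1) ^+ 2.
    by rewrite /h2; field; rewrite !gt_eqF.
  have := sqr_ge0 (ap * B - (e + 1) * zp); rewrite !expr2; lra.
(* The square has exponent 2p <= 1, so the tangent inequality applies. *)
have s3 : ap ^+ 2 <= zp ^+ 2 * (1 - 2 * p + 2 * p * (a / Z)).
  have aZ : 0 <= a / Z by rewrite divr_ge0// ltW.
  have p20 : 0 < 2 * p <= 1 by apply/andP; split; lra.
  have := powR_bernoulli (a / Z) (2 * p) aZ p20.
  have zp2 : zp ^+ 2 = Z `^ (2 * p) by rewrite mulrC powRrM powR_mulrn// ltW.
  have ap2 : ap ^+ 2 = a `^ (2 * p) by rewrite mulrC powRrM powR_mulrn.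
  move=> h; rewrite zp2 ap2 -[X in X `^ _](divfK (lt0r_neq0 Z0) a) powRM// ?(ltW Z0)//.
  by rewrite mulrC ler_wpM2l ?powR_ge0.
have s4 : Num.sqrt A <= (A / lam + lam) / 2.
  rewrite -(ler_pM2l l0).
  have -> : lam * ((A / lam + lam) / 2) = (A + lam ^+ 2) / 2 by field; rewrite gt_eqF.
  have := sqr_ge0 (Num.sqrt A - lam); have := sqr_sqrtr A0; rewrite !expr2; lra.
have s5 : (e + 1) ^+ 2 <= e ^+ 2 * (1 + k^-1) + (k + 1).
  have : 2 * e <= e ^+ 2 / k + k.
    rewrite -(ler_pM2l k0).
    have -> : k * (e ^+ 2 / k + k) = e ^+ 2 + k ^+ 2 by field; rewrite gt_eqF.
    have := sqr_ge0 (e - k); rewrite !expr2; lra.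
  rewrite !expr2; lra.
have s6 : 2^-1 * B / zp * ap ^+ 2 <= h1 * (1 - 2 * p + 2 * p / Z * ((A / lam + lam) / 2 + th)).
  have Bz0 : 0 <= 2^-1 * B / zp by rewrite divr_ge0 ?mulr_ge0 ?(ltW B0) ?(ltW zp0).
  apply: (le_trans (ler_wpM2l Bz0 s3)).
  have -> : 2^-1 * B / zp * (zp ^+ 2 * (1 - 2 * p + 2 * p * (a / Z))) =
      h1 * (1 - 2 * p + 2 * p / Z * a) by rewrite /h1; field; rewrite !gt_eqF.
  rewrite ler_pM2l// lerD2l ler_pM2l// /a lerD2r//.
have s7 := ler_wpM2l (ltW h20) s5.
apply: (le_trans s1); apply: (le_trans s2); apply: (le_trans (lerD s6 s7)).
rewrite le_eqVlt; apply/orP; left; apply/eqP.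
by field; rewrite !gt_eqF.
Qed.

Variables (T q : nat).
Hypotheses (hT : (0 < T)%N) (hq : (0 < q)%N).

(** Smoothing radius divided by kappa. Its q-th power is the rate of the theorem, and
    [rate_eps_sqrt] is the balance of the two errors. *)
Definition rate_eps : R := T%:R `^ (- ((4 * q + 2)%:R)^-1).

Let T0 : 0 < T%:R :> R. Proof. by rewrite ltr0n. Qed.
Let q0 : 0 < q%:R :> R. Proof. by rewrite ltr0n. Qed.

Lemma rate_eps_gt0 : 0 < rate_eps. Proof. exact: powR_gt0. Qed.

Lemma rate_eps_le1 : rate_eps <= 1.
Proof.
rewrite /rate_eps powRN invf_le1 ?powR_gt0//.
rewrite -[leLHS](powRr0 T%:R) ler_powR ?ler1n// invr_ge0//.
Qed.

Lemma rate_theta : rate_eps ^+ q = T%:R `^ (- (4^-1 - ((8 * q + 4)%:R)^-1)).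
Proof.
rewrite -powR_mulrn ?(ltW rate_eps_gt0)// /rate_eps -powRrM; congr (_ `^ _).
have E4 : (4 * q + 2)%:R = 4 * q%:R + 2 :> R by rewrite natrD natrM.
have E8 : (8 * q + 4)%:R = 8 * q%:R + 4 :> R by rewrite natrD natrM.
rewrite E4 E8; field.
have := q0; move: (q%:R : R) => z z0; rewrite !gt_eqF//; lra.
Qed.

Lemma rate_eps_sqrt : rate_eps ^+ (2 * q + 1) = (Num.sqrt T%:R)^-1.
Proof.
rewrite -powR_mulrn ?(ltW rate_eps_gt0)// /rate_eps -powRrM -powR12_sqrt ?(ltW T0)// -powRN.
congr (_ `^ _).
have E4 : (4 * q + 2)%:R = 4 * q%:R + 2 :> R by rewrite natrD natrM.
have E2 : (2 * q + 1)%:R = 2 * q%:R + 1 :> R by rewrite natrD natrM.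
rewrite E4 E2; field.
have := q0; move: (q%:R : R) => z z0; rewrite !gt_eqF//; lra.
Qed.

(** Purpose of the lower bound on T: it makes the smoothing radius at most 1. *)
Lemma rate_sigma_le1 (kappa b : R) : 0 < kappa ->
  Num.max b kappa ^+ (4 * q + 2) + 1 <= T%:R -> kappa * rate_eps <= 1.
Proof.
move=> k0 hTN; have n0 : (0 < 4 * q + 2)%N by rewrite addn2.
have kT : kappa ^+ (4 * q + 2) <= T%:R.
  have h1 : kappa ^+ (4 * q + 2) <= Num.max b kappa ^+ (4 * q + 2).
    have kb : kappa <= Num.max b kappa by rewrite le_max lexx orbT.
    by rewrite lerXn2r ?nnegrE ?(ltW k0)// (le_trans (ltW k0) kb).
  by rewrite (le_trans h1)// (le_trans _ hTN)// lerDl.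
rewrite /rate_eps powRN ler_pdivrMr ?powR_gt0// mul1r.
have nV : 0 <= ((4 * q + 2)%:R)^-1 :> R by rewrite invr_ge0.
have := ge0_ler_powR nV _ _ kT; rewrite !nnegrE => /(_ (exprn_ge0 _ (ltW k0)) (ltW T0)).
rewrite -[X in X `^ _ <= _](powR_mulrn _ (ltW k0)) -powRrM divff ?pnatr_eq0 -?lt0n//.
by rewrite powRr1// ltW.
Qed.

Lemma rate_grad (K kappa : R) : 0 < K -> 0 < kappa ->
  K / (kappa * rate_eps * Num.sqrt (T%:R + 1)) <=
  (Num.sqrt K * kappa `^ (- 2^-1) * rate_eps ^+ q) ^+ 2.
Proof.
move=> K0 k0; have e0 := rate_eps_gt0.
have st0 : 0 < Num.sqrt (T%:R + 1) :> R by rewrite sqrtr_gt0 ltr_wpDl.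
have sT0 : 0 < Num.sqrt T%:R :> R by rewrite sqrtr_gt0.
have kk : (kappa `^ (- 2^-1)) ^+ 2 = kappa^-1.
  by rewrite powRN exprVn powR12_sqrt ?(ltW k0)// sqr_sqrtr// ltW.
rewrite !exprMn kk sqr_sqrtr ?(ltW K0)// ler_pdivrMr ?mulr_gt0//.
have -> : K * kappa^-1 * (rate_eps ^+ q) ^+ 2 * (kappa * rate_eps * Num.sqrt (T%:R + 1)) =
    K * (rate_eps ^+ (2 * q + 1) * Num.sqrt (T%:R + 1)).
  by rewrite exprD expr1 mulnC exprM; field; rewrite gt_eqF.
rewrite ler_peMr ?(ltW K0)// rate_eps_sqrt ler_pdivlMl// mulr1.
by rewrite ler_wsqrtr// lerDl.
Qed.

End Rates.

(** * The constants kappa and the size of the smoothing error *)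

Section GoldsteinRate.
Context {R : realType} (d m : nat) (R1 R2 delta : R).
Hypotheses (hd : (0 < d)%N) (R10 : 0 <= R1) (R20 : 0 < R2) (de0 : 0 < delta).
Local Notation "a `^ b" := (powR a b).
Let Pc : R := Pcal d m R1 R2.
Let Q : R := 2 ^+ m.+1 * R1 * (m%:R + d%:R) `^ (m%:R / 2).

Let Q0 : 0 <= Q. Proof. by rewrite mulr_ge0 ?powR_ge0// mulr_ge0// exprn_ge0. Qed.

Lemma Pcal_gt0 : 0 < Pc.
Proof. by rewrite /Pc /Pcal -/Q ltr_pwDl// mulr_gt0. Qed.

Let spe0 : 0 < Num.sqrt (d%:R * pi * expR 1) :> R.
Proof. by rewrite sqrtr_gt0 !mulr_gt0 ?ltr0n ?pi_gt0 ?expR_gt0. Qed.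

Lemma kappa2_gt0 : 0 < kappa2 d m R1 R2 delta.
Proof. by rewrite divr_gt0// mulr_gt0// powR_gt0//; exact: Pcal_gt0. Qed.

(** The power P^(-1/d) in kappa2 becomes 1/P, and its denominator sqrt(d pi e) absorbs (4/3)
    sqrt(2d), from the radius 3 delta / 4 and the moment of order d, because 32/9 <= 4 <= pi e. *)
Lemma far_mass_rate (s eps : R) : 0 <= s -> 0 <= eps -> s <= kappa2 d m R1 R2 delta * eps ->
  (s / (3 / 4 * delta)) ^+ d * (d%:R + d%:R) `^ (d%:R / 2) <= eps ^+ d / Pc.
Proof.
move=> s0 eps0 hs; have P0 := Pcal_gt0.
have d0 : 0 < d%:R :> R by rewrite ltr0n.
have dd0 : 0 <= d%:R + d%:R :> R by rewrite addr_ge0.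
set pd : R := Pc `^ (- d%:R^-1); have pd0 : 0 < pd by exact: powR_gt0.
have pdd : pd ^+ d = Pc^-1.
  rewrite -powR_mulrn ?(ltW pd0)// -powRrM mulNr mulVf ?gt_eqF// powRN powRr1//.
  exact: ltW.
have -> : (d%:R + d%:R) `^ (d%:R / 2) = Num.sqrt (d%:R + d%:R) ^+ d :> R.
  by rewrite mulrC powRrM powR12_sqrt// powR_mulrn// sqrtr_ge0.
rewrite -pdd -!exprMn lerXn2r ?nnegrE ?mulr_ge0 ?sqrtr_ge0 ?(ltW pd0)//.
  by rewrite invr_ge0 !mulr_ge0// ltW.
have sq : 4 / 3 * Num.sqrt (d%:R + d%:R) <= Num.sqrt (d%:R * pi * expR 1) :> R.
  rewrite -[4 / 3]ger0_norm ?divr_ge0// -sqrtr_sqr -sqrtrM ?sqr_ge0// ler_wsqrtr//.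
  have p2 := pi_ge2 R; have e2 := expR_ge1Dx (1 : R).
  have pe : 2 * 2 <= pi * expR 1 :> R by apply: ler_pM => //; lra.
  have : d%:R * (2 * 2) <= d%:R * (pi * expR 1) :> R by rewrite ler_pM2l.
  rewrite !expr2 -[d%:R * pi * _]mulrA; lra.
have k34 : 0 < 3 / 4 * delta by rewrite !mulr_gt0.
apply: (@le_trans _ _ (kappa2 d m R1 R2 delta * eps / (3 / 4 * delta) * Num.sqrt (d%:R + d%:R))).
  by rewrite ler_wpM2r ?sqrtr_ge0// ler_wpM2r// invr_ge0 ltW.
have spe := spe0; rewrite /kappa2 -/Pc -/pd.
set W := Num.sqrt (d%:R * _ * _) in sq spe *.
have -> : delta * pd / W * eps / (3 / 4 * delta) * Num.sqrt (d%:R + d%:R) =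
    eps * pd * (4 / 3 * Num.sqrt (d%:R + d%:R) / W).
  by field; rewrite !gt_eqF.
by rewrite ler_piMr ?mulr_ge0 ?(ltW pd0)// ler_pdivrMr// mul1r.
Qed.

Lemma goldstein_error_rate0 (s eps : R) : 0 <= s -> 0 <= eps ->
  s <= kappa2 d m R1 R2 delta * eps ->
  2 * R2 * ((s / (3 / 4 * delta)) ^+ d * (d%:R + d%:R) `^ (d%:R / 2)) <= eps ^+ d.
Proof.
move=> s0 e0 hs; have h := far_mass_rate s eps s0 e0 hs.
have P0 := Pcal_gt0; have R22 : 0 <= 2 * R2 by rewrite mulr_ge0// ltW.
apply: (le_trans (ler_wpM2l R22 h)); rewrite mulrCA ler_piMr ?exprn_ge0//.
rewrite ler_pdivrMr// mul1r /Pc /Pcal -/Q; have := Q0; have := R20; lra.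
Qed.

Lemma kappa1_gt0 : (0 < m)%N -> 0 < R1 -> 0 < kappa1 d m R1 R2 delta.
Proof.
move=> m0 R1p; rewrite lt_min kappa2_gt0 andbT powR_gt0//.
have md : 0 < m%:R + d%:R :> R by rewrite ltr_wpDr// ltr0n.
by apply: mulr_gt0; [rewrite mulr_gt0// exprn_gt0|exact: powR_gt0].
Qed.

(** Each error term takes one half: the kappa2 part of the minimum handles the far region, whose
    coefficient is at most P (y + 1) / 2, and the part Q^(-1/m) gives s^m <= eps^m / Q. As eps <= 1,
    both powers are at most eps^min(m,d). *)
Lemma goldstein_error_rate (s eps y : R) : (0 < m)%N -> 0 < R1 -> 0 <= s ->
  0 <= eps -> eps <= 1 -> s <= kappa1 d m R1 R2 delta * eps -> 0 <= y ->
  (R1 * (2 `^ (m%:R - 1) + 1) * y + 2 * R2) * (s / (3 / 4 * delta)) ^+ d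
      * (d%:R + d%:R) `^ (d%:R / 2)
    + 2 * R1 * 2 `^ (m%:R - 1) * s ^+ m * (m%:R + d%:R) `^ (m%:R / 2)
  <= eps ^+ minn m d * (y + 1).
Proof.
move=> m0 R1p s0 e0 e1 hs y0.
have P0 := Pcal_gt0.
have m0' : 0 < m%:R :> R by rewrite ltr0n.
have hs2 : s <= kappa2 d m R1 R2 delta * eps.
  by rewrite (le_trans hs)// ler_wpM2r// ge_min lexx orbT.
have h1 := far_mass_rate s eps s0 e0 hs2.
set c1 : R := 2 `^ (m%:R - 1).
have c1E : c1 = 2 ^+ m.-1.
  by rewrite /c1 -{1}(prednK m0) -[m.-1.+1%:R]natr1 addrK powR_mulrn.
have c1X : 2 ^+ m.+1 = 4 * c1 :> R.
  by rewrite c1E -{1}(prednK m0) !exprS; ring.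
have c11 : 1 <= c1 by rewrite c1E exprn_ege1// ler1n.
set Em : R := (m%:R + d%:R) `^ (m%:R / 2).
have Em1 : 1 <= Em.
  rewrite -(powRr0 (m%:R + d%:R)); apply: ler_powR; last by rewrite divr_ge0.
  by rewrite -natrD ler1n addn_gt0 m0.
have QE : Q = 4 * c1 * R1 * Em by rewrite /Q c1X.
have Qp : 0 < Q by rewrite QE !mulr_gt0//; lra.
have c1R : 0 <= c1 * R1 by rewrite mulr_ge0//; lra.
have cR : 4 * (c1 * R1) <= Q.
  have : c1 * R1 * 1 <= c1 * R1 * Em by rewrite ler_wpM2l.
  rewrite QE; lra.
have k1 : R1 * (c1 + 1) * y + 2 * R2 <= Pc / 2 * (y + 1).
  have hR : R1 * (c1 + 1) <= Q / 2.
    have : R1 * 1 <= R1 * c1 by rewrite ler_wpM2l.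
    lra.
  have hy : R1 * (c1 + 1) * y <= Q / 2 * y by rewrite ler_wpM2r.
  have r2y : 0 <= R2 * y by rewrite mulr_ge0// ltW.
  rewrite /Pc /Pcal -/Q; lra.
have sm : s ^+ m <= eps ^+ m / Q.
  have hs1 : s <= Q `^ (- m%:R^-1) * eps.
    by rewrite (le_trans hs)// ler_wpM2r// ge_min lexx.
  have k0 : 0 <= Q `^ (- m%:R^-1) by exact: powR_ge0.
  apply: (le_trans (lerXn2r m _ _ hs1)); rewrite ?nnegrE ?mulr_ge0//.
  rewrite exprMn -(powR_mulrn m k0) -powRrM mulNr mulVf ?gt_eqF// powRN powRr1 ?(ltW Qp)//.
  by rewrite mulrC.
have ed : eps ^+ d <= eps ^+ minn m d by apply: ler_wiXn2l => //; exact: geq_minr.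
have emm : eps ^+ m <= eps ^+ minn m d by apply: ler_wiXn2l => //; exact: geq_minl.
set th := eps ^+ minn m d in ed emm *.
have t1 : (R1 * (c1 + 1) * y + 2 * R2) * (s / (3 / 4 * delta)) ^+ d
      * (d%:R + d%:R) `^ (d%:R / 2) <= 2^-1 * (th * (y + 1)).
  rewrite -mulrA.
  apply: (@le_trans _ _ (Pc / 2 * (y + 1) * (eps ^+ d / Pc))).
    apply: ler_pM => //.
    - have : 0 <= R1 * (c1 + 1) * y by apply: mulr_ge0 => //; apply: mulr_ge0 => //; lra.
      have := R20; lra.
    - have k34 : 0 <= 3 / 4 * delta by rewrite mulr_ge0 ?(ltW de0).
      by rewrite mulr_ge0 ?powR_ge0// exprn_ge0// divr_ge0.
  have -> : Pc / 2 * (y + 1) * (eps ^+ d / Pc) = 2^-1 * (eps ^+ d * (y + 1)).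
    by field; rewrite gt_eqF.
  by rewrite ler_wpM2l// ler_wpM2r// addr_ge0.
have t2 : 2 * R1 * c1 * s ^+ m * Em <= 2^-1 * (th * 1).
  have -> : 2 * R1 * c1 * s ^+ m * Em = 2^-1 * (Q * s ^+ m) by rewrite QE; field.
  rewrite mulr1 ler_wpM2l// mulrC -ler_pdivlMr//.
  by rewrite (le_trans sm)// ler_wpM2r// invr_ge0 ltW.
have th0 : 0 <= th by rewrite exprn_ge0.
have : th * 1 <= th * (y + 1) by rewrite ler_wpM2l// lerDr.
lra.
Qed.

End GoldsteinRate.

(** * Final averaging *)

Lemma integral_affine_le {dO : measure_display} {Om : measurableType dO} {R : realType}
  (P : probability Om R) (A X : Om -> R) (c0 cA cX a b : R) :
  measurable_fun setT A -> measurable_fun setT X ->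
  (forall w, 0 <= A w) -> (forall w, 0 <= X w) ->
  0 <= c0 -> 0 <= cA -> 0 <= cX ->
  (\int[P]_w (A w)%:E <= a%:E)%E -> (\int[P]_w (X w)%:E <= b%:E)%E ->
  (\int[P]_w (c0 + cA * A w + cX * X w)%:E <= (c0 + cA * a + cX * b)%:E)%E.
Proof.
move=> mA mX A0 X0 c00 cA0 cX0 hA hX.
have mcA : measurable_fun setT (fun w => (cA * A w)%:E).
  by apply/measurable_EFinP; exact: measurable_funM.
have mcX : measurable_fun setT (fun w => (cX * X w)%:E).
  by apply/measurable_EFinP; exact: measurable_funM.
have mc : measurable_fun setT (fun w => (c0%:E + (cA * A w)%:E)%E).
  by apply: emeasurable_funD.
have cA0' w : (0 <= (cA * A w)%:E)%E by rewrite lee_fin mulr_ge0.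
have cX0' w : (0 <= (cX * X w)%:E)%E by rewrite lee_fin mulr_ge0.
have scale (c : R) (Y : Om -> R) : 0 <= c -> measurable_fun setT Y ->
    (forall w, 0 <= Y w) -> (\int[P]_w (c * Y w)%:E = c%:E * \int[P]_w (Y w)%:E)%E.
  move=> c0' mY Y0; under eq_integral do rewrite EFinM.
  apply: ge0_integralZl_EFin => //; first by move=> w _; rewrite lee_fin.
  exact/measurable_EFinP.
under eq_integral do rewrite !EFinD.
rewrite ge0_integralD//; last by move=> w _; rewrite adde_ge0// lee_fin.
rewrite ge0_integralD// integral_cst//= probability_setT mule1 !EFinD !scale//.
rewrite !EFinM; apply: leeD; first by rewrite leeD2l// lee_wpmul2l// lee_fin.
by rewrite lee_wpmul2l// lee_fin.
Qed.

Lemma leq_double_ceil_half m : (m <= 2 * ((m + 1) %/ 2))%N.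
Proof.
rewrite addn1 divn2 mul2n -ltnS -{1}(odd_double_half m.+1).
by rewrite -[X in (_ <= X)%N]add1n leq_add2r; case: odd.
Qed.

Theorem theorem5p2 (R : realType) (d : nat) (hd : (0 < d)%N)
  (f : 'rV[R]_d -> R) (R1 R2 : R) (m : nat)
  (hSPB : SPB f R1 R2 m)
  (hinf : exists lb : R, forall x, lb <= f x)
  (delta : R) (hdelta : 0 < delta < 1)
  (T : nat) (hT : (0 < T)%N) (hTN : Nbreve d m R1 R2 delta <= T%:R)
  (dO : measure_display) (Omega : measurableType dO) (P : probability Omega R)
  (u : nat -> Omega -> 'rV[R]_d) (hu : iid_std_gaussian P u)
  (x0 : 'rV[R]_d) (x : nat -> Omega -> 'rV[R]_d)
  (hx0 : forall w, x 0%N w = x0)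
  (hxS : forall k w,
     let sigma := sigma_breve d m R1 R2 delta T in
     let gamma := sigma in
     let tau := gamma / Num.sqrt (T%:R + 1) in
     let v := (sigma^-1 * (f (x k w + sigma *: u k w) - f (x k w))) *: u k w in
     x k.+1 w = x k w - (tau / (enorm (x k w) ^+ (2 * m) + 1)) *: v) :
  let K := Kconst d m R1 R2 (f x0) (inf_f f) (enorm x0) in
  let Gdist := fun k w => setdist 0 (goldstein_subdiff f delta (x k w)) in
  (* (i) *)
  ((1 <= m)%N ->
   forall mu : R, 0 < mu ->
   argmin_set f !=set0 ->
   (exists B : R, forall w, argmin_set f w -> enorm w <= B) ->
   (forall y, f y - inf_f f >= mu / 2 * setdist y (argmin_set f) ^+ 2) ->
   let c := (2 * ((m + 1) %/ 2))%N in
   let q := minn m d in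
   let KO := 8 * mu^-1 * K + 4 * d%:R
             + 2 * sup [set enorm w ^+ 2 | w in argmin_set f] in
   exists2 k : nat, (k <= T)%N &
     (\int[P]_w (powR (Gdist k w) (c%:R^-1))%:E <=
      ((1 + Num.sqrt KO)
        * powR (2 * Num.sqrt K * powR (kappa1 d m R1 R2 delta) (- 2^-1) + 2) (c%:R^-1)
        / powR T%:R ((4^-1 - ((8 * q + 4)%:R)^-1) / c%:R))%:E)%E)
  /\
  (* (ii) *)
  (m = 0%N ->
   exists2 k : nat, (k <= T)%N &
     (\int[P]_w (Gdist k w)%:E <=
      ((2 * Num.sqrt K * powR (kappa2 d m R1 R2 delta) (- 2^-1) + 2)
        * powR T%:R (- (4^-1 - ((8 * d + 4)%:R)^-1)))%:E)%E).
Proof.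
move=> K Gdist; have [R10 R20 R1m lf _] := hSPB; have /andP[de0 de1] := hdelta.
have K0 : 0 < K by exact: (Kconst_gt0 hd f R1 R2 m hSPB hinf x0).
split.
- move=> m1 mu mu0 Sne Sbd qg c q KO.
  have R1p : 0 < R1.
    rewrite lt_neqAle R10 andbT; apply/eqP => /esym R1z.
    by move: m1; rewrite (R1m.1 R1z).
  pose kap : R := kappa1 d m R1 R2 delta.
  have kap0 : 0 < kap by exact: kappa1_gt0.
  have q0 : (0 < q)%N by rewrite leq_min m1 hd.
  pose eps : R := rate_eps T q; have eps0 : 0 < eps by exact: rate_eps_gt0.
  have eps1 : eps <= 1 by exact: rate_eps_le1.
  pose s := kap * eps; have s0 : 0 < s by rewrite mulr_gt0.
  have sE : sigma_breve d m R1 R2 delta T = s by rewrite /sigma_breve m1.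
  have s1 : s <= 1.
    apply: (rate_sigma_le1 T q hT kap (powR (Num.min (5 * R2) 1) (- (q%:R)^-1)) kap0).
    by move: hTN; rewrite /Nbreve m1.
  have hxS' k w : x k.+1 w = x k w -
      (s / Num.sqrt (T%:R + 1) / (enorm (x k w) ^+ (2 * m) + 1)) *:
        ((s^-1 * (f (x k w + s *: u k w) - f (x k w))) *: u k w).
    by have := hxS k w; rewrite /= sE.
  pose F := traj_smooth f P u hu s; pose G := traj_grad f P u hu s.
  pose th := eps ^+ q; have th0 : 0 < th by rewrite exprn_gt0.
  (* [lam ^+ 2] bounds the mean of [A] by [rate_grad]; [th] is the smoothing error. *)
  pose lam := Num.sqrt K * powR kap (- 2^-1) * th.
  have lam0 : 0 < lam by rewrite !mulr_gt0 ?sqrtr_gt0 ?powR_gt0.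
  pose Sup : R := sup [set enorm w ^+ 2 | w in argmin_set f].
  have Sup0 : 0 <= Sup.
    have [w0 Sw0] := Sne; have [B HB] := Sbd.
    apply: (@le_trans _ _ (enorm w0 ^+ 2)); first exact: sqr_ge0.
    apply: ub_le_sup; last by exists w0.
    exists (B ^+ 2) => _ [w' Sw' <-].
    by rewrite lerXn2r ?nnegrE ?HB// (le_trans _ (HB _ Sw')).
  have d0 : 0 < d%:R :> R by rewrite ltr0n.
  have mui0 : 0 <= 8 * mu^-1 by rewrite mulr_ge0// invr_ge0 ltW.
  have KO0 : 0 < KO.
    have : 0 <= 8 * mu^-1 * K by rewrite mulr_ge0// ltW.
    by rewrite /KO -/Sup; lra.
  pose kk := Num.sqrt KO; have kk0 : 0 < kk by rewrite sqrtr_gt0.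
  have kk2 : kk ^+ 2 = KO by rewrite sqr_sqrtr// ltW.
  have mc : (m <= c)%N by exact: leq_double_ceil_half.
  have c2 : (2 <= c)%N.
    by have := leq_trans m1 mc; rewrite /c; case: ((m + 1) %/ 2)%N => // n _; rewrite mulnS.
  have c0' : (0 < c)%N by exact: leq_trans c2.
  have p0 : 0 < c%:R^-1 :> R by rewrite invr_gt0 ltr0n.
  have p2 : c%:R^-1 <= 2^-1 :> R by rewrite lef_pV2 ?posrE ?ltr0n// ler_nat.
  have [c0 [cA [cX [c00 cA0 cX0 ctot hpt]]]] :=
    holder_linearized c%:R^-1 lam th kk p0 p2 lam0 th0 kk0.
  have [k kT hA] := trajectory_grad_min hd f R1 R2 m hSPB hinf P u hu T s s0 s1 x0 x hx0 hxS'.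
  have hF := trajectory_smooth_bound hd f R1 R2 m hSPB hinf P u hu T s s0 s1 x0 x hx0 hxS' k
    (leqW kT).
  have mcomp phi : econtinuous phi -> measurable_fun setT (fun w => phi (x k w)).
    by apply: (trajectory_comp_measurable f R1 R2 m hSPB P u hu T s x0 x hx0 hxS').
  exists k => //.
  pose A w := enorm (G (x k w)) ^+ 2 / (enorm (x k w) ^+ (2 * m) + 1).
  pose X w := enorm (x k w) ^+ 2.
  have A0 w : 0 <= A w.
    by rewrite divr_ge0 ?sqr_ge0// addr_ge0// exprn_ge0.
  have X0 w : 0 <= X w by exact: sqr_ge0.
  have mA : measurable_fun setT A.
    apply: (mcomp (fun y => enorm (G y) ^+ 2 / (enorm y ^+ (2 * m) + 1))).
    exact: (trajectory_gap_econtinuous f R1 R2 m hSPB hinf P u hu s s0).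
  have mX : measurable_fun setT X.
    by apply: (mcomp (fun y => enorm y ^+ 2)); apply: econtinuousX; exact: econtinuous_enorm.
  have hA' : (\int[P]_w (A w)%:E <= (lam ^+ 2)%:E)%E.
    apply: (le_trans hA); rewrite lee_fin.
    exact: (rate_grad T q hT q0 K kap K0 kap0).
  have hX : (\int[P]_w (X w)%:E <= (kk ^+ 2)%:E)%E.
    have mF : measurable_fun setT (fun w => F (x k w)).
      by apply: (mcomp F); exact: (traj_smooth_econtinuous f R1 R2 m hSPB hinf P u hu s s0).
    have F0 w : 0 <= F (x k w) by exact: traj_smooth_ge0.
    have cs0 : 0 <= 4 * d%:R + 2 * Sup by rewrite addr_ge0// mulr_ge0.
    (* Only one variable integrand occurs: [F] fills both slots and the second coefficient is 0. *)
    have := integral_affine_le P _ _ (4 * d%:R + 2 * Sup) (8 * mu^-1) 0 K K mF mF F0 F0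
      cs0 mui0 (lexx 0) hF hF.
    rewrite kk2 mul0r addr0.
    have -> : 4 * d%:R + 2 * Sup + 8 * mu^-1 * K = KO by rewrite /KO -/Sup; ring.
    apply: le_trans; apply: ge0_le_integral_nomeas => w; first by rewrite lee_fin.
    rewrite lee_fin mul0r addr0.
    have := quadratic_growth_traj f R1 R2 m hSPB hinf P u hu s s0 s1 mu (x k w) mu0 Sne Sbd qg.
    rewrite -/Sup -/(F _) /X; lra.
  have tot : (1 + kk) * powR (2 * lam + 2 * th) (c%:R^-1) =
      (1 + Num.sqrt KO)
        * powR (2 * Num.sqrt K * powR (kappa1 d m R1 R2 delta) (- 2^-1) + 2) (c%:R^-1)
        / powR T%:R ((4^-1 - ((8 * q + 4)%:R)^-1) / c%:R).
    rewrite -/kk -/kap -!mulrA; congr (_ * _).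
    have -> : 2 * lam + 2 * th = (2 * (Num.sqrt K * powR kap (- 2^-1)) + 2) * th.
      by rewrite /lam; ring.
    rewrite powRM ?(ltW th0)//; last first.
      by rewrite addr_ge0// mulr_ge0// mulr_ge0 ?sqrtr_ge0 ?powR_ge0.
    congr (_ * _); rewrite /th /eps (rate_theta T q hT q0) -powRrM mulNr powRN.
    by [].
  rewrite -tot; apply: (@le_trans _ _ (c0 + cA * lam ^+ 2 + cX * kk ^+ 2)%:E); last first.
    by rewrite lee_fin.
  apply: le_trans (integral_affine_le P A X c0 cA cX _ _ mA mX A0 X0 c00 cA0 cX0 hA' hX).
  apply: ge0_le_integral_nomeas => w; first by rewrite lee_fin powR_ge0.
  rewrite lee_fin /X.
  set y := enorm (x k w) ^+ m; have y0 : 0 <= y by rewrite exprn_ge0.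
  apply: (hpt (A w) (enorm (x k w)) (y + 1)) => //.
  + by rewrite addr_ge0.
  + exact: setdist_ge0.
  + have g1 := goldstein_traj hd f R1 R2 m hSPB hinf P u hu s s0 delta (x k w) de0.
    have g2 := goldstein_error_rate d m R1 R2 delta hd R10 R20 de0 s eps y m1 R1p (ltW s0)
      (ltW eps0) eps1 (lexx _) y0.
    rewrite -/(G _) -/y in g1; rewrite -/q -/th in g2.
    (* Undoes the normalization through sqrt(y^2 + 1) <= y + 1, so gradient and smoothing error
       share the factor y + 1. *)
    have gA : enorm (G (x k w)) <= Num.sqrt (A w) * (y + 1).
      have yE : enorm (x k w) ^+ (2 * m) = y ^+ 2 by rewrite mulnC exprM.
      have D0 : 0 < y ^+ 2 + 1 by rewrite ltr_wpDl// sqr_ge0.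
      have -> : enorm (G (x k w)) = Num.sqrt (A w) * Num.sqrt (y ^+ 2 + 1).
        by rewrite -sqrtrM// /A yE divfK ?gt_eqF// sqrtr_sqr ger0_norm.
      rewrite ler_wpM2l ?sqrtr_ge0//.
      have y1 : 0 <= y + 1 by rewrite addr_ge0.
      rewrite -[leRHS]ger0_norm// -sqrtr_sqr ler_wsqrtr//.
      rewrite !expr2; lra.
    rewrite /Gdist mulrDl; move: g1 g2 gA; lra.
  + exact: pow_add1_le.
- move=> m0.
  have R1z : R1 = 0 by exact: R1m.2.
  have mF : (0 < m)%N = false by rewrite m0.
  pose kap : R := kappa2 d m R1 R2 delta.
  have kap0 : 0 < kap by exact: kappa2_gt0.
  pose eps : R := rate_eps T d; have eps0 : 0 < eps by exact: rate_eps_gt0.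
  pose s := kap * eps; have s0 : 0 < s by rewrite mulr_gt0.
  have sE : sigma_breve d m R1 R2 delta T = s by rewrite /sigma_breve mF.
  have s1 : s <= 1.
    apply: (rate_sigma_le1 T d hT kap (powR (Num.min (5 * R2) 1) (- (d%:R)^-1)) kap0).
    by move: hTN; rewrite /Nbreve mF.
  have hxS' k w : x k.+1 w = x k w -
      (s / Num.sqrt (T%:R + 1) / (enorm (x k w) ^+ (2 * m) + 1)) *:
        ((s^-1 * (f (x k w + s *: u k w) - f (x k w))) *: u k w).
    by have := hxS k w; rewrite /= sE.
  pose G := traj_grad f P u hu s.
  pose th := eps ^+ d; have th0 : 0 < th by rewrite exprn_gt0.
  pose lam := Num.sqrt K * powR kap (- 2^-1) * th.
  have lam0 : 0 < lam by rewrite !mulr_gt0 ?sqrtr_gt0 ?powR_gt0.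
  have [k kT hA] := trajectory_grad_min hd f R1 R2 m hSPB hinf P u hu T s s0 s1 x0 x hx0 hxS'.
  exists k => //.
  pose A w := enorm (G (x k w)) ^+ 2 / (enorm (x k w) ^+ (2 * m) + 1).
  have A0 w : 0 <= A w.
    by rewrite divr_ge0 ?sqr_ge0// addr_ge0// exprn_ge0.
  have mA : measurable_fun setT A.
    apply: (trajectory_comp_measurable f R1 R2 m hSPB P u hu T s x0 x hx0 hxS'
      (fun y => enorm (G y) ^+ 2 / (enorm y ^+ (2 * m) + 1))).
    exact: (trajectory_gap_econtinuous f R1 R2 m hSPB hinf P u hu s s0).
  have hA' : (\int[P]_w (A w)%:E <= (lam ^+ 2)%:E)%E.
    apply: (le_trans hA); rewrite lee_fin.
    exact: (rate_grad T d hT hd K kap K0 kap0).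
  have c00 : 0 <= lam + th by rewrite addr_ge0 ?ltW.
  have cA0 : 0 <= (2 * lam)^-1 by rewrite invr_ge0 mulr_ge0// ltW.
  have := integral_affine_le P A A (lam + th) (2 * lam)^-1 0 (lam ^+ 2) (lam ^+ 2)
    mA mA A0 A0 c00 cA0 (lexx 0) hA' hA'.
  rewrite mul0r addr0 => hI.
  apply: (@le_trans _ _ (lam + th + (2 * lam)^-1 * lam ^+ 2)%:E); last first.
    rewrite lee_fin -(rate_theta T d hT hd) -/eps -/th -/kap.
    have -> : (2 * Num.sqrt K * powR kap (- 2^-1) + 2) * th = 2 * lam + 2 * th.
      by rewrite /lam; ring.
    have -> : (2 * lam)^-1 * lam ^+ 2 = lam / 2 by field; rewrite gt_eqF.
    by move: lam0 th0; lra.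
  apply: le_trans hI; apply: ge0_le_integral_nomeas => w.
    by rewrite lee_fin; exact: setdist_ge0.
  rewrite lee_fin mul0r addr0.
  have g1 := goldstein_traj hd f R1 R2 m hSPB hinf P u hu s s0 delta (x k w) de0.
  have g2 := goldstein_error_rate0 d m R1 R2 delta hd R10 R20 de0 s eps (ltW s0)
      (ltW eps0) (lexx _).
  rewrite -/(G _) in g1; rewrite -/th in g2.
  (* Tangent inequality in place of Jensen. For m = 0 the normalization is the constant 2, so |G|^2
     = 2 A. *)
  have gA : enorm (G (x k w)) <= lam + (2 * lam)^-1 * A w.
    have gE : enorm (G (x k w)) ^+ 2 = 2 * A w.
      by rewrite /A m0 muln0 expr0; field.
    have l2 : 0 < 2 * lam by rewrite mulr_gt0.
    rewrite -(ler_pM2l l2).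
    have -> : 2 * lam * (lam + (2 * lam)^-1 * A w) = 2 * lam ^+ 2 + A w.
      by field; rewrite gt_eqF.
    have := sqr_ge0 (enorm (G (x k w)) - 2 * lam); rewrite sqrrB gE !expr2; lra.
  have e1 : (R1 * (powR 2 (m%:R - 1) + 1) * enorm (x k w) ^+ m + 2 * R2) *
      (s / (3 / 4 * delta)) ^+ d * powR (d%:R + d%:R) (d%:R / 2) =
      2 * R2 * ((s / (3 / 4 * delta)) ^+ d * powR (d%:R + d%:R) (d%:R / 2)).
    by rewrite R1z !mul0r add0r mulrA.
  have e2 : 2 * R1 * powR 2 (m%:R - 1) * s ^+ m * powR (m%:R + d%:R) (m%:R / 2) = 0.
    by rewrite R1z mulr0 !mul0r.
  rewrite e1 e2 in g1; rewrite /Gdist; lra.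
Qed.
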